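(* Let $M=\mathbb{R}^4\times S^3$ be equipped with the coclosed $G_2$-structure determined by a function $A_1=A_2=A_3$ and a parameter $b_0>0$, as described in the context. There is an explicit $\mathrm{SU}(2)^3$-invariant $G_2$-instanton with gauge group $\mathrm{SU}(2)$ on $M$, given by $$\theta_0=\frac{A_1(t)\,e^{\int_{1/2}^tF(\xi)\,d\xi}}{\int_0^te^{\int_{1/2}^\eta F(\xi)\,d\xi}\,d\eta}\sum_{i=1}^3T_i\otimes\eta_i^+,\qquad F(t)=-\frac{\dot A_1}{A_1}+\frac1{A_1}-\frac{A_1}{B_1^2}.$$ It extends smoothly on the bundle $P_{\mathrm{id}}$ over the whole of $\mathbb{R}^4\times S^3$, and it corresponds to the parameter value $y_0=0$ in the 1-parameter family of $\mathrm{SU}(2)^3$-invariant $G_2$-instantons defined near the singular orbit and extending smoothly over it on $P_{\mathrm{id}}$ (parameter $y_0$ as defined in the context).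
   Context: Manifold. View $M=\mathbb{R}^4\times S^3\subset\mathbb{H}\times\mathbb{H}$ with $\mathrm{SU}(2)^2$ (pairs of unit quaternions) acting by $(a_1,a_2)\cdot(p,q)=(a_1p,a_1q\bar a_2)$. The singular orbit is $S^3=\{0\}\times S^3\cong \mathrm{SU}(2)^2/\Delta\mathrm{SU}(2)$, and its complement is identified with $(0,\infty)\times\mathrm{SU}(2)^2$ by $(t,(a_1,a_2))\mapsto(a_1t,a_1\bar a_2)$. Let $\{T_i\}_{i=1}^3$ be a basis of $\mathfrak{su}(2)$ with $[T_i,T_j]=2\epsilon_{ijk}T_k$ (a ''standard basis''), $T_i^{+}=(T_i,T_i)$, $T_i^-=(T_i,-T_i)$, and let $\eta_i^\pm$ be the dual left-invariant 1-forms on $\mathrm{SU}(2)^2$. A dot denotes $d/dt$. A function on $[0,\infty)$ is called odd (even) if its Taylor expansion at $0$ has only odd (even) powers. $G_2$-structure. Let $A_1:[0,\infty)\to\mathbb{R}$ be smooth, positive on $(0,\infty)$, odd at $0$, with $\dot A_1(0)=1/2$, and let $b_0>0$. Let $B_1$ be the positive smooth function on $[0,\infty)$, even at $0$, with $B_1(0)=b_0$ and $\frac{d}{dt}(A_1^2B_1^2)=A_1^3+A_1B_1^2$. Put $A_i=A_1$, $B_i=B_1$ for $i=1,2,3$. On $(0,\infty)\times \mathrm{SU}(2)^2$ set $\omega=4\sum_iA_iB_i\,\eta_i^-\wedge\eta_i^+$, $\Omega_1=8B_1B_2B_3\,\eta_1^-\wedge\eta_2^-\wedge\eta_3^- -8\sum_{cyc}A_iA_jB_k\,\eta_i^+\wedge\eta_j^+\wedge\eta_k^-$,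 $\Omega_2=-8A_1A_2A_3\,\eta_1^+\wedge\eta_2^+\wedge\eta_3^+ +8\sum_{cyc}B_iB_jA_k\,\eta_i^-\wedge\eta_j^-\wedge\eta_k^+$ (sums over cyclic permutations $(i,j,k)$ of $(1,2,3)$). The $G_2$-structure is $\varphi=dt\wedge\omega+\Omega_1$, with $\psi={*_\varphi}\varphi=\frac12\omega^2-dt\wedge\Omega_2$ and metric $dt^2+\sum_i(2A_i)^2\eta_i^+\otimes\eta_i^++\sum_i(2B_i)^2\eta_i^-\otimes\eta_i^-$; it extends smoothly to $M$ and $d\psi=0$. It is invariant under $\mathrm{SU}(2)^3$, where the third factor acts by $c\cdot(p,q)=(pc^{-1},q)$, i.e. $(t,(a_1,a_2))\mapsto(t,(a_1c^{-1},a_2c^{-1}))$. Instantons and bundles. A connection $A$ is a $G_2$-instanton if $F_A\wedge\psi=0$. $P_{\mathrm{id}}=\mathrm{SU}(2)^2\times_{(\Delta\mathrm{SU}(2),\mathrm{id})}\mathrm{SU}(2)$ denotes the homogeneous $\mathrm{SU}(2)$-bundle over the singular orbit with isotropy homomorphism the identity, pulled back to $M$ via the projection to the singular orbit. Away from the singular orbit it is equivariantly identified (via $(h,g)\mapsto[h,g]$) with the trivial bundle $(0,\infty)\times\mathrm{SU}(2)^2\times\mathrm{SU}(2)$, so invariant connections there are $\mathfrak{su}(2)$-valued 1-forms; ''extends smoothly on $P_{\mathrm{id}}$'' means that the connection extends to a smooth connection on $P_{\mathrm{id}}\to M$. $\mathrm{SU}(2)^3$-invariant means invariant under a lift of the $\mathrm{SU}(2)^3$-action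 extending the given $\mathrm{SU}(2)^2$-action on the bundle. Parameter $y_0$. Up to equivariant gauge transformation, $\mathrm{SU}(2)^3$-invariant $G_2$-instantons have the form $A_1x\sum_iT_i\otimes\eta_i^++B_1y\sum_iT_i\otimes\eta_i^-$ with $x,y$ functions of $t$; for those extending smoothly on $P_{\mathrm{id}}$, the parameter is $y_0=\lim_{t\to0}y(t)$. *)

(* Defs.v *)
From HB Require Import structures.
From mathcomp Require Import all_boot all_order all_algebra perm.
From mathcomp Require Import ring.
From mathcomp Require Import all_classical all_reals all_analysis.

Set Implicit Arguments.
Unset Strict Implicit.
Unset Printing Implicit Defensive.

Import Order.TTheory GRing.Theory Num.Theory numFieldNormedType.Exports.

Local Open Scope classical_set_scope.
Local Open Scope ring_scope.

(* Smooth maps and forms on an embedded submanifold [N] of [E] are represented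
   by maps and forms on [E] that are smooth near [N] (every smooth map or form
   on an embedded submanifold is the restriction of such a one); values away
   from [N], or on vectors not tangent to [N], carry no meaning, and equations
   between forms on [N] are only tested on tangent vectors. *)

Section Calculus.
Variable R : realType.
Implicit Types E W : normedModType R.

(* C^infinity on an open set: all iterated directional derivatives exist and
   are differentiable. *)
Definition smooth_on E W (O : set E) (f : E -> W) : Prop :=
  forall (vs : seq E) (x : E), O x ->
    differentiable (foldr (fun v (g : E -> W) => 'D_v g) f vs) x.

Definition smooth_near E W (N : set E) (f : E -> W) : Prop :=
  exists O : set E, [/\ open O, N `<=` O & smooth_on O f].

(* Tangent vectors are velocities of smooth curves lying in [N]. *)
Definition tangent E (N : set E) (x v : E) : Prop :=
  exists c : R -> E,
    [/\ smooth_on setT c, c 0 = x, \forall t \near 0, N (c t) & 'D_1 c 0 = v].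

Definition kform (k : nat) E W := E -> ('I_k -> E) -> W.

Definition multilinear k E W (a : ('I_k -> E) -> W) : Prop :=
  forall (v : 'I_k -> E) (i : 'I_k) (s : R) (u w : E),
    a (dfwith v i (s *: u + w)) =
    s *: a (dfwith v i u) + a (dfwith v i w).

Definition alternating k E W (a : ('I_k -> E) -> W) : Prop :=
  forall (v : 'I_k -> E) (i j : 'I_k), i != j -> v i = v j -> a v = 0.

Definition smooth_form k E W (N : set E) (a : kform k E W) : Prop :=
  exists O : set E, [/\ open O, N `<=` O,
    forall x, O x -> multilinear (a x) /\ alternating (a x)
    & forall v, smooth_on O (fun x => a x v)].

Definition form_eq k E W (N : set E) (a b : kform k E W) : Prop :=
  forall (x : E) (v : 'I_k -> E),
    N x -> (forall i, tangent N x (v i)) -> a x v = b x v.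

Definition pullback k E E' W (f : E -> E') (a : kform k E' W) : kform k E W :=
  fun x v => a (f x) (fun i => 'D_(v i) f x).

Definition dext k E W (a : kform k E W) : kform k.+1 E W :=
  fun x v => \sum_(i < k.+1)
    (-1) ^+ i *: 'D_(v i) (fun z => a z (fun j => v (lift i j))) x.

(* Normalised so that (a /\ b)(u, v) = a(u) b(v) - a(v) b(u) on 1-forms, which
   matches the normalisation of [dext]. *)
Definition wedge (k l : nat) E (W1 W2 : Type) (W3 : lmodType R)
    (op : W1 -> W2 -> W3) (a : E -> ('I_k -> E) -> W1)
    (b : E -> ('I_l -> E) -> W2) : E -> ('I_(k + l) -> E) -> W3 :=
  fun x v => ((k`! * l`!)%:R : R)^-1 *:
    \sum_(s : 'S_(k + l)) ((-1) ^+ s : R) *: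
       op (a x (fun i => v (s (lshift l i)))) (b x (fun j => v (s (rshift k j)))).

(* Smooth functions on [0, +oo) are restrictions of smooth functions on the
   line; the derivatives of [g] at 0 depend only on [f]. *)
Definition half_ext (f g : R -> R) : Prop :=
  smooth_on setT g /\ forall t, 0 <= t -> g t = f t.

Definition smooth_odd (f : R -> R) : Prop :=
  exists2 g, half_ext f g & forall n, derive1n n.*2 g 0 = 0.

Definition smooth_even (f : R -> R) : Prop :=
  exists2 g, half_ext f g & forall n, derive1n n.*2.+1 g 0 = 0.

Definition oint (f : R -> R) (a b : R) : R :=
  if a <= b then \int[lebesgue_measure]_(x in `[a, b]) f x
  else - \int[lebesgue_measure]_(x in `[b, a]) f x.

End Calculus.

(* [SU(2)] is the group of unit quaternions and [su(2)] the space of imaginary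
   quaternions with the commutator bracket. The norm of the quaternion algebra
   is [qnorm]; the norm of ['rV_4] as a normed module is the sup norm, which
   only serves for the topology. *)

Section Quaternions.
Variable R : realType.

Local Notation quat := 'rV[R]_4.

Definition qc (x : quat) (i : nat) : R := x ord0 (inord i).
Definition mkq (a b c d : R) : quat := \row_(i < 4) nth 0 [:: a; b; c; d] i.
Definition q1 : quat := mkq 1 0 0 0.
Definition qconj (x : quat) : quat :=
  mkq (qc x 0) (- qc x 1) (- qc x 2) (- qc x 3).
Definition qmul (x y : quat) : quat := mkq
  (qc x 0 * qc y 0 - qc x 1 * qc y 1 - qc x 2 * qc y 2 - qc x 3 * qc y 3)
  (qc x 0 * qc y 1 + qc x 1 * qc y 0 + qc x 2 * qc y 3 - qc x 3 * qc y 2)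
  (qc x 0 * qc y 2 - qc x 1 * qc y 3 + qc x 2 * qc y 0 + qc x 3 * qc y 1)
  (qc x 0 * qc y 3 + qc x 1 * qc y 2 - qc x 2 * qc y 1 + qc x 3 * qc y 0).
Definition qnorm (x : quat) : R := Num.sqrt (\sum_(i < 4) x ord0 i ^+ 2).
Definition qunit (x : quat) : Prop := qnorm x = 1.
Definition qim (x : quat) : Prop := qc x 0 = 0.
Definition qbracket (x y : quat) : quat := qmul x y - qmul y x.

End Quaternions.

Section Lemmas.
Variable R : realType.
Implicit Types x y z : 'rV[R]_4.

Lemma qc_mkq (a b c d : R) (i : nat) : (i < 4)%N ->
  qc (mkq a b c d) i = nth 0 [:: a; b; c; d] i.
Proof. by move=> i4; rewrite /qc mxE inordK. Qed.

Lemma qP x y : (forall i, (i < 4)%N -> qc x i = qc y i) -> x = y.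
Proof. 
move=> h; apply/rowP => i.
by have := h i (ltn_ord i); rewrite /qc inord_val.
Qed.

Lemma qmulA x y z : qmul x (qmul y z) = qmul (qmul x y) z.
Proof.
by apply: qP => -[|[|[|[|//]]]] _; rewrite /qmul !qc_mkq //=; ring.
Qed.

Lemma qmul1q x : qmul (q1 R) x = x.
Proof.
by apply: qP => -[|[|[|[|//]]]] _; rewrite /qmul /q1 !qc_mkq //=; ring.
Qed.

Lemma qmulq1 x : qmul x (q1 R) = x.
Proof.
by apply: qP => -[|[|[|[|//]]]] _; rewrite /qmul /q1 !qc_mkq //=; ring.
Qed.

Lemma qconjM x y : qconj (qmul x y) = qmul (qconj y) (qconj x).
Proof.
by apply: qP => -[|[|[|[|//]]]] _; rewrite /qconj /qmul !qc_mkq //=; ring.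
Qed.

Lemma qconjK x : qconj (qconj x) = x.
Proof.
by apply: qP => -[|[|[|[|//]]]] _; rewrite /qconj !qc_mkq //= opprK.
Qed.

Lemma qunit_sum x : qunit x ->
  qc x 0 ^+ 2 + qc x 1 ^+ 2 + qc x 2 ^+ 2 + qc x 3 ^+ 2 = 1.
Proof.
move=> u; have s0 : 0 <= \sum_(i < 4) x ord0 i ^+ 2.
  by apply: sumr_ge0 => i _; apply: sqr_ge0.
have := sqr_sqrtr s0; rewrite -/(qnorm x) u expr1n => ->.
rewrite !big_ord_recr big_ord0 /= add0r.
by congr (_ ^+ 2 + _ ^+ 2 + _ ^+ 2 + _ ^+ 2);
  congr (x _ _); apply: val_inj; rewrite /= inordK.
Qed.

Lemma qunit_of_sum x :
  qc x 0 ^+ 2 + qc x 1 ^+ 2 + qc x 2 ^+ 2 + qc x 3 ^+ 2 = 1 -> qunit x.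
Proof.
move=> s; rewrite /qunit /qnorm -[RHS]sqrtr1 -s; congr Num.sqrt.
rewrite !big_ord_recr big_ord0 /= add0r.
by congr (_ ^+ 2 + _ ^+ 2 + _ ^+ 2 + _ ^+ 2);
  congr (x _ _); apply: val_inj; rewrite /= inordK.
Qed.

Lemma qmulVq x : qunit x -> qmul (qconj x) x = q1 R.
Proof.
move=> /qunit_sum s.
apply: qP => -[|[|[|[|//]]]] _; rewrite /qmul /qconj /q1 !qc_mkq //=; try ring.
by rewrite -s; ring.
Qed.

Lemma qmulqV x : qunit x -> qmul x (qconj x) = q1 R.
Proof.
move=> /qunit_sum s.
apply: qP => -[|[|[|[|//]]]] _; rewrite /qmul /qconj /q1 !qc_mkq //=; try ring.
by rewrite -s; ring.
Qed.

Lemma qunitV x : qunit x -> qunit (qconj x).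
Proof.
move=> /qunit_sum s; apply: qunit_of_sum.
by rewrite -s /qconj !qc_mkq //= !sqrrN.
Qed.

Lemma qunitM x y : qunit x -> qunit y -> qunit (qmul x y).
Proof.
move=> /qunit_sum sx /qunit_sum sy; apply: qunit_of_sum.
rewrite -[RHS]mulr1 -{1}sx -sy /qmul !qc_mkq //=; ring.
Qed.

Lemma qunit1 : qunit (q1 R).
Proof. by apply: qunit_of_sum; rewrite /q1 !qc_mkq //=; ring. Qed.

End Lemmas.

Section Geometry.
Variable R : realType.
Local Notation H := 'rV[R]_4.

(* The neighbourhood [|p| < r] of the singular orbit of [M = R^4 x S^3];
   [M] itself is [Mfd +oo]. *)
Definition Mfd (r : \bar R) : set (H * H) :=
  [set m | ((qnorm m.1)%:E < r)%E /\ qunit m.2].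

(* The part [(0, r) x SU(2)^2] of the complement of the singular orbit, as a
   set of triples [(t, a1, a2)]. *)
Definition Reg (r : \bar R) : set (R * H * H) :=
  [set x | [/\ 0 < x.1.1, (x.1.1%:E < r)%E, qunit x.1.2 & qunit x.2]].

Definition reg_to_M (x : R * H * H) : H * H :=
  (x.1.1 *: x.1.2, qmul x.1.2 (qconj x.2)).

(* The associated bundle [SU(2)^2 x_(Delta SU(2), id) SU(2)] over [S^3],
   realised by the bijection [[(a1, a2), g] |-> (a1 a2^-1, a1 g)] onto pairs of
   unit quaternions (see [pid_fiber_inj] and [pid_fiber_surj]). *)
Definition pid_fiber (a1 a2 g : H) : H * H := (qmul a1 (qconj a2), qmul a1 g).

Lemma pid_fiber_inj (a1 a2 g b1 b2 h : H) :
  qunit a1 -> qunit a2 -> qunit g -> qunit b1 -> qunit b2 -> qunit h ->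
  pid_fiber a1 a2 g = pid_fiber b1 b2 h <->
  exists2 d, qunit d & [/\ b1 = qmul a1 d, b2 = qmul a2 d & h = qmul (qconj d) g].
Proof.
move=> ua1 ua2 ug ub1 ub2 uh; split => [[e1 e2]|[d ud [-> -> ->]]]; last first.
  rewrite /pid_fiber qconjM -!qmulA; congr (qmul _ _, qmul _ _).
    by rewrite qmulA qmulqV // qmul1q.
  by rewrite qmulA qmulqV // qmul1q.
exists (qmul (qconj a1) b1); first by apply: qunitM => //; apply: qunitV.
split; first by rewrite qmulA qmulqV // qmul1q.
- have : qmul a2 (qmul (qconj a1) (qmul b1 (qconj b2))) = q1 R.
    by rewrite -e1 [qmul (qconj a1) _]qmulA qmulVq // qmul1q qmulqV.
  move=> e; rewrite -[LHS]qmul1q -e -!qmulA; congr (qmul a2 (qmul _ _)).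
  by rewrite qmulVq // qmulq1.
- by rewrite qconjM qconjK -qmulA e2 qmulA qmulVq // qmul1q.
Qed.

Lemma pid_fiber_surj (q k : H) : qunit q -> qunit k ->
  exists a1 a2 g, [/\ qunit a1, qunit a2, qunit g & pid_fiber a1 a2 g = (q, k)].
Proof.
move=> uq uk; exists (q1 R), (qconj q), k; split=> //; first exact: qunit1.
  exact: qunitV.
by rewrite /pid_fiber qconjK !qmul1q.
Qed.

(* The pullback of this bundle along [(p, q) |-> q], over [Mfd r]: points
   [((p, q), k)] with [(p, q)] in [Mfd r] and [(q, k)] as above. *)
Definition Pid (r : \bar R) : set (H * H * H) :=
  [set x | Mfd r x.1 /\ qunit x.2].

Definition pid_proj (x : H * H * H) : H * H := x.1.

Definition pid_ract (g : H) (x : H * H * H) : H * H * H := (x.1, qmul x.2 g).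

(* Vector field generated by [X] in [su(2)] under the right action. *)
Definition pid_fund (X : H) (x : H * H * H) : H * H * H := (0, qmul x.2 X).

(* The given action of [SU(2)^2] on the bundle, [b . [a, g] = [b a, g]]. *)
Definition pid_lact (b1 b2 : H) (x : H * H * H) : H * H * H :=
  (qmul b1 x.1.1, qmul (qmul b1 x.1.2) (qconj b2), qmul b1 x.2).

(* The section [h |-> [h, 1]] over the complement of the singular orbit, which
   defines the equivariant trivialisation [(h, g) |-> [h, g]]. *)
Definition pid_sec (x : R * H * H) : H * H * H :=
  (reg_to_M x, (pid_fiber x.1.2 x.2 (q1 R)).2).

(* Lifts to the bundle of the action [c . (p, q) = (p c^-1, q)] of the third
   factor which, with [pid_lact], form an action of [SU(2)^3] by bundle
   automorphisms. *)
Definition lift3 (r : \bar R) (L : H -> H * H * H -> H * H * H) : Prop :=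
  [/\ smooth_near [set cx : H * (H * H * H) | qunit cx.1 /\ Pid r cx.2]
        (fun cx => L cx.1 cx.2),
      forall c x, qunit c -> Pid r x ->
        Pid r (L c x) /\ pid_proj (L c x) = (qmul x.1.1 (qconj c), x.1.2),
      forall c g x, qunit c -> qunit g -> Pid r x ->
        L c (pid_ract g x) = pid_ract g (L c x),
      (forall x, Pid r x -> L (q1 R) x = x) /\
      (forall c c' x, qunit c -> qunit c' -> Pid r x ->
        L (qmul c c') x = L c (L c' x))
    & forall c b1 b2 x, qunit c -> qunit b1 -> qunit b2 -> Pid r x ->
        L c (pid_lact b1 b2 x) = pid_lact b1 b2 (L c x)].

Definition connection (r : \bar R) (Th : kform 1 (H * H * H)%type H) : Prop :=
  [/\ smooth_form (Pid r) Th,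
      forall x v, Pid r x -> tangent (Pid r) x (v ord0) -> qim (Th x v),
      forall x X, Pid r x -> qim X -> Th x (fun=> pid_fund X x) = X
    & forall g, qunit g -> form_eq (Pid r) (pullback (pid_ract g) Th)
        (fun x v => qmul (qmul (qconj g) (Th x v)) g)].

Definition curvature (E : normedModType R) (th : kform 1 E H) : kform 2 E H :=
  fun x v => dext th x v
    + (2%:R : R)^-1 *: wedge (k := 1) (l := 1) (@qbracket R) th th x v.

Definition SU2_3_invariant (r : \bar R) (Th : kform 1 (H * H * H)%type H) : Prop :=
  exists L, [/\ lift3 r L,
    forall b1 b2, qunit b1 -> qunit b2 ->
      form_eq (Pid r) (pullback (pid_lact b1 b2) Th) Th
    & forall c, qunit c -> form_eq (Pid r) (pullback (L c) Th) Th].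

End Geometry.

Section G2.
Variable R : realType.
Local Notation H := 'rV[R]_4.
Local Notation E0 := (R * H * H)%type.

(* [ordS] is the cyclic successor on ['I_3]; by antisymmetry the three cyclic
   brackets give [T_i, T_j] = 2 eps_ijk T_k. *)
Definition standard_basis (T : 3.-tuple H) : Prop :=
  [/\ free T, forall i, qim (tnth T i)
    & forall i, qbracket (tnth T i) (tnth T (ordS i)) =
        (2%:R : R) *: tnth T (ordS (ordS i))].

Definition G2_data (A1 B1 : R -> R) (b0 : R) : Prop :=
  [/\ smooth_odd A1,
      forall t, 0 < t -> 0 < A1 t,
      (A1 t - A1 0) / t @[t --> 0^'+] --> (2%:R^-1 : R)
    & 0 < b0] /\
  [/\ smooth_even B1,
      forall t, 0 <= t -> 0 < B1 t,
      B1 0 = b0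
    & forall t, 0 < t ->
        derive1 (fun s => A1 s ^+ 2 * B1 s ^+ 2) t =
        A1 t ^+ 3 + A1 t * B1 t ^+ 2].

Variables (T : 3.-tuple H) (A1 B1 : R -> R).

Definition dt : kform 1 E0 R := fun x v => (v ord0).1.1.

(* [eta true i] is eta_i^+ and [eta false i] is eta_i^-, for the left-invariant
   coframe dual to (T_i, T_i), (T_i, -T_i); see [eta_dual]. *)
Definition eta (s : bool) (i : 'I_3) : kform 1 E0 R := fun x v =>
  let c1 := coord T i (qmul (qconj x.1.2) (v ord0).1.2) in
  let c2 := coord T i (qmul (qconj x.2) (v ord0).2) in
  (if s then c1 + c2 else c1 - c2) / 2%:R.

Lemma eta_dual (s s' : bool) (i j : 'I_3) (t u : R) (a1 a2 : H) :
  free T -> qunit a1 -> qunit a2 ->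
  eta s i (t, a1, a2) (fun=> (u, qmul a1 (tnth T j),
    qmul a2 (if s' then tnth T j else - tnth T j))) =
  ((s == s') && (i == j))%:R.
Proof.
move=> fT u1 u2; rewrite /eta /= !qmulA !qmulVq // !qmul1q.
have cT : coord T i (tnth T j) = (i == j)%:R.
  by rewrite (tnth_nth 0) coord_free // eq_sym.
case: s; case: s'; rewrite ?linearN /= !cT; case: (i == j) => //=;
  by rewrite ?subrr ?opprK ?addr0 ?subr0 ?oppr0 ?mul0r -?mulr2n ?divff ?pnatr_eq0.
Qed.

Definition wedgeR k l (a : kform k E0 R) (b : kform l E0 R) :
  kform (k + l) E0 R := wedge (fun x y => x * y) a b.

Definition omega : kform 2 E0 R := fun x v =>
  4%:R * \sum_(i < 3)
    A1 x.1.1 * B1 x.1.1 * wedgeR (eta false i) (eta true i) x v.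

Definition Omega2 : kform 3 E0 R := fun x v =>
  let A := A1 x.1.1 in let B := B1 x.1.1 in
  let e3 s1 i s2 j s3 k :=
    wedgeR (eta s1 i) (wedgeR (eta s2 j) (eta s3 k)) x v in
  let i1 := ord0 in let i2 := ordS i1 in let i3 := ordS i2 in
  - 8%:R * A ^+ 3 * e3 true i1 true i2 true i3
  + 8%:R * \sum_(i < 3)
      B ^+ 2 * A * e3 false i false (ordS i) true (ordS (ordS i)).

Definition psi : kform 4 E0 R := fun x v =>
  2%:R^-1 * wedgeR omega omega x v - wedgeR dt Omega2 x v.

(* [Psi] is the 4-form on [Mfd r] that restricts to [psi]. *)
Definition psi_ext (r : \bar R) (Psi : kform 4 (H * H)%type R) : Prop :=
  smooth_form (Mfd r) Psi /\
  form_eq (Reg r) (pullback (@reg_to_M R) Psi) psi.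

Definition curv_wedge (E : normedModType R) (th : kform 1 E H)
    (b : kform 4 E R) : kform 6 E H :=
  wedge (k := 2) (l := 4) (fun (X : H) (c : R) => c *: X) (curvature th) b.

Definition instanton_reg (r : \bar R) (th : kform 1 E0 H) : Prop :=
  form_eq (Reg r) (curv_wedge th psi) (fun _ _ => 0).

(* F /\ psi = 0 over the whole of [Mfd r], singular orbit included, for the
   curvature form on the total space and the pullback of psi to it. *)
Definition instanton_Pid (r : \bar R) (Th : kform 1 (H * H * H)%type H) : Prop :=
  forall Psi, psi_ext r Psi ->
    form_eq (Pid r)
      (curv_wedge Th (pullback (@pid_proj R) Psi)) (fun _ _ => 0).

(* The instanton [th] on [Reg r] extends, over the singular orbit, to an
   SU(2)^3-invariant G2-instanton on P_id over [Mfd r]. *)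
Definition inv_instanton_Pid (r : \bar R) (th : kform 1 E0 H) : Prop :=
  instanton_reg r th /\
  exists Th, [/\ connection r Th,
    form_eq (Reg r) (pullback (@pid_sec R) Th) th,
    SU2_3_invariant r Th & instanton_Pid r Th].

Definition ansatz (x y : R -> R) : kform 1 E0 H := fun z v =>
  (A1 z.1.1 * x z.1.1) *: (\sum_(i < 3) eta true i z v *: tnth T i)
  + (B1 z.1.1 * y z.1.1) *: (\sum_(i < 3) eta false i z v *: tnth T i).

(* Members, with parameter [y0] and defined for [0 < t < r], of the family of
   SU(2)^3-invariant instantons extending smoothly on P_id. *)
Definition Pid_family (r : \bar R) (y0 : R) (x y : R -> R) : Prop :=
  inv_instanton_Pid r (ansatz x y) /\ y t @[t --> 0^'+] --> y0.

Definition Ffun (t : R) : R :=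
  - derive1 A1 t / A1 t + (A1 t)^-1 - A1 t / B1 t ^+ 2.

Definition theta0 : kform 1 E0 H := fun z v =>
  let t := z.1.1 in
  (A1 t * expR (oint Ffun 2%:R^-1 t)
    / oint (fun s => expR (oint Ffun 2%:R^-1 s)) 0 t)
  *: \sum_(i < 3) eta true i z v *: tnth T i.

End G2.

(* Main.v *)
(* Write a connection of the ansatz as [f sum_i T_i eta_i^+ + g sum_i T_i eta_i^-]
   with [f = A1 x] and [g = B1 y]; on the regular part it is an instanton iff
     A1 B1^2 f' = B1^2 (f - f^2) + A1^2 (g^2 - f)  and  A1 g' = 2 (f - 1) g.
   For [g = 0] the first equation is the Riccati equation [x' = F x - x^2], whose
   solution [x = I / int_0^t I] with [I = exp (int F)] gives [theta0].  Since
   [A1] is odd with [A1'(0) = 1/2], this [f] is even, smooth and [f(0) = 1], so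
   [f = 1 - t^2 h] with [h] even and smooth.  In the coordinates [(p, q, k)] of
   the bundle [theta0] becomes the smooth connection
     k^-1 dk - k^-1 (h(|p|) Im (dp p^-) + f(|p|) / 2 dq q^-) k,
   and the instanton equation extends to the singular orbit by continuity.
   Conversely, a connection of the ansatz extending over the singular orbit has
   [f = 1 + t mu] with [mu] differentiable up to [t = 0], so the coefficient in
   [g' = (2 t mu / A1) g] is bounded and [g -> 0] forces [g = 0]; the
   difference of two solutions [f] then satisfies a linear equation with
   coefficient bounded above, and vanishes as well. *)
Require Import Defs.
From HB Require Import structures.
From mathcomp Require Import all_boot all_order all_algebra perm.
From mathcomp Require Import ring zify.
From mathcomp Require Import all_classical all_reals all_analysis.
Import Order.TTheory GRing.Theory Num.Theory numFieldNormedType.Exports.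
Set Implicit Arguments.
Unset Strict Implicit.
Unset Printing Implicit Defensive.
Local Open Scope classical_set_scope.
Local Open Scope ring_scope.

(** * Smooth maps on normed spaces *)

Section SmoothMaps.
Variable R : realType.
Implicit Types E W V : normedModType R.

(** The obstacle on the analytic side is that [|p|] is not smooth at [p = 0]. For even [h] the
    derivative of [h(|p|)] along [v] is [(h'/t)(|p|) <p, v>], and [h'/t] is again even and smooth,
    so everything rests on dividing smooth functions by [t]. The same division builds the profile:
    the zero of [A1] and the double zero of [int_0^t I] are factored out before the quotient is
    formed. The value [f(0) = 1] has its origin in [A1'(0) = 1/2], which makes [1/A1 - 2/t] smooth;
    then [F = 1/t + (odd smooth)], so that [I ~ c t], while [A1 I] and [int_0^t I] are both
    [~ c t^2 / 2]. On the algebraic side, a wedge product is a sum over all permutations of the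
    arguments. Forms are therefore rewritten as formal sums of monomials in a coframe, each monomial
    being a determinant; Laplace expansion turns wedge into concatenation, and [F /\ psi] is found
    by sorting lists of indices. The equation reaches [p = 0] with the six vectors held fixed,
    because the tangency conditions on the [q] and [k] components do not involve [p]. *)

Lemma smooth_on_differentiable E W (O : set E) (f : E -> W) x :
  smooth_on O f -> O x -> differentiable f x.
Proof. by move=> sf Ox; exact: (sf [::]). Qed.

Lemma smooth_on_derive E W (O : set E) (f : E -> W) v :
  smooth_on O f -> smooth_on O ('D_v f).
Proof. by move=> sf vs x Ox; have := sf (rcons vs v) x Ox; rewrite foldr_rcons. Qed.

(** Smoothness speaks of all iterated derivatives at once, so it is proved by exhibiting a class of
    functions that is stable under differentiation. The classes used below are existential and ask
    for equality on [O] only. *)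
Lemma smooth_on_class E W (O : set E) (P : (E -> W) -> Prop) f :
  (forall g, P g -> forall x, O x -> differentiable g x) ->
  (forall g v, P g -> P ('D_v g)) -> P f -> smooth_on O f.
Proof.
move=> dP DP Pf vs x Ox; apply: dP => //.
by elim: vs => //= v vs; exact: DP.
Qed.

Lemma smooth_on_sub E W (O O' : set E) (f : E -> W) :
  O `<=` O' -> smooth_on O' f -> smooth_on O f.
Proof. by move=> OO' sf vs x /OO'; exact: sf. Qed.

(** The epsilon form of the differential serves where no differentiation rule applies: at the
    junction of two glued functions and at the centre of a radial function. *)
Lemma is_diff_littleo V W (f : V -> W) (df : {linear V -> W}) x :
  continuous df ->
  (forall e, 0 < e -> \forall h \near 0, `|f (h + x) - f x - df h| <= e * `|h|) ->
  is_diff x f df.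
Proof.
move=> cdf H.
have E : f \o shift x = cst (f x) + df +o_ 0 id.
  apply/eqaddoP => e e0; near=> h.
  rewrite /= !fctE opprD addrA; near: h; exact: H.
have dE := diff_unique cdf E.
split=> //; apply/diff_locallyP; split; first by rewrite dE.
by rewrite dE.
Unshelve. all: by end_near. Qed.

Lemma diff_littleo V W (f : V -> W) x : differentiable f x ->
  forall e, 0 < e -> \forall h \near 0, `|f (h + x) - f x - 'd f x h| <= e * `|h|.
Proof.
move=> /diff_locallyP[_ /eqaddoP H] e /H; apply: filterS => h.
by rewrite /= !fctE opprD addrA.
Qed.

Lemma is_diff_near_eq V W (f g : V -> W) x :
  (\near x, f x = g x) -> differentiable f x -> is_diff x g ('d f x).
Proof.
move=> fg df; apply: is_diff_littleo; first exact: diff_continuous.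
move=> e /(diff_littleo df) H.
have fgx : f x = g x by exact: nbhs_singleton fg.
have fgh : \forall h \near 0, f (h + x) = g (h + x).
  by move: fg; rewrite (near_shift 0) /= subr0; apply: filterS => h.
by near=> h; rewrite -fgx -(_ : f (h + x) = g (h + x)); near: h.
Unshelve. all: by end_near. Qed.

Lemma near_eq_differentiable V W (f g : V -> W) x :
  (\near x, f x = g x) -> differentiable f x -> differentiable g x.
Proof. by move=> fg df; case: (is_diff_near_eq fg df). Qed.

Lemma open_near_eq V W (O : set V) (f g : V -> W) x : open O ->
  (forall y, O y -> f y = g y) -> O x -> \near x, f x = g x.
Proof. by move=> oO fg Ox; apply: filterS fg _; exact: open_nbhs_nbhs. Qed.

Lemma smooth_on_ext E W (O : set E) (f g : E -> W) : open O ->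
  (forall x, O x -> f x = g x) -> smooth_on O f -> smooth_on O g.
Proof.
move=> oO fg sf.
apply: (@smooth_on_class _ _ O (fun g => exists2 f, smooth_on O f &
    forall x, O x -> f x = g x)); last by exists f.
- move=> {}g [{}f {}sf {}fg] x Ox.
  apply: near_eq_differentiable (smooth_on_differentiable sf Ox).
  exact: open_near_eq Ox.
- move=> {}g v [{}f {}sf {}fg]; exists ('D_v f); first exact: smooth_on_derive.
  by move=> x Ox; apply: near_eq_derive; exact: open_near_eq Ox.
Qed.

Lemma smooth_on_cst E W (O : set E) (w : W) : smooth_on O (fun=> w).
Proof.
apply: (@smooth_on_class _ _ O (fun g => exists w, g = cst w)); last by exists w.
- by move=> _ [{}w ->] x _.
- by move=> _ v [{}w ->]; exists 0; apply/funext => x; rewrite derive_cst.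
Qed.

Lemma smooth_onD E W (O : set E) (f g : E -> W) : open O ->
  smooth_on O f -> smooth_on O g -> smooth_on O (fun x => f x + g x).
Proof.
move=> oO sf sg.
apply: (@smooth_on_class _ _ O (fun h => exists f g, [/\ smooth_on O f, smooth_on O g &
    forall x, O x -> f x + g x = h x])); last by exists f, g.
- move=> {sf sg}h {f g}[f [g [sf sg fg]]] x Ox.
  apply: (near_eq_differentiable (open_near_eq oO fg Ox)).
  exact: differentiableD (smooth_on_differentiable sf Ox) (smooth_on_differentiable sg Ox).
- move=> {sf sg}h v {f g}[f [g [sf sg fg]]]; exists ('D_v f), ('D_v g).
  split; [exact: smooth_on_derive|exact: smooth_on_derive|].
  move=> x Ox; rewrite -(near_eq_derive v (open_near_eq oO fg Ox)).
  rewrite -deriveD //; exact: diff_derivable (smooth_on_differentiable _ Ox).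
Qed.

Lemma smooth_on_sum E W (O : set E) (I : Type) (r : seq I) (f : I -> E -> W) :
  open O -> (forall i, smooth_on O (f i)) ->
  smooth_on O (fun x => \sum_(i <- r) f i x).
Proof.
move=> oO sf; elim: r => [|i r IH].
  by apply: (smooth_on_ext oO _ (smooth_on_cst 0)) => x _; rewrite big_nil.
by apply: (smooth_on_ext oO _ (smooth_onD oO (sf i) IH)) => x _; rewrite big_cons.
Qed.

Lemma smooth_onZl E W (O : set E) (f : E -> R) (w : W) : open O ->
  smooth_on O f -> smooth_on O (fun x => f x *: w).
Proof.
move=> oO sf.
apply: (@smooth_on_class _ _ O (fun h : E -> W => exists2 f : E -> R, smooth_on O f &
    forall x, O x -> f x *: w = h x)); last by exists f.
- move=> {sf}h {f}[f sf fh] x Ox.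
  apply: (near_eq_differentiable (open_near_eq oO fh Ox)).
  exact: differentiableZl (smooth_on_differentiable sf Ox).
- move=> {sf}h v {f}[f sf fh]; exists ('D_v f); first exact: smooth_on_derive.
  move=> x Ox; rewrite -(near_eq_derive v (open_near_eq oO fh Ox)).
  have dfx := smooth_on_differentiable sf Ox.
  rewrite [RHS]deriveE; last exact: differentiableZl.
  by rewrite diffZl // deriveE.
Qed.

Lemma smooth_on_pair E W V (O : set E) (f : E -> W) (g : E -> V) : open O ->
  smooth_on O f -> smooth_on O g -> smooth_on O (fun x => (f x, g x)).
Proof.
move=> oO sf sg.
apply: (@smooth_on_class _ _ O (fun h => exists f g, [/\ smooth_on O f, smooth_on O g &
    forall x, O x -> (f x, g x) = h x])); last by exists f, g.
- move=> {sf sg}h {f g}[f [g [sf sg fg]]] x Ox.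
  apply: (near_eq_differentiable (open_near_eq oO fg Ox)).
  exact: differentiable_pair (smooth_on_differentiable sf Ox) (smooth_on_differentiable sg Ox).
- move=> {sf sg}h v {f g}[f [g [sf sg fg]]]; exists ('D_v f), ('D_v g).
  split; [exact: smooth_on_derive|exact: smooth_on_derive|].
  move=> x Ox; rewrite -(near_eq_derive v (open_near_eq oO fg Ox)).
  have df := smooth_on_differentiable sf Ox; have dg := smooth_on_differentiable sg Ox.
  rewrite [RHS]deriveE; last exact: differentiable_pair.
  by rewrite diff_pair // !deriveE.
Qed.

Lemma smooth_on_comp_linear E W V (O : set E) (O' : set W) (p : {linear E -> W})
    (f : W -> V) : open O -> continuous p -> (forall x, O x -> O' (p x)) ->
  smooth_on O' f -> smooth_on O (fun x => f (p x)).
Proof.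
move=> oO cp OO' sf.
apply: (@smooth_on_class _ _ O (fun h => exists2 f, smooth_on O' f &
    forall x, O x -> f (p x) = h x)); last by exists f.
- move=> h {sf f}[f sf fh] x Ox; apply: (near_eq_differentiable (open_near_eq oO fh Ox)).
  apply: (@differentiable_comp _ _ _ _ p f); first exact: linear_differentiable.
  exact: smooth_on_differentiable (OO' _ Ox).
- move=> h v {sf f}[f sf fh]; exists ('D_(p v) f); first exact: smooth_on_derive.
  move=> x Ox; rewrite -(near_eq_derive v (open_near_eq oO fh Ox)).
  have df : differentiable f (p x) by exact: smooth_on_differentiable (OO' _ Ox).
  have dp : differentiable p x by exact: linear_differentiable.
  have dfp : differentiable (f \o p) x by exact: differentiable_comp.
  rewrite [RHS](deriveE _ dfp) diff_comp //= diff_lin //.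
  by rewrite deriveE.
Qed.

Lemma smooth_on_id E (O : set E) : smooth_on O (@id E).
Proof.
move=> vs x _; case: (lastP vs) => // {vs} vs v.
rewrite foldr_rcons; have -> : 'D_v (@id E) = fun=> v by apply/funext => y; rewrite derive_id.
exact: (smooth_on_cst (O := setT)).
Qed.

(* Sums, products and composites of smooth functions are handled at once: the
   algebra they generate is closed under directional derivatives, provided that
   the derivatives of the generators [B] lie in it. *)
Inductive smooth_alg E (O : set E) (B : (E -> R) -> Prop) : (E -> R) -> Prop :=
| alg_gen f : B f -> smooth_alg O B f
| alg_smooth f : smooth_on O f -> smooth_alg O B f
| alg_add f g : smooth_alg O B f -> smooth_alg O B g ->
    smooth_alg O B (fun x => f x + g x)
| alg_mul f g : smooth_alg O B f -> smooth_alg O B g ->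
    smooth_alg O B (fun x => f x * g x)
| alg_comp (g : R -> R) f : smooth_on setT g -> smooth_alg O B f ->
    smooth_alg O B (fun x => g (f x))
| alg_inv f : smooth_alg O B f -> (forall x, O x -> f x != 0) ->
    smooth_alg O B (fun x => (f x)^-1)
| alg_ext f g : smooth_alg O B f -> (forall x, O x -> f x = g x) ->
    smooth_alg O B g.

Lemma derive_comp1 V (g : R -> R) (f : V -> R) x v :
  differentiable f x -> differentiable g (f x) ->
  'D_v (fun x => g (f x)) x = 'D_v f x * 'D_1 g (f x).
Proof.
move=> df dg; have dgf : differentiable (g \o f) x by exact: differentiable_comp.
rewrite (deriveE _ dgf) diff_comp //= (deriveE _ df) (deriveE _ dg).
transitivity ('d g (f x) ('d f x v *: (1 : R))); last by rewrite linearZ.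
by rewrite [_ *: _]mulr1.
Qed.

Lemma smooth_alg_smooth E (O : set E) (B : (E -> R) -> Prop) f : open O ->
  (forall b, B b -> (forall x, O x -> differentiable b x) /\
     forall v, smooth_alg O B ('D_v b)) ->
  smooth_alg O B f -> smooth_on O f.
Proof.
move=> oO HB Bf.
have main g : smooth_alg O B g -> (forall x, O x -> differentiable g x) /\
    forall v, smooth_alg O B ('D_v g).
  elim=> {f g Bf}.
  - by move=> b /HB.
  - move=> f sf; split=> [x|v]; first exact: smooth_on_differentiable.
    by apply: alg_smooth; exact: smooth_on_derive.
  - move=> f g Bf [df Df] Bg [dg Dg]; split=> [x Ox|v].
      exact: differentiableD (df x Ox) (dg x Ox).
    apply: (alg_ext (alg_add (Df v) (Dg v))) => x Ox.
    by rewrite -deriveD //; apply: diff_derivable; [exact: df|exact: dg].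
  - move=> f g Bf [df Df] Bg [dg Dg]; split=> [x Ox|v].
      exact: differentiableM (df x Ox) (dg x Ox).
    apply: (alg_ext (alg_add (alg_mul Bf (Dg v)) (alg_mul Bg (Df v)))) => x Ox.
    by rewrite [RHS]deriveM //; apply: diff_derivable; [exact: df|exact: dg].
  - move=> g f sg Bf [df Df].
    have dg y : differentiable g y by exact: smooth_on_differentiable sg _.
    split=> [x Ox|v].
      by apply: (@differentiable_comp _ _ _ _ f g) => //; exact: df.
    have sg' : smooth_on setT ('D_1 g) by exact: smooth_on_derive.
    apply: (alg_ext (alg_mul (Df v) (alg_comp sg' Bf))) => x Ox.
    by rewrite (derive_comp1 v (df x Ox) (dg _)).
  - move=> f Bf [df Df] f0; split=> [x Ox|v].
      by apply: differentiableV; [exact: df|exact: f0].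
    have Bi := alg_inv Bf f0.
    have s1 : smooth_on O (fun _ : E => -1 : R) by exact: smooth_on_cst.
    apply: (alg_ext (alg_mul (alg_smooth B s1)
      (alg_mul (Df v) (alg_mul Bi Bi)))) => x Ox.
    rewrite [RHS]deriveV; [|exact: f0|exact: diff_derivable (df x Ox)].
    rewrite /= -[RHS]/(_ * _) -exprVn expr2; ring.
  - move=> f g Bf [df Df] fg; split=> [x Ox|v].
      exact: near_eq_differentiable (open_near_eq oO fg Ox) (df x Ox).
    apply: (alg_ext (Df v)) => x Ox.
    exact: near_eq_derive (open_near_eq oO fg Ox).
apply: (@smooth_on_class _ _ O (smooth_alg O B)) => //.
- by move=> g /main[].
- by move=> g v /main[].
Qed.

Lemma smooth_alg0 E (O : set E) f : open O ->
  smooth_alg O (fun=> False) f -> smooth_on O f.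
Proof. by move=> oO; apply: smooth_alg_smooth. Qed.

Lemma smooth_onM E (O : set E) (f g : E -> R) : open O ->
  smooth_on O f -> smooth_on O g -> smooth_on O (fun x => f x * g x).
Proof.
by move=> oO sf sg; apply: smooth_alg0 => //; apply: alg_mul; exact: alg_smooth.
Qed.

Lemma smooth_on_comp E (O : set E) (g : R -> R) (f : E -> R) : open O ->
  smooth_on setT g -> smooth_on O f -> smooth_on O (fun x => g (f x)).
Proof.
by move=> oO sg sf; apply: smooth_alg0 => //; apply: alg_comp => //; exact: alg_smooth.
Qed.

Lemma smooth_onV E (O : set E) (f : E -> R) : open O ->
  smooth_on O f -> (forall x, O x -> f x != 0) -> smooth_on O (fun x => (f x)^-1).
Proof.
by move=> oO sf f0; apply: smooth_alg0 => //; apply: alg_inv => //; exact: alg_smooth.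
Qed.

Lemma smooth_onN E (O : set E) (f : E -> R) : open O ->
  smooth_on O f -> smooth_on O (fun x => - f x).
Proof.
move=> oO sf; have s1 : smooth_on O (fun _ : E => -1 : R) by exact: smooth_on_cst.
apply: (smooth_on_ext oO _ (smooth_onM oO s1 sf)).
by move=> x _; rewrite mulN1r.
Qed.

Lemma smooth_onB E (O : set E) (f g : E -> R) : open O ->
  smooth_on O f -> smooth_on O g -> smooth_on O (fun x => f x - g x).
Proof. by move=> oO sf sg; apply: smooth_onD => //; exact: smooth_onN. Qed.

Lemma smooth_on_row E n (O : set E) (f : E -> 'rV[R]_n) : open O ->
  (forall i, smooth_on O (fun x => f x ord0 i)) -> smooth_on O f.
Proof.
move=> oO sf.
apply: (smooth_on_ext oO _ (smooth_on_sum (index_enum 'I_n) oO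
  (fun i => smooth_onZl (delta_mx ord0 i : 'rV[R]_n) oO (sf i)))) => x Ox.
by rewrite -row_sum_delta.
Qed.

Lemma is_der_add V W (f g : V -> W) x v df dg :
  is_derive x v f df -> is_derive x v g dg ->
  is_derive x v (fun y => f y + g y) (df + dg).
Proof. by move=> Hf Hg; exact: is_deriveD. Qed.

Lemma is_der_opp V W (f : V -> W) x v df :
  is_derive x v f df -> is_derive x v (fun y => - f y) (- df).
Proof. by move=> Hf; exact: is_deriveN. Qed.

Lemma is_der_sub V W (f g : V -> W) x v df dg :
  is_derive x v f df -> is_derive x v g dg ->
  is_derive x v (fun y => f y - g y) (df - dg).
Proof. by move=> Hf Hg; exact: is_deriveB. Qed.

Lemma is_der_cst V W (w : W) (x v : V) : is_derive x v (fun=> w) 0.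
Proof. exact: is_derive_cst. Qed.

Lemma is_der_mul V (f g : V -> R) x v df dg :
  is_derive x v f df -> is_derive x v g dg ->
  is_derive x v (fun y => f y * g y) (df * g x + f x * dg).
Proof.
move=> Hf Hg; rewrite addrC [df * _]mulrC; exact: (is_deriveM Hf Hg).
Qed.

Lemma is_der_mulc V (f : V -> R) x v (c df : R) :
  is_derive x v f df -> is_derive x v (fun y => c * f y) (c * df).
Proof. move=> Hf; exact: (@is_deriveZ _ _ _ f c x v df Hf). Qed.

Lemma is_der_expS V (f : V -> R) n x v (df : R) :
  is_derive x v f df ->
  is_derive x v (fun y => f y ^+ n.+1) (n.+1%:R * f x ^+ n * df).
Proof.
move=> Hf; have -> : (fun y => f y ^+ n.+1) = f ^+ n.+1.
  by apply/funext => y; rewrite exprfctE.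
exact: is_deriveX.
Qed.

Lemma is_der_inv V (f : V -> R) x v (df : R) : f x != 0 ->
  is_derive x v f df -> is_derive x v (fun y => (f y)^-1) (- df / f x ^+ 2).
Proof.
move=> f0 [dfx <-]; apply: DeriveDef; first exact: derivableV.
by rewrite deriveV //= -[LHS]/(_ * _) !mulNr mulrC.
Qed.

End SmoothMaps.

(** * Even and odd smooth functions *)

Section OneVariable.
Variable R : realType.
Implicit Types (f g u phi : R -> R) (x t l a b c : R).

Local Notation smooth1 f := (smooth_on [set: R] (f : R -> R)).

Lemma smooth1_derivable g x v : smooth1 g -> derivable g x v.
Proof. by move=> sg; apply: diff_derivable; exact: (smooth_on_differentiable sg). Qed.

Lemma smooth1_continuous g : smooth1 g -> continuous g.
Proof.
by move=> sg x; apply: differentiable_continuous; exact: (smooth_on_differentiable sg).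
Qed.

Lemma smooth1_is_derive g x : smooth1 g -> is_derive x 1 g (derive1 g x).
Proof. by move=> sg; apply: DeriveDef; [exact: smooth1_derivable|rewrite derive1E]. Qed.

Lemma smooth1_derive1 g : smooth1 g -> smooth1 (derive1 g).
Proof.
move=> sg; have -> : derive1 g = 'D_1 g by apply/funext => x; rewrite derive1E.
exact: smooth_on_derive.
Qed.

Lemma smooth1_class (P : (R -> R) -> Prop) f :
  (forall g, P g -> exists2 g', P g' & forall x, is_derive x 1 g (g' x)) ->
  P f -> smooth1 f.
Proof.
move=> dP Pf.
(* The derivative in direction [v] is [v] times the derivative in direction 1, hence the closure of
   [P] under scalar factors. *)
apply: (@smooth_on_class _ _ _ setT (fun h => exists c g, P g /\ h = (fun x => c * g x))).
- move=> _ [c [g [/dP[g' _ dg] ->]]] x _; apply: differentiableM => //.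
  by apply/derivable1_diffP; apply: ex_derive.
- move=> _ v [c [g [/dP[g' Pg' dg] ->]]]; exists (v * c), g'; split=> //.
  apply/funext => x.
  have dgx : differentiable g x by apply/derivable1_diffP; apply: ex_derive.
  have dcg : differentiable (fun x => c * g x) x by apply: differentiableM.
  rewrite (deriveE _ dcg).
  transitivity ('d (fun x => c * g x) x (v *: (1 : R))).
    by congr ('d _ x _); rewrite -[RHS]/(v * 1) mulr1.
  have [_ E] : is_derive x 1 (fun x => c * g x) (c * g' x).
    exact: (@is_deriveZ _ _ _ g c x 1 _ (dg x)).
  by rewrite linearZ /= -(deriveE _ dcg) E -[LHS]/(_ * _) mulrA.
- by exists 1, f; split=> //; apply/funext => x; rewrite mul1r.
Qed.

Definition glue f g t := if 0 <= t then f t else g t.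

Lemma is_derive_glue0 f g l : f 0 = g 0 ->
  is_derive (0 : R) (1 : R) f l -> is_derive (0 : R) (1 : R) g l ->
  is_derive (0 : R) (1 : R) (glue f g) l.
Proof.
move=> fg0 df dg.
have Df : differentiable f 0 by apply/derivable1_diffP; apply: ex_derive.
have Dg : differentiable g 0 by apply/derivable1_diffP; apply: ex_derive.
have dE (h : R -> R) : differentiable h 0 -> is_derive (0:R) (1:R) h l ->
    forall x, 'd h 0 x = x * l.
  move=> Dh dh x; transitivity ('d h 0 (x *: (1 : R))).
    by congr ('d h 0 _); rewrite -[RHS]/(x * 1) mulr1.
  by rewrite linearZ /= -deriveE // derive_val.
have E : 'd f 0 = 'd g 0 :> (R -> R) by apply/funext => x; rewrite !dE.
have H : is_diff (0 : R) (glue f g) ('d f 0).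
  apply: is_diff_littleo; first exact: diff_continuous.
  move=> e e0; have Hf := diff_littleo Df e0; have Hg := diff_littleo Dg e0.
  apply: filterS2 Hf Hg => h Hf Hg.
  by rewrite {1 2}/glue lexx; case: ifP => _; [exact: Hf|rewrite E fg0; exact: Hg].
case: H => H1 H2; apply: DeriveDef; first exact: diff_derivable.
by rewrite deriveE // H2 dE // mul1r.
Qed.

Lemma near_gt (a b : R) : a < b -> \forall x \near b, a < x.
Proof. by move=> ab; exact: lt_nbhsr. Qed.

Lemma near_lt (a b : R) : a < b -> \forall x \near a, x < b.
Proof. by move=> ab; exact: lt_nbhsl. Qed.

Lemma is_derive_glue f g df dg : f 0 = g 0 -> df 0 = dg 0 ->
  (forall t, 0 <= t -> is_derive t 1 f (df t)) ->
  (forall t, t <= 0 -> is_derive t 1 g (dg t)) ->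
  forall t, is_derive t 1 (glue f g) (glue df dg t).
Proof.
move=> fg0 dfg0 Df Dg t; rewrite /glue; case: (ltgtP t 0) => t0.
- apply: near_eq_is_derive (Dg t (ltW t0)).
  by near=> x; rewrite leNgt; case: ltP => //; rewrite leNgt; near: x; rewrite /=;
    apply: filterS (near_lt t0) => x ->.
- apply: near_eq_is_derive (Df t (ltW t0)).
  by apply: filterS (near_gt t0) => x /ltW ->.
- rewrite t0; apply: is_derive_glue0 => //; first exact: Df.
  by rewrite dfg0; exact: Dg.
Unshelve. all: by end_near. Qed.

(** The derivative of a gluing is the gluing of the derivatives, whose Taylor coefficients at 0
    agree again; gluings of this kind thus form a class stable under differentiation. *)
Lemma glue_smooth f g : smooth1 f -> smooth1 g ->
  (forall n, derive1n n f 0 = derive1n n g 0) -> smooth1 (glue f g).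
Proof.
move=> sf sg fg.
apply: (@smooth1_class (fun h => exists f g, [/\ smooth1 f, smooth1 g,
  forall n, derive1n n f 0 = derive1n n g 0 & h = glue f g])); last by exists f, g.
move=> _ {f g sf sg fg} [f [g [sf sg fg ->]]].
exists (glue (derive1 f) (derive1 g)).
  exists (derive1 f), (derive1 g); split => //; try exact: smooth1_derive1.
  by move=> n; rewrite -!derive1Sn fg.
apply: (is_derive_glue (fg 0%N : f 0 = g 0)) => [|t _|t _].
- by have := fg 1%N; rewrite !derive1n1.
- exact: smooth1_is_derive.
- exact: smooth1_is_derive.
Qed.

Lemma is_derive_comp1 f g x a b : is_derive (g x) 1 f a -> is_derive x 1 g b ->
  is_derive x 1 (fun y => f (g y)) (b * a).
Proof.
move=> df dg; rewrite mulrC; exact: (@is_derive1_comp _ f g x a b df dg).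
Qed.

Lemma is_derive_opp x : is_derive x 1 (fun t : R => - t) (-1).
Proof. exact: is_deriveNid. Qed.

Lemma smooth1_comp f g : smooth1 f -> smooth1 g -> smooth1 (fun t => f (g t)).
Proof. by move=> sf sg; apply: smooth_on_comp => //; exact: openT. Qed.

Lemma smooth1_id : smooth1 (fun t : R => t).
Proof. exact: smooth_on_id. Qed.

Lemma smooth1_opp f : smooth1 f -> smooth1 (fun t => f (- t)).
Proof.
move=> sf; apply: smooth1_comp => //.
by apply: smooth_onN; [exact: openT|exact: smooth1_id].
Qed.

Lemma smooth1Z c f : smooth1 f -> smooth1 (fun t => c * f t).
Proof.
by move=> sf; apply: smooth_onM => //; [exact: openT|exact: smooth_on_cst].
Qed.

Lemma derive1n_reflect n c f : smooth1 f ->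
  derive1n n (fun t => c * f (- t)) = fun t => c * (-1) ^+ n * derive1n n f (- t).
Proof.
elim: n c f => [|n IH] c f sf; first by rewrite expr0 mulr1.
rewrite derive1Sn (_ : derive1 _ = fun t => - c * derive1 f (- t)); last first.
  apply/funext => t; rewrite derive1E.
  have [_ ->//] : is_derive t 1 (fun t => c * f (- t)) (- c * derive1 f (- t)).
  have -> : - c * derive1 f (- t) = c *: (-1 * derive1 f (- t)).
    by rewrite -[RHS]/(_ * _); ring.
  apply: (@is_deriveZ _ _ _ (fun t => f (- t)) c t 1).
  exact: (is_derive_comp1 (smooth1_is_derive _ sf) (is_derive_opp t)).
rewrite IH; last exact: smooth1_derive1.
by apply/funext => t; rewrite derive1Sn exprS; ring.
Qed.

Definition odd_fun f := forall t, f (- t) = - f t.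
Definition even_fun f := forall t, f (- t) = f t.

(** The extension provided by [smooth_odd] has the parity of [f] only in its derivatives at 0 and is
    arbitrary on the negative half-line. Replacing that half by the reflection of the positive one
    keeps smoothness, since the vanishing derivatives are exactly those on which the two sides could
    disagree. *)
Lemma reflect_smooth_odd f : smooth_odd f ->
  exists g, [/\ smooth1 g, odd_fun g & forall t, 0 <= t -> g t = f t].
Proof.
move=> [g [sg gf] g0]; pose r := fun t => -1 * g (- t).
have g00 : g 0 = 0 by exact: (g0 0%N).
exists (glue g r); split.
- apply: glue_smooth => //; first by apply: smooth1Z; exact: smooth1_opp.
  move=> n; rewrite derive1n_reflect // oppr0.
  have [on|/negbTE en] := boolP (odd n).
    by rewrite -signr_odd on expr1; ring.
  by rewrite -[n]odd_double_half en add0n g0 mulr0.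
- move=> t; rewrite /glue /r oppr_ge0.
  case: (ltgtP t 0) => t0; rewrite ?opprK ?t0 ?oppr0 ?g00 ?oppr0 //; ring.
- by move=> t t0; rewrite /glue t0 gf.
Qed.

Lemma reflect_smooth_even f : smooth_even f ->
  exists g, [/\ smooth1 g, even_fun g & forall t, 0 <= t -> g t = f t].
Proof.
move=> [g [sg gf] g0]; pose r := fun t => 1 * g (- t).
exists (glue g r); split.
- apply: glue_smooth => //; first by apply: smooth1Z; exact: smooth1_opp.
  move=> n; rewrite derive1n_reflect // oppr0.
  have [on|/negbTE en] := boolP (odd n).
    by rewrite -[n]odd_double_half on add1n g0 mulr0.
  by rewrite -signr_odd en expr0; ring.
- move=> t; rewrite /glue /r oppr_ge0.
  by case: (ltgtP t 0) => t0; rewrite ?opprK ?t0 ?oppr0 ?mul1r.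
- by move=> t t0; rewrite /glue t0 gf.
Qed.

Lemma is_derive_cvg0 phi l : is_derive (0 : R) 1 phi l <->
  (phi t - phi 0) / t @[t --> (0 : R)^'] --> l.
Proof.
have E : (fun h : R => h^-1 *: ((phi \o shift 0) (h *: (1 : R)) - phi 0)) =
    (fun t : R => (phi t - phi 0) / t).
  apply/funext => h /=; rewrite -[LHS]/(_ * _) addr0 mulrC.
  by rewrite -[h *: 1]/(h * 1) mulr1.
split=> [[d <-]|H].
- by have := d; rewrite /derivable E /derive E.
- apply: DeriveDef; rewrite /derivable /derive E.
  + by apply/cvg_ex; exists l.
  + exact/cvg_lim.
Qed.

(* The derivatives of [u / t] at [t <> 0] all satisfy an equation
   [t phi' = u - n phi]; L'Hopital's rule for [t^n phi / t^n] then gives their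
   limits at 0. *)
Lemma hadamard_step n u phi (psi : R -> R) : smooth1 u ->
  phi 0 = u 0 / n.+1%:R -> {for 0, continuous phi} ->
  (forall t, t != 0 -> is_derive t 1 phi (psi t)) ->
  (forall t, t != 0 -> t * psi t = u t - n.+1%:R * phi t) ->
  is_derive (0 : R) 1 phi (derive1 u 0 / n.+2%:R) /\
  psi t @[t --> (0 : R)^'] --> derive1 u 0 / n.+2%:R.
Proof.
move=> su phi0 cphi dphi ephi; set L := derive1 u 0 / _.
have n2 : n.+2%:R != 0 :> R by rewrite pnatr_eq0.
have in11 : (0 : R) \in `]-1, 1[ by rewrite in_itv /= ltrN10 ltr01.
have psiL : psi t @[t --> (0 : R)^'] --> L.
  (* Off 0 the quotient [f / g] is [psi], and the equation for [psi] collapses the derivative of [f]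
     to [t^(n+1) u'], free of [psi]. The values of [df] and [dg] at 0 make [df / dg] equal to
     [u' / (n+2)] there too. *)
  pose f t := t ^+ n.+1 * (u t - n.+1%:R * phi t).
  pose df t := if t == 0 then L else t ^+ n.+1 * derive1 u t.
  pose g t : R := t ^+ n.+2.
  pose dg t : R := if t == 0 then 1 else n.+2%:R * t ^+ n.+1.
  have H : f x / g x @[x --> (0 : R)^'] --> L.
    apply: (@lhopital _ f df g dg (-1) 1 0 L in11).
    - move=> x /set_mem [_ /eqP x0]; rewrite /df (negbTE x0).
      apply: (is_derive_eq (is_der_mul (is_der_expS n (is_derive_id x 1))
        (is_der_sub (smooth1_is_derive x su) (is_der_mulc n.+1%:R (dphi _ x0))))).
      by rewrite -(ephi _ x0) exprS; ring.
    - move=> x /set_mem [_ /eqP x0]; rewrite /dg (negbTE x0).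
      by apply: (is_derive_eq (is_der_expS n.+1 (is_derive_id x 1))); rewrite mulr1.
    - rewrite [X in _ --> X](_ : _ = f 0); last by rewrite /f expr0n mul0r.
      apply: cvgM; first exact: exprn_continuous.
      apply: cvgB; first exact: smooth1_continuous.
      by apply: cvgM => //; exact: cvg_cst.
    - rewrite [X in _ --> X](_ : _ = g 0); last by rewrite /g expr0n.
      exact: exprn_continuous.
    - move=> x /set_mem [_ /eqP x0]; rewrite /dg (negbTE x0).
      by rewrite mulf_neq0 // expf_neq0.
    - rewrite (_ : (fun x => df x / dg x) = fun x => derive1 u x / n.+2%:R).
        apply: cvgM; last exact: cvg_cst.
        by apply: smooth1_continuous; exact: smooth1_derive1.
      apply/funext => x; rewrite /df /dg; case: eqP => [->|/eqP x0].
        by rewrite divr1.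
      have xn0 : x ^+ n.+1 != 0 by rewrite expf_neq0.
      by rewrite [_%:R * _]mulrC -mulf_div divff // mul1r.
  apply: cvg_trans H; apply: near_eq_cvg; near=> t.
  have t0 : t != 0 by near: t; exact: nbhs_dnbhs_neq.
  have tn0 : t ^+ n.+1 != 0 by rewrite expf_neq0.
  by rewrite /f /g -(ephi _ t0) [t ^+ n.+2]exprS; field; rewrite t0 tn0.
(* A function continuous at 0 whose derivative has a limit there is differentiable at 0 with that
   limit as derivative. *)
split=> //; apply/is_derive_cvg0.
rewrite (_ : (fun t => _) = fun t => (phi t - phi 0) / id t) //.
apply: (@lhopital _ _ (fun t => if t == 0 then L else psi t) id (cst 1) (-1) 1 0 L in11).
- move=> x /set_mem [_ /eqP x0]; rewrite (negbTE x0).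
  by apply: (is_derive_eq (is_der_sub (dphi _ x0) (is_der_cst (phi 0) x 1))); rewrite subr0.
- rewrite [X in _ --> X](_ : _ = phi 0 - phi 0); last by rewrite subrr.
  by apply: (cvgB cphi); exact: cvg_cst.
- exact: cvg_id.
- by move=> x _; rewrite /= oner_neq0.
- apply/cvgrPdist_lt => e e0.
  have := (cvgrPdist_lt _ _).1 psiL e e0; rewrite near_withinE => H.
  near=> t; rewrite /= divr1; case: (eqVneq t 0) => [_|].
    by rewrite subrr normr0.
  by near: t; exact: H.
Unshelve. all: by end_near. Qed.

Definition quot0 g t := if t == 0 then derive1 g 0 else g t / t.

Lemma quot0E g t : g 0 = 0 -> g t = t * quot0 g t.
Proof.
by move=> g0; rewrite /quot0; case: (eqVneq t 0) => [->|t0];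
  rewrite ?mul0r // mulrC divfK.
Qed.

Lemma dnbhs0_cvg f phi l : (forall t, t != 0 -> f t = phi t) ->
  f t @[t --> (0 : R)^'] --> l -> phi t @[t --> (0 : R)^'] --> l.
Proof.
move=> fphi; apply: cvg_trans; apply: near_eq_cvg; near=> t.
by rewrite fphi //; near: t; exact: nbhs_dnbhs_neq.
Unshelve. all: by end_near. Qed.

Lemma cvg_dnbhs0_continuous phi :
  phi t @[t --> (0 : R)^'] --> phi 0 -> {for 0, continuous phi}.
Proof.
move=> H; apply/cvgrPdist_lt => e e0.
have := (cvgrPdist_lt _ _).1 H e e0; rewrite near_withinE => {}H.
near=> t; case: (eqVneq t 0) => [->|]; first by rewrite subrr normr0.
by near: t; exact: H.
Unshelve. all: by end_near. Qed.

(** The stable class consists of the [phi], continuous at 0 with the value the equation forces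
    there, such that [t phi' = u - (n+1) phi] off 0 for some smooth [u]. The quotient [g / t]
    belongs to it with [n = 0] and [u = g']; differentiating the equation replaces [n] by [n+1] and
    [u] by [u']. *)
Lemma smooth_quot0 g : smooth1 g -> g 0 = 0 -> smooth1 (quot0 g).
Proof.
move=> sg g0.
apply: (@smooth1_class (fun phi => exists n u, [/\ smooth1 u,
  phi 0 = u 0 / n.+1%:R, {for 0, continuous phi} & exists psi : R -> R,
  forall t, t != 0 -> is_derive t 1 phi (psi t) /\
    t * psi t = u t - n.+1%:R * phi t])).
- move=> phi [n [u [su phi0 cphi [psi Hpsi]]]].
  have dp t : t != 0 -> is_derive t 1 phi (psi t) by case/Hpsi.
  have ep t : t != 0 -> t * psi t = u t - n.+1%:R * phi t by case/Hpsi.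
  have [d0 c0] := hadamard_step su phi0 cphi dp ep.
  pose psi' t := if t == 0 then derive1 u 0 / n.+2%:R else psi t.
  have psiE t : t != 0 -> psi t = psi' t by rewrite /psi' => /negbTE ->.
  exists psi'; last first.
    move=> x; rewrite /psi'; case: (eqVneq x 0) => [->//|x0].
    exact: dp.
  exists n.+1, (derive1 u); split; first exact: smooth1_derive1.
  + by rewrite /psi' eqxx.
  + apply: cvg_dnbhs0_continuous; rewrite {2}/psi' eqxx.
    exact: dnbhs0_cvg c0.
  + exists (fun t => (derive1 u t - n.+2%:R * psi t) / t) => t t0; split; last first.
      by rewrite -psiE // mulrC divfK.
    apply: (@near_eq_is_derive _ _ _ (fun t => (u t - n.+1%:R * phi t) / t)).
      near=> s; have s0 : s != 0.
        by near: s; apply: (@cvgr_neq0 _ _ _ _ _ id t) => //; exact: cvg_id.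
      by rewrite -ep // -psiE // mulrC mulKf.
    apply: (is_derive_eq (is_der_mul (is_der_sub (smooth1_is_derive t su)
      (is_der_mulc n.+1%:R (dp t t0)))
      (is_der_inv (f := fun s : R => s) (x := t) t0 (is_derive_id t 1)))).
    have -> : n.+2%:R = n.+1%:R + 1 :> R by rewrite natr1.
    rewrite -ep //; set N := n.+1%:R; field; exact: t0.
- exists 0%N, (derive1 g); split; first exact: smooth1_derive1.
  + by rewrite /quot0 eqxx divr1.
  + apply: cvg_dnbhs0_continuous; rewrite {2}/quot0 eqxx.
    apply: (@dnbhs0_cvg (fun t => (g t - g 0) / t)).
      by move=> t t0; rewrite /quot0 (negbTE t0) g0 subr0.
    exact/is_derive_cvg0/smooth1_is_derive.
  + exists (fun t => (derive1 g t - quot0 g t) / t) => t t0; split; last first.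
      by rewrite mul1r mulrC divfK.
    apply: (@near_eq_is_derive _ _ _ (fun t => g t / t)).
      near=> s; have s0 : s != 0.
        by near: s; apply: (@cvgr_neq0 _ _ _ _ _ id t) => //; exact: cvg_id.
      by rewrite /quot0 (negbTE s0).
    apply: (is_derive_eq (is_der_mul (smooth1_is_derive t sg)
      (is_der_inv (f := fun s : R => s) (x := t) t0 (is_derive_id t 1)))).
    by rewrite /quot0 (negbTE t0); field; exact: t0.
Unshelve. all: by end_near. Qed.

Lemma odd_fun0 g : odd_fun g -> g 0 = 0.
Proof.
move=> og; have := og 0; rewrite oppr0 => /eqP.
by rewrite -subr_eq0 opprK -mulr2n mulrn_eq0 /= => /eqP.
Qed.

Lemma quot0_even g : odd_fun g -> even_fun (quot0 g).
Proof. by move=> og t; rewrite /quot0 oppr_eq0 og invrN mulrNN. Qed.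

Lemma derive1_odd g : smooth1 g -> even_fun g -> odd_fun (derive1 g).
Proof.
move=> sg eg t.
have : is_derive t 1 (fun s => g (- s)) (-1 * derive1 g (- t)).
  exact: (is_derive_comp1 (smooth1_is_derive _ sg) (is_derive_opp t)).
rewrite (_ : (fun s => g (- s)) = g); last by apply/funext => s; rewrite eg.
by case=> _; rewrite -derive1E => ->; ring.
Qed.

Lemma quot0_odd g : smooth1 g -> even_fun g -> odd_fun (quot0 g).
Proof.
move=> sg eg t; rewrite /quot0 oppr_eq0; case: eqP => _.
  by rewrite (odd_fun0 (derive1_odd sg eg)) oppr0.
by rewrite eg invrN mulrN.
Qed.

Lemma antiderivative g : continuous g ->
  exists G : R -> R, G 0 = 0 /\ forall t, is_derive t 1 G (g t).
Proof.
(* Integrating from -1 makes 0 an interior point, which gives a two-sided derivative at every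
   [t >= 0]. The negative half-line is treated by reflection and glued on. *)
have half (h : R -> R) : continuous h -> exists G : R -> R, G 0 = 0 /\
    forall t, 0 <= t -> is_derive t 1 G (h t).
  move=> ch; pose G x := (\int[lebesgue_measure]_(s in `[-1, x]) h s)%R.
  exists (fun x => G x - G 0); rewrite subrr; split=> // t t0.
  have [] := @continuous_FTC1_closed R h (-1) t (t + 1).
  - by rewrite ltrDl.
  - apply: continuous_compact_integrable; first exact: segment_compact.
    exact: continuous_subspaceT.
  - by apply: lt_le_trans t0; rewrite ltrN10.
  - exact: ch.
  rewrite derive1E => dG eG.
  by apply: (is_derive_eq (is_der_sub (DeriveDef dG eG) (is_der_cst (G 0) t 1))); rewrite subr0.
move=> cg; have [G [G0 dG]] := half g cg.
have cg' : continuous (fun t => g (- t)).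
  by move=> t; apply: continuous_comp; [exact: opp_continuous|exact: cg].
have [K [K0 dK]] := half _ cg'.
exists (glue G (fun t => - K (- t))); split; first by rewrite /glue lexx.
move=> t; have -> : g t = glue g g t by rewrite /glue; case: ifP.
apply: is_derive_glue => //.
  by rewrite oppr0 K0 oppr0.
move=> {}t t0; have t0' : 0 <= - t by rewrite oppr_ge0.
apply: (is_derive_eq (is_der_opp (is_derive_comp1 (dK _ t0') (is_derive_opp t)))).
by rewrite opprK mulN1r opprK.
Qed.

Lemma antiderivative_smooth g G : smooth1 g ->
  (forall t, is_derive t 1 G (g t)) -> smooth1 G.
Proof.
move=> sg dG; apply: (@smooth1_class (fun h => smooth1 h \/ h = G)); last by right.
move=> h [sh|->]; last by exists g => //; left.
exists (derive1 h); first by left; exact: smooth1_derive1.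
by move=> x; exact: smooth1_is_derive.
Qed.

Lemma antiderivative_even g G : odd_fun g ->
  (forall t, is_derive t 1 G (g t)) -> even_fun G.
Proof.
move=> og dG t; apply/eqP; rewrite -subr_eq0; apply/eqP.
transitivity (G (- 0) - G 0); last by rewrite oppr0 subrr.
apply: (@is_derive_0_is_cst R (fun s => G (- s) - G s)) => s.
apply: (is_derive_eq (is_der_sub (is_derive_comp1 (dG _) (is_derive_opp s)) (dG s))).
by rewrite og mulN1r opprK subrr.
Qed.

End OneVariable.

(** * The Riccati profile *)

Section Profile.
Variable R : realType.
Implicit Types (f g u phi : R -> R) (x t l a b c : R).

Local Notation smooth1 f := (smooth_on [set: R] (f : R -> R)).

Lemma smooth1_expR : smooth1 (@expR R).
Proof.
apply: (@smooth1_class _ (fun h => h = @expR R)) => // _ ->.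
by exists (@expR R) => // x; exact: is_derive_expR.
Qed.

Lemma even_pos f : even_fun f -> (forall t, 0 <= t -> 0 < f t) -> forall t, 0 < f t.
Proof.
move=> ef f0 t; case: (leP 0 t) => [/f0//|t0].
by rewrite -ef f0 // oppr_ge0 ltW.
Qed.

Lemma continuous_off0 g : continuous g -> (forall t, t != 0 -> g t = 0) -> g 0 = 0.
Proof.
move=> cg g0.
have H1 : g t @[t --> (0 : R)^'] --> g 0.
  by apply: cvg_within_filter; exact: cg.
have H2 : g t @[t --> (0 : R)^'] --> (0 : R).
  by apply: (@dnbhs0_cvg _ (cst 0)) => [t /g0 ->//|]; exact: cvg_cst.
exact: cvg_unique H1 H2.
Qed.

(** Factoring the simple zero out of [A1] leaves an even positive function, so that every later
    division by [A1] is a division by [t] times a smooth function. *)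
Lemma G2_data_A (A1 B1 : R -> R) b0 : G2_data A1 B1 b0 ->
  exists aa : R -> R, [/\ smooth1 aa, even_fun aa, aa 0 = 2%:R^-1,
    forall t, 0 < aa t & forall t, 0 <= t -> A1 t = t * aa t].
Proof.
move=> [[oA A0 dA _] _].
have [A [sA Ao AE]] := reflect_smooth_odd oA.
have A00 := odd_fun0 Ao.
have AK t : 0 <= t -> A1 t = t * quot0 A t by move=> t0; rewrite -quot0E // AE.
have a0 : quot0 A 0 = 2%:R^-1.
  rewrite /quot0 eqxx.
  have := (is_derive_cvg0 _ _).1 (smooth1_is_derive 0 sA) => H.
  have H1 : (A t - A 0) / t @[t --> (0 : R)^'+] --> derive1 A 0.
    exact: cvg_dnbhs_at_right.
  apply: cvg_unique H1 _ => //=.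
  apply: cvg_trans dA; apply: near_eq_cvg; near=> t.
  by rewrite !AE // ltW.
have ev := quot0_even Ao.
exists (quot0 A); split => //; first exact: smooth_quot0.
apply: even_pos => // t; rewrite le_eqVlt => /predU1P[<-|t0].
  by rewrite a0 invr_gt0.
by rewrite /quot0 gt_eqF // divr_gt0 // AE ?A0 // ltW.
Unshelve. all: by end_near. Qed.

(** The bound [c] keeps the integral away from a singularity: it is used with [c = 0] for [Ffun],
    which behaves like [1/t], and with [c = -1] for a smooth integrand on [[0, t]]. *)
Lemma oint_FTC f F c : (forall t, c < t -> is_derive t 1 F (f t)) ->
  (forall t, c < t -> {for t, continuous f}) ->
  forall a b, c < a -> c < b -> oint f a b = F b - F a.
Proof.
move=> dF cf.
have main a b : c < a -> a <= b ->
    (\int[lebesgue_measure]_(x in `[a, b]) f x)%R = F b - F a.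
  move=> ca; rewrite le_eqVlt => /predU1P[->|ab].
    by rewrite subrr set_itv1 Rintegral_set1.
  have cb : c < b by exact: lt_trans ab.
  rewrite /Rintegral (@continuous_FTC2 _ f F a b ab) //.
  - apply: continuous_in_subspaceT => x /set_mem; rewrite /= in_itv /= => /andP[ax _].
    by apply: cf; exact: lt_le_trans ax.
  - have cF x : c < x -> {for x, continuous F}.
      move=> cx; apply: differentiable_continuous; apply/derivable1_diffP.
      by case: (dF _ cx).
    split.
    + move=> x; rewrite in_itv /= => /andP[ax _].
      by case: (dF _ (lt_trans ca ax)).
    + by apply: cvg_at_right_filter; exact: cF.
    + by apply: cvg_at_left_filter; exact: cF.
  - move=> x; rewrite in_itv /= => /andP[ax _].
    by rewrite derive1E; case: (dF _ (lt_trans ca ax)).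
move=> a b ca cb; rewrite /oint; case: leP => ab; first exact: main.
by rewrite main // ?opprB // ltW.
Qed.

Lemma near_eq_pos (f g : R -> R) t : 0 < t -> (forall s, 0 < s -> f s = g s) ->
  \forall s \near t, f s = g s.
Proof. by move=> t0 fg; apply: filterS (near_gt t0) => s; exact: fg. Qed.

Lemma G2_data_B (A1 B1 : R -> R) b0 : G2_data A1 B1 b0 ->
  exists B : R -> R, [/\ smooth1 B, even_fun B, forall t, 0 < B t
    & forall t, 0 <= t -> B1 t = B t].
Proof.
move=> [_ [eB B0 _ _]]; have [B [sB eB' BE]] := reflect_smooth_even eB.
exists B; split=> //; last by move=> t /BE.
by apply: even_pos => // t t0; rewrite BE // B0.
Qed.

(** With [A1 = t a], the term [- A1'/A1] contributes [- 1/t - a'/a] and [1/A1] contributes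
    [2/t + (1/a - 2)/t]. The last quotient is smooth and odd because [1/a] is even and equals 2 at
    0. *)
Lemma Ffun_split (A1 B1 : R -> R) b0 : G2_data A1 B1 b0 ->
  exists G : R -> R, [/\ smooth1 G, odd_fun G &
    forall t, 0 < t -> Ffun A1 B1 t = t^-1 + G t].
Proof.
move=> hG; have [aa [sa ea a0 apos AE]] := G2_data_A hG.
have [B [sB eB Bpos BE]] := G2_data_B hG.
have an0 t : aa t != 0 by rewrite gt_eqF.
have Bn0 t : B t != 0 by rewrite gt_eqF.
have oT := @openT R.
have sai : smooth1 (fun t => (aa t)^-1) by exact: smooth_onV.
pose k t := (aa t)^-1 - 2%:R.
have sk : smooth1 k by apply: smooth_onB => //; exact: smooth_on_cst.
have ek : even_fun k by move=> t; rewrite /k ea.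
have k0 : k 0 = 0 by rewrite /k a0 invrK subrr.
exists (fun t => quot0 k t - derive1 aa t * (aa t)^-1 - t * aa t * (B t ^+ 2)^-1); split.
- apply: smooth_onB => //; first apply: smooth_onB => //.
  + exact: smooth_quot0.
  + by apply: smooth_onM => //; exact: smooth1_derive1.
  + apply: smooth_onM => //; first by apply: smooth_onM => //; exact: smooth_on_id.
    apply: smooth_onV => // [|t _]; last by rewrite expf_neq0.
    exact: smooth_onM.
- move=> t; rewrite (quot0_odd sk ek) (derive1_odd sa ea) ea eB; ring.
move=> t t0; have tn0 : t != 0 by rewrite gt_eqF.
have dA : is_derive t 1 A1 (aa t + t * derive1 aa t : R).
  apply: (@near_eq_is_derive R R^o R^o (fun s : R => s * aa s)).
    by apply: near_eq_pos => // s s0; rewrite AE // ltW.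
  apply: (is_derive_eq (is_der_mul (is_derive_id t 1) (smooth1_is_derive t sa))).
  by rewrite mul1r.
rewrite /Ffun derive1E; case: dA => _ ->; rewrite AE ?ltW // BE ?ltW //.
rewrite /quot0 (negbTE tn0) /k; have := an0 t; have := Bn0 t; move: tn0.
by move=> h1 h2 h3; field; rewrite h1 h2 h3.
Qed.

Lemma profile (A1 B1 : R -> R) b0 : G2_data A1 B1 b0 ->
  exists f h : R -> R,
  [/\ smooth1 f, even_fun f, smooth1 h, even_fun h & forall t, f t = 1 - t ^+ 2 * h t]
  /\ (forall t, 0 < t -> A1 t * expR (oint (Ffun A1 B1) 2%:R^-1 t)
       / oint (fun s => expR (oint (Ffun A1 B1) 2%:R^-1 s)) 0 t = f t)
  /\ (forall t, 0 < t ->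
       is_derive t 1 f ((f t - f t ^+ 2) / A1 t - A1 t * f t / B1 t ^+ 2)).
Proof.
move=> hG; have [aa [sa ea a0 apos AE]] := G2_data_A hG.
have [G [sG oG FE]] := Ffun_split hG.
have [P [P0 dP]] := antiderivative (smooth1_continuous sG).
have sP := antiderivative_smooth sG dP; have eP := antiderivative_even oG dP.
(* Since [ln t + P] is a primitive of [Ffun], the exponential in [theta0] is [t * E t] up to a
   constant factor, which cancels in the quotient. *)
pose E t := expR (P t).
have sE : smooth1 E by apply: smooth1_comp => //; exact: smooth1_expR.
have eE : even_fun E by move=> t; rewrite /E eP.
have Epos t : 0 < E t by exact: expR_gt0.
have dE t : is_derive t 1 E (G t * E t).
  exact: (is_derive_comp1 (is_derive_expR (P t)) (dP t)).
have oT := @openT R; have sid : smooth1 (fun t => t) by exact: smooth1_id.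
have stE : smooth1 (fun t => t * E t) by exact: smooth_onM.
have otE : odd_fun (fun t => t * E t) by move=> t; rewrite eE mulNr.
have [J [J0 dJ]] := antiderivative (smooth1_continuous stE).
have sJ := antiderivative_smooth stE dJ; have eJ := antiderivative_even otE dJ.
(* The denominator [J] is even and vanishes at 0, hence is [t^2] times a smooth even function; with
   [A1 = t a] the powers of [t] cancel and leave [f = a E / K]. *)
pose K := quot0 (quot0 J).
have J'0 : quot0 J 0 = 0 by rewrite (odd_fun0 (quot0_odd sJ eJ)).
have JK t : J t = t ^+ 2 * K t.
  by rewrite (quot0E t J0) (quot0E t J'0) mulrA -expr2.
have sK : smooth1 K by do 2! apply: smooth_quot0 => //.
have eK : even_fun K by apply: quot0_even; exact: quot0_odd.
(* Differentiating [J = t^2 K] gives [2 K + t K' = E] off 0, and at 0 by continuity. Together with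
   [aa 0 = 1/2] this is what makes [f 0 = 1]. *)
have K0 : 2%:R * K 0 = E 0.
  apply/eqP; rewrite -subr_eq0; apply/eqP.
  transitivity (2%:R * K 0 + 0 * derive1 K 0 - E 0); first by rewrite mul0r addr0.
  apply: (@continuous_off0 (fun t => 2%:R * K t + t * derive1 K t - E t)).
    apply: smooth1_continuous; apply: smooth_onB => //; apply: smooth_onD => //.
      by apply: smooth_onM => //; exact: smooth_on_cst.
    by apply: smooth_onM => //; exact: smooth1_derive1.
  move=> t t0; have [_] := dJ t.
  have -> : J = (fun t => t ^+ 2 * K t) by apply/funext.
  have [_ ->] := is_der_mul (is_der_expS 1 (is_derive_id t 1)) (smooth1_is_derive t sK).
  move=> H; apply: (mulfI t0); rewrite mulr0 mulrBr -H; ring.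
have Jpos t : 0 < t -> 0 < J t.
  move=> t0; rewrite -J0.
  have dJ1 x : x \in `]0, t[ -> is_derive x 1 J (x * E x) by move=> _; exact: dJ.
  have [c] := MVT t0 dJ1 (continuous_subspaceT (smooth1_continuous sJ)).
  rewrite in_itv /= subr0 => /andP[c0 _] /eqP; rewrite subr_eq => /eqP ->.
  by rewrite ltrDr !mulr_gt0.
have Kpos t : 0 < K t.
  apply: even_pos t => // t; rewrite le_eqVlt => /predU1P[<-|t0].
    by rewrite -(@pmulr_rgt0 _ 2%:R) // K0.
  by rewrite -(@pmulr_rgt0 _ (t ^+ 2)) ?exprn_gt0 // -JK Jpos.
have Kn0 t : K t != 0 by rewrite gt_eqF.
pose f t := aa t * E t * (K t)^-1.
have sf : smooth1 f.
  by apply: smooth_onM => //; [exact: smooth_onM|exact: smooth_onV].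
have ef : even_fun f by move=> t; rewrite /f ea eE eK.
pose u t := 1 - f t.
have su : smooth1 u by apply: smooth_onB => //; exact: smooth_on_cst.
have eu : even_fun u by move=> t; rewrite /u ef.
have u0 : u 0 = 0.
  by rewrite /u /f a0 -K0 mulKf ?pnatr_eq0 // divff // subrr.
have u1 : quot0 u 0 = 0 by rewrite (odd_fun0 (quot0_odd su eu)).
exists f, (quot0 (quot0 u)); split; first split => //.
- by do 2! apply: smooth_quot0 => //.
- by apply: quot0_even; exact: quot0_odd.
- by move=> t; rewrite expr2 -mulrA -quot0E // -quot0E // /u; ring.
have fE t : 0 < t -> f t = A1 t * (t * E t) / J t.
  move=> t0; rewrite AE ?ltW // JK /f; have := Kn0 t.
  have tn0 : t != 0 by rewrite gt_eqF.
  by move=> h; field; rewrite h tn0.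
split=> t t0.
(* The constant is the value at the base point 1/2 of the primitive [ln + P]. *)
- pose c := expR (- (ln 2%:R^-1 + P 2%:R^-1)).
  have eF s : 0 < s -> expR (oint (Ffun A1 B1) 2%:R^-1 s) = c * (s * E s).
    move=> s0.
    have dF x : 0 < x -> is_derive x 1 (fun x => ln x + P x) (Ffun A1 B1 x).
      by move=> x0; rewrite FE //; apply: is_der_add (is_derive1_ln x0) (dP x).
    rewrite (oint_FTC dF) ?invr_gt0 //.
      by rewrite addrC expRD expRD lnK // /c.
    move=> x x0.
    have cG : {for x, continuous (fun x => x^-1 + G x)}.
      apply: cvgD; last exact: smooth1_continuous.
      by apply: cvgV; [rewrite gt_eqF|exact: cvg_id].
    apply: cvg_trans (_ : (fun x => x^-1 + G x) @ x --> Ffun A1 B1 x); last by rewrite FE.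
    apply: near_eq_cvg; apply: near_eq_pos => // s' s'0; rewrite FE //.
  have -> : oint (fun s => expR (oint (Ffun A1 B1) 2%:R^-1 s)) 0 t = c * J t.
    have dcJ x : -1 < x -> is_derive x 1 (fun x => c * J x) (c * (x * E x)).
      by move=> _; exact: is_der_mulc.
    have ccJ x : -1 < x -> {for x, continuous (fun x => c * (x * E x))}.
      by move=> _; apply: cvgM; [exact: cvg_cst|exact: (smooth1_continuous stE)].
    transitivity (oint (fun s => c * (s * E s)) 0 t); last first.
      have m1 : -1 < 0 :> R by rewrite ltrN10.
      by rewrite (oint_FTC dcJ ccJ) // ?(lt_trans m1) // J0 mulr0 subr0.
    (* [eF] says nothing at [s = 0], where the inner integral diverges, so the two integrals are
       compared on the half-open interval. *)
    rewrite /oint (ltW t0).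
    have ic : lebesgue_measure.-integrable `]0, t] (EFin \o (fun s => c * (s * E s))).
      suff ic0 : lebesgue_measure.-integrable `[0, t] (EFin \o (fun s => c * (s * E s))).
        by apply: integrableS ic0 => //; apply: subset_itvr; rewrite bnd_simp.
      apply: continuous_compact_integrable; first exact: segment_compact.
      by apply: continuous_subspaceT; exact/smooth1_continuous/smooth1Z.
    have eqE x : x \in `]0, t]%classic ->
        expR (oint (Ffun A1 B1) 2%:R^-1 x) = c * (x * E x).
      by rewrite inE /= in_itv /= => /andP[x0 _]; exact: eF.
    rewrite -!Rintegral_itv_obnd_cbnd //; first exact: eq_Rintegral.
    apply: eq_integrable ic => // x xi; rewrite /= eqE //.
  rewrite eF // fE //; have cn0 : c != 0 by rewrite gt_eqF ?expR_gt0.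
  have Jn0 : J t != 0 by rewrite gt_eqF // Jpos.
  by field; rewrite cn0 Jn0.
- have oA : 0 < A1 t by rewrite AE ?mulr_gt0 // ltW.
  have dA : is_derive t 1 A1 (derive1 A1 t).
    have D : is_derive t 1 (fun s : R => s * aa s) (1 * aa t + t * derive1 aa t : R).
      exact: (is_der_mul (is_derive_id t 1) (smooth1_is_derive t sa)).
    have [d _] : is_derive t 1 A1 (1 * aa t + t * derive1 aa t : R).
      apply: (@near_eq_is_derive R R^o R^o _ A1 t 1 _ _ D).
      by apply: near_eq_pos => // s s0; rewrite AE // ltW.
    by apply: DeriveDef => //; rewrite derive1E.
  apply: (@near_eq_is_derive R R^o R^o (fun s : R => A1 s * (s * E s) * (J s)^-1)).
    by apply: near_eq_pos => // s s0; rewrite fE.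
  have Jn0 : J t != 0 by rewrite gt_eqF // Jpos.
  apply: (is_derive_eq (is_der_mul (is_der_mul dA (is_der_mul (is_derive_id t 1) (dE t)))
    (is_der_inv Jn0 (dJ t)))).
  have -> : G t = Ffun A1 B1 t - t^-1 by rewrite FE // addrC addKr.
  have Bn0 : B1 t != 0 by case: hG => _ [_ B0 _ _]; rewrite gt_eqF // B0 // ltW.
  have An0 : A1 t != 0 by rewrite gt_eqF.
  have tn0 : t != 0 by rewrite gt_eqF.
  rewrite fE // /Ffun; move: (derive1 A1 t) => dA1.
  by field; rewrite Bn0 An0 tn0 Jn0.
Qed.

End Profile.

(** * Exterior products of linear forms *)

Section BlockPerm.
Variables (k l : nat).

Definition bperm_fun (s : 'S_k) (t : 'S_l) (i : 'I_(k + l)) : 'I_(k + l) :=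
  match fintype.split i with inl a => lshift l (s a) | inr b => rshift k (t b) end.

Lemma bperm_inj s t : injective (bperm_fun s t).
Proof.
move=> i j; rewrite /bperm_fun.
case: (split_ordP i) => a ->; case: (split_ordP j) => b -> e.
- by have /perm_inj -> := lshift_inj e.
- by move/eqP: e; rewrite eq_lrshift.
- by move/eqP: e; rewrite eq_rlshift.
- by have /perm_inj -> := rshift_inj e.
Qed.

Definition bperm s t : 'S_(k + l) := perm (@bperm_inj s t).

Lemma bpermL s t i : bperm s t (lshift l i) = lshift l (s i).
Proof. by rewrite permE /bperm_fun (unsplitK (inl i)). Qed.

Lemma bpermR s t j : bperm s t (rshift k j) = rshift k (t j).
Proof. by rewrite permE /bperm_fun (unsplitK (inr j)). Qed.

(** The sign is read off as the determinant of a block diagonal permutation matrix. *)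
Lemma sign_bperm (R : comNzRingType) s t :
  (-1) ^+ bperm s t = (-1) ^+ s * (-1) ^+ t :> R.
Proof.
rewrite -!det_perm -(@det_ublock _ _ _ _ 0); congr (\det _).
apply/matrixP => i j; rewrite !mxE.
case: (split_ordP i) => a ->; rewrite mxE; case: (split_ordP j) => b ->.
- by rewrite bpermL !mxE (inj_eq (@lshift_inj _ _)).
- by rewrite bpermL eq_lrshift mxE.
- by rewrite bpermR eq_rlshift mxE.
- by rewrite bpermR !mxE (inj_eq (@rshift_inj _ _)).
Qed.

End BlockPerm.

(** A pair [(a, b)] of permutations from the Leibniz expansions of the two minors is absorbed by
    composing [s] with the block permutation [bperm a b]. What remains for each of the [k! l!] pairs
    is one Leibniz expansion of [\det M]. *)
Lemma Laplace_sum (R : comNzRingType) (k l : nat) (M : 'M[R]_(k + l)) :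
  \sum_(s : 'S_(k + l)) (-1) ^+ s *
    (\det (\matrix_(i < k, j < k) M (lshift l i) (s (lshift l j))) *
     \det (\matrix_(i < l, j < l) M (rshift k i) (s (rshift k j)))) =
  (k`! * l`!)%:R * \det M.
Proof.
transitivity (\sum_(a : 'S_k) \sum_(b : 'S_l) \det M); last first.
  by rewrite !sumr_const !card_Sn -!mulrnA mulr_natl mulnC.
under eq_bigr => s _ do rewrite mulr_suml mulr_sumr.
rewrite exchange_big /=; apply: eq_bigr => a _.
under eq_bigr => s _ do rewrite mulr_sumr mulr_sumr.
rewrite exchange_big /=; apply: eq_bigr => b _.
rewrite [RHS](reindex_inj (mulgI (bperm a b))) /=; apply: eq_bigr => s _.
rewrite big_split_ord /= odd_permM signr_addb sign_bperm.
under [X in _ = _ * (X * _)]eq_bigr => i _ do rewrite permM bpermL.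
under [X in _ = _ * (_ * X)]eq_bigr => i _ do rewrite permM bpermR.
under [X in _ * (_ * X * _) = _]eq_bigr => i _ do rewrite mxE.
under [X in _ * (_ * (_ * X)) = _]eq_bigr => i _ do rewrite mxE.
have rearr (x y z p q : R) : x * ((y * p) * (z * q)) = y * z * x * (p * q) by ring.
exact: rearr.
Qed.

Section ExteriorAlgebra.
Variables (R : realType) (E : normedModType R) (cov : nat -> E -> R).
Implicit Types (s t : seq nat) (e : seq (R * seq nat)).

(* A formal form [e] is a list of pairs (coefficient, list of indices of
   covectors); [ev n e] is the n-form it denotes. *)
Definition mono n s (v : 'I_n -> E) : R :=
  \det (\matrix_(i < n, j < n) cov (nth 0%N s i) (v j)).

Definition ev n e (v : 'I_n -> E) : R := \sum_(p <- e) p.1 * mono p.2 v.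

Definition eprod e1 e2 : seq (R * seq nat) :=
  [seq (p.1 * q.1, p.2 ++ q.2) | p <- e1, q <- e2].

(** The normalisation of [wedge] is exactly what cancels the multiplicity in [Laplace_sum]. *)
Lemma mono_wedge k l s t (v : 'I_(k + l) -> E) : size s = k ->
  ((k`! * l`!)%:R : R)^-1 * \sum_(p : 'S_(k + l)) (-1) ^+ p *
    (mono s (fun i : 'I_k => v (p (lshift l i))) *
     mono t (fun j : 'I_l => v (p (rshift k j)))) = mono (s ++ t) v.
Proof.
move=> sk; pose M : 'M[R]_(k + l) := \matrix_(i, j) cov (nth 0%N (s ++ t) i) (v j).
rewrite /mono -[RHS]/(\det M).
have fk : (k`! * l`!)%:R != 0 :> R by rewrite pnatr_eq0 -lt0n muln_gt0 !fact_gt0.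
apply: (mulfI fk); rewrite -Laplace_sum mulrA divff // mul1r.
apply: eq_bigr => p _; congr (_ * _); congr (_ * _); congr (\det _).
  by apply/matrixP => i j; rewrite !mxE nth_cat /= sk ltn_ord.
by apply/matrixP => i j; rewrite !mxE nth_cat /= sk ltnNge leq_addr /= addKn.
Qed.

Lemma wedge_ev k l (P : E -> Prop) (a : E -> ('I_k -> E) -> R)
    (b : E -> ('I_l -> E) -> R) (x : E) e1 e2 :
  all (fun p => size p.2 == k) e1 ->
  (forall w, (forall i, P (w i)) -> a x w = ev e1 w) ->
  (forall w, (forall i, P (w i)) -> b x w = ev e2 w) ->
  forall v : 'I_(k + l) -> E, (forall i, P (v i)) ->
  wedge (fun c d : R => c * d : R^o) a b x v = ev (eprod e1 e2) v.
Proof.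
have rearr (y c m d n : R) : y * (c * m * (d * n)) = c * d * (y * (m * n)) by ring.
move=> /allP h1 ae be v Pv; rewrite /wedge.
transitivity (((k`! * l`!)%:R : R)^-1 * \sum_(p : 'S_(k + l))
  \sum_(q1 <- e1) \sum_(q2 <- e2) q1.1 * q2.1 * ((-1) ^+ p *
    (mono q1.2 (fun i : 'I_k => v (p (lshift l i))) *
     mono q2.2 (fun j : 'I_l => v (p (rshift k j)))))).
  rewrite -[LHS]/(_ * _); congr (_ * _); apply: eq_bigr => p _.
  rewrite -[LHS]/(_ * _) ae // be // /ev mulr_suml mulr_sumr.
  apply: eq_bigr => q1 _; rewrite mulr_sumr mulr_sumr; apply: eq_bigr => q2 _.
  exact: rearr.
rewrite exchange_big mulr_sumr /ev /eprod big_allpairs_dep big_seq [RHS]big_seq.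
apply: eq_bigr => q1 /h1 /eqP sq1; rewrite exchange_big mulr_sumr.
apply: eq_bigr => q2 _ /=; by rewrite -mono_wedge // -mulr_sumr mulrCA.
Qed.

Lemma ev_cons n p e (v : 'I_n -> E) : ev (p :: e) v = p.1 * mono p.2 v + ev e v.
Proof. by rewrite /ev big_cons. Qed.

Lemma ev_nil n (v : 'I_n -> E) : ev [::] v = 0.
Proof. by rewrite /ev big_nil. Qed.

Lemma ev_cat n e1 e2 (v : 'I_n -> E) : ev (e1 ++ e2) v = ev e1 v + ev e2 v.
Proof. by rewrite /ev big_cat. Qed.

Lemma mono1 a (v : 'I_1 -> E) : mono [:: a] v = cov a (v ord0).
Proof. by rewrite /mono det_mx11 mxE. Qed.

Lemma mono2 a b (v : 'I_2 -> E) : mono [:: a; b] v =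
  cov a (v ord0) * cov b (v (lift ord0 ord0)) - cov a (v (lift ord0 ord0)) * cov b (v ord0).
Proof.
rewrite /mono (expand_det_row _ ord0) !big_ord_recl big_ord0 /cofactor !det_mx11 !mxE /=.
have -> : lift (lift ord0 ord0) ord0 = ord0 :> 'I_2 by apply: val_inj.
rewrite expr0 expr1 /=; ring.
Qed.

Lemma mono_swap n (v : 'I_n -> E) s a b t : size (s ++ a :: b :: t) = n ->
  mono (s ++ a :: b :: t) v = - mono (s ++ b :: a :: t) v.
Proof.
move=> sn.
have i0n : (size s < n)%N by rewrite -sn size_cat /= -addSnnS leq_addr.
have i1n : ((size s).+1 < n)%N by rewrite -sn size_cat /= -!addSnnS leq_addr.
pose i0 := Ordinal i0n; pose i1 := Ordinal i1n.
have i01 : i0 != i1 by rewrite -val_eqE /= neq_ltn ltnSn.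
pose M : 'M[R]_n := \matrix_(i, j) cov (nth 0%N (s ++ b :: a :: t) i) (v j).
rewrite /mono -[X in - X]/(\det M).
transitivity (\det (row_perm (tperm i0 i1) M)); last first.
  by rewrite row_permE det_mulmx det_perm odd_tperm i01 expr1 mulN1r.
congr (\det _); apply/matrixP => i j; rewrite !mxE; congr (cov _ _).
case: tpermP => [->|->|]; rewrite !nth_cat /=.
- by rewrite ltnn subnn ltnNge leqnSn /= subSnn.
- by rewrite ltnn subnn ltnNge leqnSn /= subSnn.
move=> /eqP ni0 /eqP ni1; case: ltnP => // si.
have : (1 < i - size s)%N.
  move: ni0 ni1; rewrite -!val_eqE /= => ni0 ni1; lia.
by case: (i - size s)%N => [|[|]].
Qed.

Lemma mono_dup n (v : 'I_n -> E) s a t : size (s ++ a :: a :: t) = n ->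
  mono (s ++ a :: a :: t) v = 0.
Proof.
move=> sn; have := mono_swap v sn => /eqP.
by rewrite -subr_eq0 opprK -mulr2n mulrn_eq0 /= => /eqP.
Qed.

(** Insertion sort that records the parity of the transpositions; [None] signals a repeated index,
    that is, a vanishing monomial. *)
Fixpoint ins a s : option (bool * seq nat) :=
  if s is b :: s' then
    if (a < b)%N then Some (false, a :: s)
    else if a == b then None
    else if ins a s' is Some (c, m) then Some (~~ c, b :: m) else None
  else Some (false, [:: a]).

Fixpoint nf s : option (bool * seq nat) :=
  if s is a :: s' then
    if nf s' is Some (c, m) then
      if ins a m is Some (c', m') then Some (c (+) c', m') else None
    else None
  else Some (false, [::]).

Lemma ins_size a s c m : ins a s = Some (c, m) -> size m = (size s).+1.
Proof.
elim: s c m => [|b s IH] c m /=; first by case=> _ <-.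
case: ifP => _; first by case=> _ <-.
case: ifP => // _; case: (ins a s) IH => [[c' m']|] IH //.
by case=> _ <- /=; rewrite (IH _ _ erefl).
Qed.

Lemma nf_size s c m : nf s = Some (c, m) -> size m = size s.
Proof.
elim: s c m => [|a s IH] c m /=; first by case=> _ <-.
case: (nf s) IH => [[c' m']|] IH //.
case e : (ins a m') => [[c'' m'']|] // [_ <-].
by rewrite (ins_size e) (IH _ _ erefl).
Qed.

Definition signed (b : bool) (c : R) := if b then - c else c.

Lemma ins_correct n (v : 'I_n -> E) a t s : size (s ++ a :: t) = n ->
  mono (s ++ a :: t) v =
  if ins a t is Some (c, m) then signed c (mono (s ++ m) v) else 0.
Proof.
elim: t s => [|b t IH] s sn //=.
case: ifP => // _; case: eqP => [->|_]; first by rewrite mono_dup //; move: sn; rewrite !size_cat.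
rewrite mono_swap // -cat_rcons IH; last first.
  by rewrite -sn !size_cat size_rcons /=; lia.
case: (ins a t) => [[c m]|]; last by rewrite oppr0.
by rewrite cat_rcons; case: c; rewrite /= ?opprK.
Qed.

Lemma nf_correct n (v : 'I_n -> E) t s : size (s ++ t) = n ->
  mono (s ++ t) v =
  if nf t is Some (c, m) then signed c (mono (s ++ m) v) else 0.
Proof.
elim: t s => [|a t IH] s sn //=.
rewrite -cat_rcons IH ?cat_rcons //.
case e : (nf t) => [[c m]|] //; rewrite cat_rcons ins_correct; last first.
  by rewrite -sn !size_cat /= (nf_size e).
case: (ins a m) => [[c' m']|]; last by case: c {e}; rewrite /= ?oppr0.
by case: c {e}; case: c'; rewrite /= ?opprK.
Qed.

(** Equal monomials are not merged: once sorted they are syntactically the same, and ring arithmetic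
    collects their coefficients. *)
Fixpoint nfe e : seq (R * seq nat) :=
  if e is p :: e' then
    if nf p.2 is Some (c, m) then (signed c p.1, m) :: nfe e' else nfe e'
  else [::].

Lemma ev_nfe n e (v : 'I_n -> E) : all (fun p => size p.2 == n) e ->
  ev e v = ev (nfe e) v.
Proof.
elim: e => [|[c s] e IH] //= /andP[/eqP sn /IH {}IH].
rewrite ev_cons IH /= (@nf_correct n v s [::]) //=.
case: (nf s) => [[b m]|]; last by rewrite mulr0 add0r.
by rewrite ev_cons /=; case: b; rewrite /= ?mulNr ?mulrN.
Qed.

End ExteriorAlgebra.

(** * Quaternions, tangent spaces and curvature *)

Section QuaternionCalculus.
Variable R : realType.
Implicit Types V W : normedModType R.
Local Notation H := 'rV[R]_4.
Implicit Types (c : R).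

Lemma qcD (x y : H) i : qc (x + y) i = qc x i + qc y i.
Proof. by rewrite /qc mxE. Qed.

Lemma qcN (x : H) i : qc (- x) i = - qc x i.
Proof. by rewrite /qc mxE. Qed.

Lemma qcZ c (x : H) i : qc (c *: x) i = c * qc x i.
Proof. by rewrite /qc mxE. Qed.

Lemma qc0 i : qc (0 : H) i = 0.
Proof. by rewrite /qc mxE. Qed.

Definition qcE := (qcD, qcN, qcZ, qc0).

(** Linearity is requested in the shape in which it acts on a difference quotient, so that
    projections and coordinates can be supplied as plain functions. *)
Lemma is_der_linear V W W' (L : W -> W') (f : V -> W) x v df :
  (forall (c : R) u w, L (c *: (u - w)) = c *: (L u - L w)) -> continuous L ->
  is_derive x v f df -> is_derive x v (fun y => L (f y)) (L df).
Proof.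
move=> lL cL [dfx <-].
have E : (fun h : R => h^-1 *: (((fun y => L (f y)) \o shift x) (h *: v) - L (f x))) =
    L \o (fun h : R => h^-1 *: ((f \o shift x) (h *: v) - f x)).
  by apply/funext => h; rewrite /= lL.
have C : (fun h : R => h^-1 *: (((fun y => L (f y)) \o shift x) (h *: v) - L (f x)))
    @ (0 : R)^' --> L ('D_v f x).
  by rewrite E; apply: continuous_cvg => //; exact: cL.
apply: DeriveDef; first by apply/cvg_ex; exists (L ('D_v f x)).
exact/cvg_lim.
Qed.

Lemma is_der_fst V W W' (f : V -> W * W') x v df :
  is_derive x v f df -> is_derive x v (fun y => (f y).1) df.1.
Proof. by apply: is_der_linear => // -[u1 u2]; exact: cvg_fst. Qed.

Lemma is_der_snd V W W' (f : V -> W * W') x v df :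
  is_derive x v f df -> is_derive x v (fun y => (f y).2) df.2.
Proof. by apply: is_der_linear => // -[u1 u2]; exact: cvg_snd. Qed.

Lemma is_der_pair V W W' (f : V -> W) (g : V -> W') x v df dg :
  is_derive x v f df -> is_derive x v g dg ->
  is_derive x v (fun y => (f y, g y)) (df, dg).
Proof.
move=> [dfx <-] [dgx <-].
have C : (fun h : R => h^-1 *: (((fun y => (f y, g y)) \o shift x) (h *: v) - (f x, g x)))
    @ (0 : R)^' --> ('D_v f x, 'D_v g x).
  exact: (cvg_pair dfx dgx).
apply: DeriveDef; first by apply/cvg_ex; exists ('D_v f x, 'D_v g x).
exact/cvg_lim.
Qed.

Lemma qc_continuous i : continuous (fun x : H => qc x i).
Proof. exact: coord_continuous. Qed.

Lemma is_der_qc V (f : V -> H) x v df i :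
  is_derive x v f df -> is_derive x v (fun y => qc (f y) i) (qc df i).
Proof.
apply: (@is_der_linear V _ R^o (fun x : H => qc x i)); last exact: qc_continuous.
by move=> c u w; rewrite qcZ qcD qcN.
Qed.

Lemma is_der_quat V (f : V -> H) x v df :
  (forall i, (i < 4)%N -> is_derive x v (fun y => qc (f y) i) (qc df i)) ->
  is_derive x v f df.
Proof.
move=> Hf.
have Hf' i j : is_derive x v (fun y => f y i j) (df i j).
  have := Hf j (ltn_ord j); rewrite /qc (ord1 i).
  by rewrite inord_val.
have D : derivable f x v by apply/derivable_mxP => i j; case: (Hf' i j).
apply: DeriveDef => //; rewrite derive_mx //.
by apply/matrixP => i j; rewrite mxE; case: (Hf' i j).
Qed.

Lemma is_der_qmul V (f g : V -> H) x v df dg :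
  is_derive x v f df -> is_derive x v g dg ->
  is_derive x v (fun y => qmul (f y) (g y)) (qmul df (g x) + qmul (f x) dg).
Proof.
move=> Hf Hg.
have m i j := is_der_mul (is_der_qc i Hf) (is_der_qc j Hg).
apply: is_der_quat => -[|[|[|[|//]]]] _; rewrite /qmul qcD !qc_mkq //=;
  under eq_fun do rewrite qc_mkq //=.
- by apply: (is_derive_eq
    (is_der_sub (is_der_sub (is_der_sub (m 0 0) (m 1 1)) (m 2 2)) (m 3 3))%N); ring.
- by apply: (is_derive_eq
    (is_der_sub (is_der_add (is_der_add (m 0 1) (m 1 0)) (m 2 3)) (m 3 2))%N); ring.
- by apply: (is_derive_eq
    (is_der_add (is_der_add (is_der_sub (m 0 2) (m 1 3)) (m 2 0)) (m 3 1))%N); ring.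
- by apply: (is_derive_eq
    (is_der_add (is_der_sub (is_der_add (m 0 3) (m 1 2)) (m 2 1)) (m 3 0))%N); ring.
Qed.

Lemma is_der_qconj V (f : V -> H) x v df :
  is_derive x v f df -> is_derive x v (fun y => qconj (f y)) (qconj df).
Proof.
move=> Hf; have m i := is_der_qc i Hf.
apply: is_der_quat => -[|[|[|[|//]]]] _; rewrite /qconj qc_mkq //=;
  under eq_fun do rewrite qc_mkq //=; by [exact: m|exact: is_der_opp].
Qed.

Lemma is_der_scale V (f : V -> R) (g : V -> H) x v df dg :
  is_derive x v f df -> is_derive x v g dg ->
  is_derive x v (fun y => f y *: g y) (df *: g x + f x *: dg).
Proof.
move=> Hf Hg; apply: is_der_quat => i _; rewrite qcD !qcZ.
under eq_fun do rewrite qcZ.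
exact: (is_der_mul Hf (is_der_qc i Hg)).
Qed.

Lemma linear_quat_continuous W (L : {linear H -> W}) : continuous L.
Proof.
have oT := @openT H.
have -> : (L : H -> W) = (fun x => \sum_(i < 4) x ord0 i *: L (delta_mx ord0 i)).
  apply/funext => x; rewrite {1}(row_sum_delta x) linear_sum.
  by apply: eq_bigr => i _; rewrite linearZ.
move=> x; apply: differentiable_continuous; apply: (@smooth_on_differentiable _ _ _ setT) => //.
apply: smooth_on_sum => // i; apply: smooth_onZl => // vs y _.
case: (lastP vs) => [|vs' v]; first exact: differentiable_coord.
rewrite foldr_rcons; have -> : 'D_v (fun x : H => x ord0 i) = (fun=> v ord0 i).
  apply/funext => z; have := is_der_qc i (is_derive_id z v).
  by rewrite /qc inord_val; case.
exact: (@smooth_on_cst R H R^o setT).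
Qed.

End QuaternionCalculus.

(** * Tangent vectors of products of unit spheres *)

Section TangentSpaces.
Variable R : realType.
Local Notation H := 'rV[R]_4.
Implicit Types (a w x y : 'rV[R]_4).

(** The real part of [a^- w] is the Euclidean inner product, so for unit [a] this condition says
    that [w] is tangent to the sphere at [a]. *)
Lemma qim_conjM a w : qim (qmul (qconj a) w) <->
  qc a 0 * qc w 0 + qc a 1 * qc w 1 + qc a 2 * qc w 2 + qc a 3 * qc w 3 = 0.
Proof.
rewrite /qim (_ : qc _ 0 =
  qc a 0 * qc w 0 + qc a 1 * qc w 1 + qc a 2 * qc w 2 + qc a 3 * qc w 3) //.
by rewrite /qmul /qconj !qc_mkq //=; ring.
Qed.

Lemma unit_curve_derive (c : R -> H) w : is_derive (0 : R) 1 c w ->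
  (\forall t \near (0 : R), qunit (c t)) -> qim (qmul (qconj (c 0)) w).
Proof.
move=> dc uc; apply/qim_conjM.
have d := is_der_qc 0 (is_der_qmul (is_der_qconj dc) dc).
have c1 : \forall t \near (0 : R), (fun=> 1 : R) t = qc (qmul (qconj (c t)) (c t)) 0.
  by apply: filterS uc => t ut; rewrite qmulVq // qc_mkq.
have [_] := near_eq_is_derive c1 (is_der_cst (1 : R^o) (0 : R) (1 : R)).
case: d => _ ->; rewrite qcD /qmul /qconj !qc_mkq //= => e.
have two : 2%:R != 0 :> R by rewrite pnatr_eq0.
by apply: (mulfI two); rewrite mulr0 -[RHS]e; ring.
Qed.

(** The great circle through [a] with velocity [w], for unit [a] and [w] orthogonal to it; it is
    constant when [w = 0]. *)
Definition ucurve a w (s : R) : H :=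
  cos (qnorm w * s) *: a + ((qnorm w)^-1 * sin (qnorm w * s)) *: w.

Lemma qnorm_sqr x :
  qnorm x ^+ 2 = qc x 0 ^+ 2 + qc x 1 ^+ 2 + qc x 2 ^+ 2 + qc x 3 ^+ 2.
Proof.
rewrite sqr_sqrtr; last by apply: sumr_ge0 => i _; apply: sqr_ge0.
rewrite !big_ord_recr big_ord0 /= add0r.
by congr (_ ^+ 2 + _ ^+ 2 + _ ^+ 2 + _ ^+ 2);
  congr (x _ _); apply: val_inj; rewrite /= inordK.
Qed.

Lemma qnorm_ge0 x : 0 <= qnorm x. Proof. exact: sqrtr_ge0. Qed.

Lemma qnorm_eq0 x : qnorm x = 0 -> x = 0.
Proof.
move=> x0; have := qnorm_sqr x; rewrite x0 expr0n /= => /esym/eqP.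
rewrite !paddr_eq0 ?sqr_ge0 ?addr_ge0 ?sqr_ge0 // !sqrf_eq0 => /andP[/andP[/andP[]]].
move=> /eqP h0 /eqP h1 /eqP h2 /eqP h3.
by apply: qP => -[|[|[|[|//]]]] _; rewrite qc0.
Qed.

Lemma ucurve_unit a w s : qunit a -> qim (qmul (qconj a) w) -> qunit (ucurve a w s).
Proof.
move=> /qunit_sum ua /qim_conjM aw; apply: qunit_of_sum; rewrite !qcE.
have := qnorm_sqr w; rewrite /ucurve; set m := qnorm w => em.
case: (eqVneq m 0) => [m0|m0].
  have w0 : w = 0 by exact: qnorm_eq0.
  rewrite w0 m0 !mul0r cos0 sin0 !mulr0 !qcE !mulr0 !mul1r !addr0; exact: ua.
set C := cos _; set S := sin _.
have CS : C ^+ 2 + S ^+ 2 = 1 by rewrite /C /S cos2Dsin2.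
transitivity (C ^+ 2 * (qc a 0 ^+ 2 + qc a 1 ^+ 2 + qc a 2 ^+ 2 + qc a 3 ^+ 2)
  + 2%:R * C * (m^-1 * S) * (qc a 0 * qc w 0 + qc a 1 * qc w 1 + qc a 2 * qc w 2 + qc a 3 * qc w 3)
  + (m^-1 * S) ^+ 2 * (qc w 0 ^+ 2 + qc w 1 ^+ 2 + qc w 2 ^+ 2 + qc w 3 ^+ 2)).
  ring.
rewrite ua aw -em -[RHS]CS; field; exact: m0.
Qed.

Lemma ucurve0 a w : ucurve a w 0 = a.
Proof. by rewrite /ucurve mulr0 cos0 sin0 mulr0 scale0r scale1r addr0. Qed.

Lemma smooth1_trig : smooth_on [set: R] (@cos R) /\ smooth_on [set: R] (@sin R).
Proof.
pose P (h : R -> R) := exists c d : R, h = (fun t => c * cos t + d * sin t).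
have sP h : P h -> smooth_on [set: R] h.
  apply: (@smooth1_class R P) => _ [c [d ->]].
  exists (fun t => d * cos t + (- c) * sin t); first by exists d, (- c).
  move=> x; apply: (is_derive_eq (is_der_add (is_der_mulc c (is_derive_cos x))
    (is_der_mulc d (is_derive_sin x)))); ring.
split; apply: sP.
  by exists 1, 0; apply/funext => t; ring.
by exists 0, 1; apply/funext => t; ring.
Qed.

Lemma smooth_ucurve a w : smooth_on setT (ucurve a w).
Proof.
have oT := @openT R; have [sc ss] := smooth1_trig.
have sm : smooth_on setT (fun s : R => qnorm w * s).
  by apply: smooth1Z; exact: smooth1_id.
apply: smooth_onD => //; apply: smooth_onZl => //; first exact: smooth_on_comp.
by apply: smooth1Z; exact: smooth_on_comp.
Qed.

Lemma is_der_ucurve a w : is_derive (0 : R) 1 (ucurve a w) w.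
Proof.
have dm : is_derive (0 : R) 1 (fun s : R => qnorm w * s) (qnorm w).
  apply: (is_derive_eq (is_der_mulc (qnorm w) (is_derive_id (0 : R) 1))); exact: mulr1.
have dc := is_derive_comp1 (is_derive_cos _) dm.
have ds := is_der_mulc (qnorm w)^-1 (is_derive_comp1 (is_derive_sin _) dm).
apply: (is_derive_eq (is_der_add (is_der_scale dc (is_der_cst a _ _))
  (is_der_scale ds (is_der_cst w _ _)))).
rewrite !mulr0 sin0 cos0 oppr0 !mulr0 scale0r !scaler0 !addr0 add0r mulr1.
case: (eqVneq (qnorm w) 0) => m0; last by rewrite mulVf // scale1r.
by rewrite m0 mulr0 scale0r (qnorm_eq0 m0).
Qed.

Lemma tangent_Reg_qim (r : \bar R) (z w : R * H * H) : tangent (Reg r) z w ->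
  qim (qmul (qconj z.1.2) w.1.2) /\ qim (qmul (qconj z.2) w.2).
Proof.
move=> [c [sc <- Rc <-]].
have dc : is_derive (0 : R) 1 c ('D_1 c 0).
  by apply: DeriveDef => //; apply: diff_derivable; exact: (sc [::]).
split.
  apply: (unit_curve_derive (is_der_snd (is_der_fst dc))).
  by apply: filterS Rc => t [].
apply: (unit_curve_derive (is_der_snd dc)).
by apply: filterS Rc => t [].
Qed.

Lemma tangent_Pid_qim (r : \bar R) (x v : H * H * H) : tangent (Pid r) x v ->
  qim (qmul (qconj x.1.2) v.1.2) /\ qim (qmul (qconj x.2) v.2).
Proof.
move=> [c [sc <- Rc <-]].
have dc : is_derive (0 : R) 1 c ('D_1 c 0).
  by apply: DeriveDef => //; apply: diff_derivable; exact: (sc [::]).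
split.
  apply: (unit_curve_derive (is_der_snd (is_der_fst dc))).
  by apply: filterS Rc => t [[]].
apply: (unit_curve_derive (is_der_snd dc)).
by apply: filterS Rc => t [].
Qed.

Lemma near_lt_ereal (r : \bar R) (t : R) : (t%:E < r)%E ->
  \forall s \near t, (s%:E < r)%E.
Proof.
case: r => [r| |] //.
- by rewrite lte_fin => tr; apply: filterS (near_lt tr) => s; rewrite lte_fin.
- by move=> _; apply: filterE => s; rewrite ltry.
Qed.

Lemma tangent_RegI (r : \bar R) (z w : R * H * H) : Reg r z -> qim (qmul (qconj z.1.2) w.1.2) ->
  qim (qmul (qconj z.2) w.2) -> tangent (Reg r) z w.
Proof.
case: z w => [[t a1] a2] [[u w1] w2] [/= t0 tr u1 u2] i1 i2.
have oT := @openT R.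
pose c s : R * H * H := (t + u * s, ucurve a1 w1 s, ucurve a2 w2 s).
have dl : is_derive (0 : R) 1 (fun s : R => t + u * s) u.
  apply: (is_derive_eq (is_der_add (is_der_cst (t : R^o) _ _)
     (is_der_mulc u (is_derive_id (0 : R) 1)))); by rewrite add0r mulr1.
exists c; split.
- apply: smooth_on_pair => //; last exact: smooth_ucurve.
  apply: smooth_on_pair => //; last exact: smooth_ucurve.
  apply: smooth_onD => //; first exact: smooth_on_cst.
  by apply: smooth1Z; exact: smooth1_id.
- by rewrite /c mulr0 addr0 !ucurve0.
- have cl : (fun s : R => t + u * s) @ (0 : R) --> t.
    have Hc : {for (0 : R), continuous (fun s : R => t + u * s)}.
      by apply: differentiable_continuous; apply/derivable1_diffP; case: dl.
    by move: Hc; rewrite /prop_for /continuous_at /= mulr0 addr0.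
  have n1 : \forall s \near (0 : R), 0 < t + u * s by exact: (cl _ (near_gt t0)).
  have n2 : \forall s \near (0 : R), ((t + u * s)%:E < r)%E.
    exact: (cl _ (near_lt_ereal tr)).
  near=> s; split => /=.
  + by near: s; exact: n1.
  + by near: s; exact: n2.
  + exact: ucurve_unit.
  + exact: ucurve_unit.
- by case: (is_der_pair (is_der_pair dl (is_der_ucurve a1 w1)) (is_der_ucurve a2 w2)).
Unshelve. all: by end_near. Qed.

End TangentSpaces.

Section Curvature.
Variable R : realType.
Local Notation H := 'rV[R]_4.

Lemma sum_perm2 (W : nmodType) (F : 'S_2 -> W) :
  \sum_(s : 'S_2) F s = F (1%g : {perm 'I_2}) + F (tperm ord0 (lift ord0 ord0)).
Proof.
have o2 (i : 'I_2) : (i == ord0) || (i == lift ord0 ord0).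
  by case: i => -[|[|]].
have n01 : ord0 != lift ord0 ord0 :> 'I_2 by [].
rewrite (bigD1 (1%g : {perm 'I_2})) //= (bigD1 (tperm ord0 (lift ord0 ord0))) /=; last first.
  by apply/eqP => /permP/(_ ord0); rewrite tpermL perm1.
rewrite big1 ?addr0 // => s /andP[/eqP s1 /eqP s2]; exfalso.
case/orP: (o2 (s ord0)) => /eqP s0.
- apply: s1; apply/permP => i; rewrite perm1.
  case/orP: (o2 i) => /eqP -> //.
  case/orP: (o2 (s (lift ord0 ord0))) => /eqP // s3.
  by have /perm_inj/eqP := etrans s3 (esym s0).
- apply: s2; apply/permP => i.
  case/orP: (o2 i) => /eqP ->; first by rewrite tpermL.
  rewrite tpermR; case/orP: (o2 (s (lift ord0 ord0))) => /eqP // s3.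
  by have /perm_inj/eqP := etrans s3 (esym s0).
Qed.

(** The two permutations contribute equal terms to the wedge, because both the bracket and the sign
    are antisymmetric; the factor 1/2 leaves one of them. *)
Lemma curvatureE (E : normedModType R) (th : kform 1 E H) (x : E) (v : 'I_2 -> E) :
  let v0 := v ord0 in let v1 := v (lift ord0 ord0) in
  curvature th x v = 'D_v0 (fun z => th z (fun=> v1)) x
    - 'D_v1 (fun z => th z (fun=> v0)) x
    + qbracket (th x (fun=> v0)) (th x (fun=> v1)).
Proof.
move=> v0 v1; rewrite /curvature; congr (_ + _).
  rewrite /dext !big_ord_recl big_ord0 addr0 expr0 scale1r expr1 scaleN1r.
  have e0 : (fun j : 'I_1 => v (lift ord0 j)) = (fun=> v1).
    by apply/funext => j; rewrite (ord1 j).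
  have e1 : (fun j : 'I_1 => v (lift (lift ord0 ord0) j)) = (fun=> v0).
    by apply/funext => j; rewrite (ord1 j); congr v; apply: val_inj.
  by rewrite e0 e1.
have ls (s : 'S_2) : (fun i => v (s (lshift 1 i))) = (fun=> v (s ord0)) :> ('I_1 -> E).
  by apply/funext => i; congr (v (s _)); apply: val_inj; rewrite (ord1 i).
have rs (s : 'S_2) : (fun i => v (s (rshift 1 i))) = (fun=> v (s (lift ord0 ord0))) :> ('I_1 -> E).
  by apply/funext => i; congr (v (s _)); apply: val_inj; rewrite (ord1 i).
have antisym (a b : H) : qbracket b a = - qbracket a b by rewrite /qbracket opprB.
rewrite /wedge sum_perm2 !ls !rs !perm1 tpermL tpermR odd_perm1 odd_tperm /=.
rewrite expr0 expr1 scale1r scaleN1r (antisym (th x (fun=> v0))) opprK muln1 invr1 scale1r.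
by rewrite -mulr2n -[X in _ *: X = _]scaler_nat scalerA mulVf ?scale1r // pnatr_eq0.
Qed.

End Curvature.

(** * Coordinates in a standard basis of imaginary quaternions *)

Section StandardBasis.
Variables (R : realType) (T : 3.-tuple 'rV[R]_4).
Hypothesis hT : standard_basis T.
Local Notation H := 'rV[R]_4.
Local Notation E0 := (R * H * H)%type.
Local Notation i0 := (ord0 : 'I_3).
Local Notation i1 := (ordS (ord0 : 'I_3)).
Local Notation i2 := (ordS (ordS (ord0 : 'I_3))).

Lemma ordS3 : ordS i2 = i0.
Proof. exact: val_inj. Qed.

Lemma sum3 (W : nmodType) (F : 'I_3 -> W) : \sum_(i < 3) F i = F i0 + F i1 + F i2.
Proof.
rewrite !big_ord_recl big_ord0 addr0 addrA; congr (_ + F _ + F _); exact: val_inj.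
Qed.

Lemma qim_sum (c : 'I_3 -> R) : qim (\sum_i c i *: tnth T i).
Proof.
have [_ iT _] := hT; rewrite /qim sum3 !qcE.
by rewrite (iT i0) (iT i1) (iT i2) !mulr0 !addr0.
Qed.

Lemma qim_span x : x \in <<T>>%VS -> qim x.
Proof.
move=> /coord_span ->; rewrite (_ : \sum_i _ = \sum_i coord T i x *: tnth T i).
  exact: qim_sum.
by apply: eq_bigr => i _; rewrite (tnth_nth 0).
Qed.

(** Since 1 is not in the span of [T], adjoining it gives four independent vectors, hence a basis of
    the quaternions; an imaginary quaternion has no component along 1. *)
Lemma coordK x : qim x -> \sum_i coord T i x *: tnth T i = x.
Proof.
move=> ix; have [fT iT _] := hT.
have q1T : q1 R \notin <<T>>%VS.
  apply/negP => /qim_span; rewrite /qim /q1 qc_mkq //=; apply/eqP; exact: oner_neq0.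
have fq : free (q1 R :: T) by rewrite free_cons q1T.
have full : <<q1 R :: T>>%VS = fullv.
  apply/eqP; rewrite eqEdim subvf dimvf /=; move: fq; rewrite /free => /eqP ->.
  by rewrite /= size_tuple.
have xT : x \in <<T>>%VS.
  have : x \in <<q1 R :: T>>%VS by rewrite full memvf.
  rewrite span_cons => /memv_addP[y /vlineP[c ->] [z zT e]].
  have c0 : c = 0.
    have iz := qim_span zT; move: ix; rewrite /qim e !qcE /q1 qc_mkq //= mulr1.
    by rewrite iz addr0.
  by rewrite e c0 scale0r add0r.
rewrite [RHS](coord_span xT); apply: eq_bigr => i _; by rewrite (tnth_nth 0).
Qed.

Lemma coord_tnth i j : coord T i (tnth T j) = (i == j)%:R.
Proof. by have [fT _ _] := hT; rewrite (tnth_nth 0) coord_free // eq_sym. Qed.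

Lemma coord_sum (c : 'I_3 -> R) k : coord T k (\sum_i c i *: tnth T i) = c k.
Proof.
rewrite linear_sum (bigD1 k) //= big1 => [|i ik].
  by rewrite linearZ /= coord_tnth eqxx -[LHS]/(_ * _ + 0) mulr1 addr0.
by rewrite linearZ /= coord_tnth eq_sym (negbTE ik) -[LHS]/(_ * _) mulr0.
Qed.

Lemma qbracket_im (x y : H) : qim (qbracket x y).
Proof. by rewrite /qim /qbracket qcD qcN /qmul !qc_mkq //=; ring. Qed.

Lemma qbracket_sum (a b : 'I_3 -> R) :
  qbracket (\sum_i a i *: tnth T i) (\sum_i b i *: tnth T i) =
  \sum_i (2%:R * (a (ordS i) * b (ordS (ordS i)) - a (ordS (ordS i)) * b (ordS i)))
    *: tnth T i.
Proof.
have [_ _ bT] := hT.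
rewrite !sum3 !ordS3.
have := bT i0; have := bT i1; have := bT i2; rewrite !ordS3.
move: (tnth T i0) (tnth T i1) (tnth T i2) => x y z zx yz xy.
transitivity ((a i0 * b i1 - a i1 * b i0) *: qbracket x y +
  (a i1 * b i2 - a i2 * b i1) *: qbracket y z +
  (a i2 * b i0 - a i0 * b i2) *: qbracket z x).
  move: (a i0) (a i1) (a i2) (b i0) (b i1) (b i2) => a0 a1 a2 b0 b1 b2.
  apply: qP => -[|[|[|[|//]]]] _; rewrite /qbracket /qmul ?qcE !qc_mkq //= ?qcE; ring.
rewrite xy yz zx !scalerA.
move: (a i0) (a i1) (a i2) (b i0) (b i1) (b i2) => a0 a1 a2 b0 b1 b2.
by apply: qP => i _; rewrite ?qcE; ring.
Qed.

Lemma coord_qbracket (x y : H) k : qim x -> qim y ->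
  coord T k (qbracket x y) = 2%:R * (coord T (ordS k) x * coord T (ordS (ordS k)) y
    - coord T (ordS (ordS k)) x * coord T (ordS k) y).
Proof.
move=> ix iy; rewrite -{1}(coordK ix) -{1}(coordK iy) qbracket_sum.
by rewrite coord_sum.
Qed.

Lemma is_der_coord (V : normedModType R) (f : V -> H) x v df i :
  is_derive x v f df -> is_derive x v (fun y => coord T i (f y) : R) (coord T i df).
Proof.
apply: (@is_der_linear R V _ R^o (fun y => coord T i y)).
  by move=> c u w; rewrite linearZ linearB.
exact: (@linear_quat_continuous R R^o).
Qed.

(** The formula of [eta] as a function of two quaternions. As [eta] is linear in the conjugated base
    point, its derivative along [v] is the same formula with the base point replaced by [v]. *)
Definition ceta (s : bool) (i : 'I_3) (w1 w2 : H) : R :=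
  (if s then coord T i w1 + coord T i w2 else coord T i w1 - coord T i w2) / 2%:R.

Lemma is_der_eta s i (z v w : E0) :
  is_derive z v (fun z => Defs.eta T s i z (fun=> w) : R)
    (ceta s i (qmul (qconj v.1.2) w.1.2) (qmul (qconj v.2) w.2)).
Proof.
have d1 : is_derive z v (fun z : E0 => qmul (qconj z.1.2) w.1.2)
    (qmul (qconj v.1.2) w.1.2).
  apply: (is_derive_eq (is_der_qmul (is_der_qconj (is_der_snd (is_der_fst
    (is_derive_id z v)))) (is_der_cst w.1.2 z v))).
  by apply: qP => -[|[|[|[|//]]]] _; rewrite /qmul ?qcE !qc_mkq ?qcE //=; ring.
have d2 : is_derive z v (fun z : E0 => qmul (qconj z.2) w.2) (qmul (qconj v.2) w.2).
  apply: (is_derive_eq (is_der_qmul (is_der_qconj (is_der_snd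
    (is_derive_id z v))) (is_der_cst w.2 z v))).
  by apply: qP => -[|[|[|[|//]]]] _; rewrite /qmul ?qcE !qc_mkq ?qcE //=; ring.
rewrite /ceta /Defs.eta; case: s.
- apply: (is_derive_eq (is_der_mul (is_der_add (is_der_coord i d1) (is_der_coord i d2))
    (is_der_cst (2%:R^-1 : R^o) z v))).
  by rewrite mulr0 addr0.
- apply: (is_derive_eq (is_der_mul (is_der_sub (is_der_coord i d1) (is_der_coord i d2))
    (is_der_cst (2%:R^-1 : R^o) z v))).
  by rewrite mulr0 addr0.
Qed.

End StandardBasis.

(** * The instanton equations for the ansatz *)

Section LinearMaps.
Variable R : realType.
Implicit Types V W : normedModType R.

Definition linear_of V W (L : V -> W) (lL : linear L) : {linear V -> W} :=
  HB.pack_for {linear V -> W} L (GRing.isLinear.Build R V W _ L lL).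

Lemma differentiable_linear V W (L : V -> W) x :
  linear L -> continuous L -> differentiable L x.
Proof. by move=> lL cL; apply: (@linear_differentiable _ _ _ (linear_of lL)). Qed.

Lemma derive_linear V W (L : V -> W) x v : linear L -> continuous L -> 'D_v L x = L v.
Proof.
move=> lL cL; rewrite deriveE; last exact: differentiable_linear.
by rewrite (@diff_lin _ _ _ (linear_of lL)).
Qed.

Lemma smooth_on_comp_lin_sub V W W' (O : set V) (O' : set W) (L : V -> W) (f : W -> W') :
  open O -> linear L -> continuous L -> (forall x, O x -> O' (L x)) ->
  smooth_on O' f -> smooth_on O (fun x => f (L x)).
Proof.
by move=> oO lL cL OO'; apply: (@smooth_on_comp_linear _ _ _ _ O O' (linear_of lL)).
Qed.

Lemma smooth_on_comp_lin V W W' (O : set V) (L : V -> W) (f : W -> W') : open O ->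
  linear L -> continuous L -> smooth_on setT f -> smooth_on O (fun x => f (L x)).
Proof. by move=> oO lL cL; apply: smooth_on_comp_lin_sub. Qed.

Lemma smooth_on_lin V W (O : set V) (L : V -> W) : open O ->
  linear L -> continuous L -> smooth_on O L.
Proof. by move=> oO lL cL; apply: (smooth_on_comp_lin oO lL cL (@smooth_on_id _ _ _)). Qed.

Lemma is_der_comp1 V (g : R -> R) (f : V -> R) x v (g' : R) :
  is_derive (f x) 1 g g' -> differentiable f x ->
  is_derive x v (fun y => g (f y)) ('D_v f x * g').
Proof.
move=> [dg <-] df; have dg' : differentiable g (f x) by apply/derivable1_diffP.
apply: DeriveDef; last exact: derive_comp1.
by apply: diff_derivable; exact: (@differentiable_comp _ _ _ _ f g).
Qed.

End LinearMaps.

(** * Curvature of the ansatz and the form [psi] in the coframe *)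

Section Ansatz.
Variables (R : realType) (T : 3.-tuple 'rV[R]_4).
Hypothesis hT : standard_basis T.
Local Notation H := 'rV[R]_4.
Local Notation E0 := (R * H * H)%type.
Variables (A1 B1 x y : R -> R).

(** Numbering of the coframe for the formal calculus: 0 is [dt], 1 to 3 are the [eta_i^+], 4 to 6
    the [eta_i^-]. *)
Definition cov (z : E0) (a : nat) (w : E0) : R :=
  if a == 0%N then w.1.1
  else if (a <= 3)%N then Defs.eta T true (inord a.-1) z (fun=> w)
  else Defs.eta T false (inord (a - 4)) z (fun=> w).

Definition ip (k : 'I_3) : nat := k.+1.
Definition im (k : 'I_3) : nat := (k + 4)%N.

Lemma cov_ip z k w : cov z (ip k) w = Defs.eta T true k z (fun=> w).
Proof. by rewrite /cov /ip /= ltn_ord /= inord_val. Qed.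

Lemma cov_im z k w : cov z (im k) w = Defs.eta T false k z (fun=> w).
Proof. by rewrite /cov /im addn_eq0 andbF leqNgt ltn_addl //= addnK inord_val. Qed.

Lemma is_der_time (h : R -> R) (h' : R) (z v : E0) : is_derive z.1.1 1 h h' ->
  is_derive z v (fun z => h z.1.1 : R) (v.1.1 * h').
Proof.
move=> dh.
have lL : linear (fun z : E0 => z.1.1) by [].
have cL : continuous (fun z : E0 => z.1.1).
  by move=> u; apply: continuous_comp; exact: cvg_fst.
rewrite -(derive_linear z v lL cL).
exact: (@is_der_comp1 R _ h (fun z : E0 => z.1.1) z v h' dh (differentiable_linear z lL cL)).
Qed.

Lemma is_der_sum3 (V W : normedModType R) (F : 'I_3 -> V -> W) (z v : V) (dF : 'I_3 -> W) :
  (forall i, is_derive z v (F i) (dF i)) ->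
  is_derive z v (fun z => \sum_i F i z) (\sum_i dF i).
Proof.
move=> d; rewrite sum3; under eq_fun do rewrite sum3.
by apply: is_der_add => //; exact: is_der_add.
Qed.

Lemma ansatzE z (w : 'I_1 -> E0) : ansatz T A1 B1 x y z w =
  \sum_i (A1 z.1.1 * x z.1.1 * Defs.eta T true i z w +
          B1 z.1.1 * y z.1.1 * Defs.eta T false i z w) *: tnth T i.
Proof.
rewrite /ansatz !scaler_sumr -big_split; apply: eq_bigr => i _ /=.
by rewrite !scalerA scalerDl.
Qed.

(** The terms linear in [f] and [g] come from the structure equations [d eta_k^+ = -2 (eta_i^+
    eta_j^+ + eta_i^- eta_j^-)] and [d eta_k^- = -2 (eta_i^+ eta_j^- + eta_i^- eta_j^+)], the
    quadratic ones from [[T_i, T_j] = 2 T_k]. *)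
Definition curv_ev (f g f' g' : R) (k : 'I_3) : seq (R * seq nat) :=
  let i := ordS k in let j := ordS i in
  [:: (f', [:: 0%N; ip k]); (g', [:: 0%N; im k]);
      (2%:R * (f ^+ 2 - f), [:: ip i; ip j]); (2%:R * (g ^+ 2 - f), [:: im i; im j]);
      (2%:R * (f * g - g), [:: im i; ip j]); (2%:R * (f * g - g), [:: ip i; im j])].

Lemma unit_conjM (a v w : H) : qunit a ->
  qmul (qconj v) w = qmul (qconj (qmul (qconj a) v)) (qmul (qconj a) w).
Proof.
by move=> ua; rewrite qconjM qconjK qmulA -(qmulA _ a) qmulqV // qmulq1.
Qed.

(** The Maurer-Cartan equation in coordinates: after left translation by [unit_conjM], the left-hand
    side is the antisymmetrised derivative of the coframe. *)
Lemma coord_antisym (X Y : H) k : qim X -> qim Y ->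
  coord T k (qmul (qconj X) Y) - coord T k (qmul (qconj Y) X) = - coord T k (qbracket X Y).
Proof.
move=> iX iY; rewrite -linearB -linearN; congr (coord T k _).
have cX : qconj X = - X.
  by apply: qP => -[|[|[|[|//]]]] _; rewrite qcN /qconj qc_mkq //= iX oppr0.
have cY : qconj Y = - Y.
  by apply: qP => -[|[|[|[|//]]]] _; rewrite qcN /qconj qc_mkq //= iY oppr0.
by rewrite cX cY; apply: qP => -[|[|[|[|//]]]] _;
  rewrite /qbracket /qmul ?qcE !qc_mkq ?qcE //=; ring.
Qed.

Lemma ansatz_curvature r z (w : 'I_2 -> E0) (f' g' : R) : Reg r z ->
  (forall i, tangent (Reg r) z (w i)) ->
  is_derive z.1.1 1 (fun t => A1 t * x t : R) f' ->
  is_derive z.1.1 1 (fun t => B1 t * y t : R) g' ->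
  curvature (ansatz T A1 B1 x y) z w =
  \sum_k ev (cov z) (curv_ev (A1 z.1.1 * x z.1.1) (B1 z.1.1 * y z.1.1) f' g' k) w
    *: tnth T k.
Proof.
move=> [t0 tr u1 u2] tw df dg.
have D (v v' : E0) : is_derive z v (fun z => ansatz T A1 B1 x y z (fun=> v'))
  (\sum_i ((v.1.1 * f') * Defs.eta T true i z (fun=> v') + (A1 z.1.1 * x z.1.1) *
     ceta T true i (qmul (qconj v.1.2) v'.1.2) (qmul (qconj v.2) v'.2) +
    ((v.1.1 * g') * Defs.eta T false i z (fun=> v') + (B1 z.1.1 * y z.1.1) *
     ceta T false i (qmul (qconj v.1.2) v'.1.2) (qmul (qconj v.2) v'.2))) *: tnth T i).
  have Di i := is_der_scale (is_der_add
    (is_der_mul (is_der_time v df) (is_der_eta T true i z v v'))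
    (is_der_mul (is_der_time v dg) (is_der_eta T false i z v v')))
    (is_der_cst (tnth T i) z v).
  under eq_fun do rewrite ansatzE.
  apply: (is_derive_eq (is_der_sum3 Di)).
  by apply: eq_bigr => i _; rewrite scaler0 addr0.
rewrite curvatureE.
set v := w ord0; set v' := w (lift ord0 ord0).
case: (D v v') => _ ->; case: (D v' v) => _ ->.
rewrite !ansatzE (qbracket_sum hT) -sumrB -big_split; apply: eq_bigr => k _ /=.
rewrite -scalerBl -scalerDl; congr (_ *: _).
have [iX iY] := tangent_Reg_qim (tw ord0); rewrite -/v in iX iY.
have [iX' iY'] := tangent_Reg_qim (tw (lift ord0 ord0)); rewrite -/v' in iX' iY'.
rewrite /curv_ev !ev_cons ev_nil !mono2 !cov_ip !cov_im -/v -/v'.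
rewrite (_ : cov z 0 v = v.1.1) // (_ : cov z 0 v' = v'.1.1) //=.
rewrite (unit_conjM v.1.2 v'.1.2 u1) (unit_conjM v'.1.2 v.1.2 u1).
rewrite (unit_conjM v.2 v'.2 u2) (unit_conjM v'.2 v.2 u2).
have e1 := coord_antisym k iX iX'; have e2 := coord_antisym k iY iY'.
rewrite (coord_qbracket hT k iX iX') in e1.
rewrite (coord_qbracket hT k iY iY') in e2.
rewrite /ceta /Defs.eta /=.
move: e1 e2.
set X := qmul (qconj z.1.2) v.1.2; set X' := qmul (qconj z.1.2) v'.1.2.
set Y := qmul (qconj z.2) v.2; set Y' := qmul (qconj z.2) v'.2.
set q1 := coord T k (qmul (qconj X) X'); set q2 := coord T k (qmul (qconj X') X).
set q3 := coord T k (qmul (qconj Y) Y'); set q4 := coord T k (qmul (qconj Y') Y).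
move: (coord T k X) (coord T k Y) (coord T k X') (coord T k Y') => xk yk xk' yk'.
move: (coord T (ordS k) X) (coord T (ordS k) Y) (coord T (ordS k) X')
  (coord T (ordS k) Y') => xi yi xi' yi'.
move: (coord T (ordS (ordS k)) X) (coord T (ordS (ordS k)) Y)
  (coord T (ordS (ordS k)) X') (coord T (ordS (ordS k)) Y') => xj yj xj' yj'.
move: q1 q2 q3 q4 => q1 q2 q3 q4 /eqP; rewrite subr_eq => /eqP -> /eqP.
rewrite subr_eq => /eqP ->.
move: (A1 z.1.1 * x z.1.1) (B1 z.1.1 * y z.1.1) v.1.1 v'.1.1 => f g u u'.
by field.
Qed.

Local Notation i0 := (ord0 : 'I_3).
Local Notation i1 := (ordS (ord0 : 'I_3)).
Local Notation i2 := (ordS (ordS (ord0 : 'I_3))).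

Lemma ev_scale (E : normedModType R) (cv : nat -> E -> R) n (c : R) e (v : 'I_n -> E) :
  c * ev cv e v = ev cv [seq (c * p.1, p.2) | p <- e] v.
Proof.
by rewrite /ev big_map mulr_sumr; apply: eq_bigr => p _; rewrite mulrA.
Qed.

Definition ieta (s : bool) := if s then ip else im.

Lemma eta_ev s i z (v : 'I_1 -> E0) :
  Defs.eta T s i z v = ev (cov z) [:: (1, [:: ieta s i])] v.
Proof.
rewrite ev_cons ev_nil addr0 mul1r mono1.
by case: s; rewrite /ieta ?cov_ip ?cov_im.
Qed.

Lemma wedgeR_ev k l (a : kform k E0 R) (b : kform l E0 R) z e1 e2 :
  all (fun p => size p.2 == k) e1 ->
  (forall v, a z v = ev (cov z) e1 v) -> (forall v, b z v = ev (cov z) e2 v) ->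
  forall v, wedgeR a b z v = ev (cov z) (eprod e1 e2) v.
Proof.
move=> h ha hb v.
by apply: (@wedge_ev _ _ (cov z) k l (fun=> True)).
Qed.

Definition omega_ev (A B : R) : seq (R * seq nat) :=
  [:: (4%:R * (A * B), [:: 4; 1]%N); (4%:R * (A * B), [:: 5; 2]%N);
      (4%:R * (A * B), [:: 6; 3]%N)].

Definition Omega2_ev (A B : R) : seq (R * seq nat) :=
  [:: (- 8%:R * A ^+ 3, [:: 1; 2; 3]%N); (8%:R * (B ^+ 2 * A), [:: 4; 5; 3]%N);
      (8%:R * (B ^+ 2 * A), [:: 5; 6; 1]%N); (8%:R * (B ^+ 2 * A), [:: 6; 4; 2]%N)].

Definition psi_ev (A B : R) : seq (R * seq nat) :=
  [seq (2%:R^-1 * p.1, p.2) | p <- eprod (omega_ev A B) (omega_ev A B)] ++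
  [seq (- 1 * p.1, p.2) | p <- eprod [:: (1, [:: 0%N])] (Omega2_ev A B)].

Lemma omegaE z (v : 'I_2 -> E0) :
  omega T A1 B1 z v = ev (cov z) (omega_ev (A1 z.1.1) (B1 z.1.1)) v.
Proof.
have W s i s' j (u : 'I_2 -> E0) : wedgeR (Defs.eta T s i) (Defs.eta T s' j) z u =
    ev (cov z) (eprod [:: (1, [:: ieta s i])] [:: (1, [:: ieta s' j])]) u.
  by apply: wedgeR_ev => // w; exact: eta_ev.
rewrite /omega sum3 !W /eprod /= !ev_cons !ev_nil /=.
rewrite (_ : im i0 = 4%N) // (_ : im i1 = 5%N) // (_ : im i2 = 6%N) //.
rewrite (_ : ip i0 = 1%N) // (_ : ip i1 = 2%N) // (_ : ip i2 = 3%N) //.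
ring.
Qed.

Lemma Omega2E z (v : 'I_3 -> E0) :
  Omega2 T A1 B1 z v = ev (cov z) (Omega2_ev (A1 z.1.1) (B1 z.1.1)) v.
Proof.
have W2 s i s' j (u : 'I_2 -> E0) : wedgeR (Defs.eta T s i) (Defs.eta T s' j) z u =
    ev (cov z) (eprod [:: (1, [:: ieta s i])] [:: (1, [:: ieta s' j])]) u.
  by apply: wedgeR_ev => // w; exact: eta_ev.
have W s i s' j s'' k (u : 'I_3 -> E0) :
    wedgeR (Defs.eta T s i) (wedgeR (Defs.eta T s' j) (Defs.eta T s'' k)) z u =
    ev (cov z) (eprod [:: (1, [:: ieta s i])]
      (eprod [:: (1, [:: ieta s' j])] [:: (1, [:: ieta s'' k])])) u.
  by apply: wedgeR_ev => // w; exact: eta_ev.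
rewrite /Omega2 sum3 !W /eprod /= !ev_cons !ev_nil /= !ordS3.
rewrite (_ : im i0 = 4%N) // (_ : im i1 = 5%N) // (_ : im i2 = 6%N) //.
rewrite (_ : ip i0 = 1%N) // (_ : ip i1 = 2%N) // (_ : ip i2 = 3%N) //.
ring.
Qed.

Lemma psiE z (v : 'I_4 -> E0) :
  psi T A1 B1 z v = ev (cov z) (psi_ev (A1 z.1.1) (B1 z.1.1)) v.
Proof.
have dtE (u : 'I_1 -> E0) : dt z u = ev (cov z) [:: (1, [:: 0%N])] u.
  by rewrite ev_cons ev_nil addr0 mul1r mono1.
rewrite /psi (wedgeR_ev _ (omegaE z) (omegaE z)) //.
rewrite (wedgeR_ev _ dtE (Omega2E z)) // /psi_ev [RHS]ev_cat; congr (_ + _).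
  by rewrite ev_scale.
by rewrite -[LHS]mulN1r ev_scale.
Qed.

(** [P] will be tangency to [Reg], as the curvature formula holds only for tangent vectors; [wedge]
    merely permutes its arguments, so the condition passes to both factors. *)
Lemma curv_wedge_sum (E : normedModType R) (th : kform 1 E H) (b : kform 4 E R)
    (F : 'I_3 -> ('I_2 -> E) -> R) (z : E) (P : E -> Prop) :
  (forall w, (forall i, P (w i)) -> curvature th z w = \sum_k F k w *: tnth T k) ->
  forall v : 'I_6 -> E, (forall i, P (v i)) -> curv_wedge th b z v =
  \sum_k wedge (k := 2) (l := 4) (fun c d : R => c * d : R^o) (fun=> F k) b z v *: tnth T k.
Proof.
move=> HF v Pv; rewrite /curv_wedge /wedge.
transitivity (\sum_k \sum_(s : 'S_(2 + 4)) ((2`! * 4`!)%:R^-1 * ((-1) ^+ s *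
    (F k (fun i => v (s (lshift 4 i))) * b z (fun j => v (s (rshift 2 j)))))) *: tnth T k).
  rewrite exchange_big scaler_sumr; apply: eq_bigr => s _ /=.
  rewrite HF // scaler_sumr !scaler_sumr; apply: eq_bigr => k _.
  by rewrite !scalerA; congr (_ *: _); rewrite -!mulrA [F k _ * _]mulrC.
apply: eq_bigr => k _; rewrite -scaler_suml; congr (_ *: _).
by rewrite -mulr_sumr.
Qed.

End Ansatz.

(** * The instanton equation as a system of differential equations *)

Section InstantonODE.
Variables (R : realType) (T : 3.-tuple 'rV[R]_4).
Hypothesis hT : standard_basis T.
Local Notation H := 'rV[R]_4.
Local Notation E0 := (R * H * H)%type.
Variables (A1 B1 x y : R -> R).
Local Notation i0 := (ord0 : 'I_3).
Local Notation i1 := (ordS (ord0 : 'I_3)).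
Local Notation i2 := (ordS (ordS (ord0 : 'I_3))).

(** The equations in the form in which wedging with [psi] yields them: [16 A] times the equation for
    [f], and for [ode_m] [16 A B^2] times the one for [g]. *)
Definition ode_p (A B f g f' : R) : R :=
  16%:R * (A ^+ 2 * B ^+ 2 * f' + (f ^+ 2 - f) * B ^+ 2 * A - (g ^+ 2 - f) * A ^+ 3).
Definition ode_m (A B f g g' : R) : R :=
  16%:R * (A ^+ 2 * B ^+ 2 * g' - 2%:R * (f * g - g) * B ^+ 2 * A).

(** Of the 78 products [nfe] keeps those without a repeated index, and these involve two sorted
    monomials only: the one omitting [eta_1^-] and the one omitting [eta_1^+]. The other two
    components follow the same pattern, with signs due to sorting. *)
Lemma curv_psi0 z A B f g f' g' (v : 'I_6 -> E0) :
  ev (cov T z) (eprod (curv_ev f g f' g' i0) (psi_ev A B)) v =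
   - ode_p A B f g f' * mono (cov T z) [:: 0; 1; 2; 3; 5; 6]%N v
   + - ode_m A B f g g' * mono (cov T z) [:: 0; 2; 3; 4; 5; 6]%N v.
Proof.
rewrite [curv_ev _ _ _ _ _](_ : _ = [:: (f', [:: 0; 1]%N);
      (g', [:: 0; 4]%N);
      (2%:R * (f ^+ 2 - f), [:: 2; 3]%N);
      (2%:R * (g ^+ 2 - f), [:: 5; 6]%N);
      (2%:R * (f * g - g), [:: 5; 3]%N);
      (2%:R * (f * g - g), [:: 2; 6]%N)]) //.
rewrite ev_nfe // /nfe /eprod /psi_ev /omega_ev /Omega2_ev /= !ev_cons ev_nil /=.
move: (mono _ _ _) (mono _ _ _) => m1 m2; rewrite /ode_p /ode_m; by field.
Qed.

Lemma curv_psi1 z A B f g f' g' (v : 'I_6 -> E0) :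
  ev (cov T z) (eprod (curv_ev f g f' g' i1) (psi_ev A B)) v =
   ode_p A B f g f' * mono (cov T z) [:: 0; 1; 2; 3; 4; 6]%N v
   + ode_m A B f g g' * mono (cov T z) [:: 0; 1; 3; 4; 5; 6]%N v.
Proof.
rewrite [curv_ev _ _ _ _ _](_ : _ = [:: (f', [:: 0; 2]%N);
      (g', [:: 0; 5]%N);
      (2%:R * (f ^+ 2 - f), [:: 3; 1]%N);
      (2%:R * (g ^+ 2 - f), [:: 6; 4]%N);
      (2%:R * (f * g - g), [:: 6; 1]%N);
      (2%:R * (f * g - g), [:: 3; 4]%N)]) //.
rewrite ev_nfe // /nfe /eprod /psi_ev /omega_ev /Omega2_ev /= !ev_cons ev_nil /=.
move: (mono _ _ _) (mono _ _ _) => m1 m2; rewrite /ode_p /ode_m; by field.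
Qed.

Lemma curv_psi2 z A B f g f' g' (v : 'I_6 -> E0) :
  ev (cov T z) (eprod (curv_ev f g f' g' i2) (psi_ev A B)) v =
   - ode_p A B f g f' * mono (cov T z) [:: 0; 1; 2; 3; 4; 5]%N v
   + - ode_m A B f g g' * mono (cov T z) [:: 0; 1; 2; 4; 5; 6]%N v.
Proof.
rewrite [curv_ev _ _ _ _ _](_ : _ = [:: (f', [:: 0; 3]%N);
      (g', [:: 0; 6]%N);
      (2%:R * (f ^+ 2 - f), [:: 1; 2]%N);
      (2%:R * (g ^+ 2 - f), [:: 4; 5]%N);
      (2%:R * (f * g - g), [:: 4; 2]%N);
      (2%:R * (f * g - g), [:: 1; 5]%N)]) //.
rewrite ev_nfe // /nfe /eprod /psi_ev /omega_ev /Omega2_ev /= !ev_cons ev_nil /=.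
move: (mono _ _ _) (mono _ _ _) => m1 m2; rewrite /ode_p /ode_m; by field.
Qed.

Lemma curv_wedge_ansatz r z (v : 'I_6 -> E0) (f' g' : R) : Reg r z ->
  (forall i, tangent (Reg r) z (v i)) ->
  is_derive z.1.1 1 (fun t => A1 t * x t : R) f' ->
  is_derive z.1.1 1 (fun t => B1 t * y t : R) g' ->
  curv_wedge (ansatz T A1 B1 x y) (psi T A1 B1) z v =
  \sum_k ev (cov T z) (eprod
    (curv_ev (A1 z.1.1 * x z.1.1) (B1 z.1.1 * y z.1.1) f' g' k)
    (psi_ev (A1 z.1.1) (B1 z.1.1))) v *: tnth T k.
Proof.
move=> Rz tv df dg.
rewrite (@curv_wedge_sum R T E0 _ _ (fun k => ev (cov T z) (curv_ev
  (A1 z.1.1 * x z.1.1) (B1 z.1.1 * y z.1.1) f' g' k)) z (tangent (Reg r) z)) //.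
  apply: eq_bigr => k _; congr (_ *: _).
  apply: (@wedge_ev R E0 (cov T z) 2 4 (fun=> True)) => // w _.
  exact: psiE.
by move=> w tw; exact: (ansatz_curvature hT Rz tw df dg).
Qed.

Lemma instanton_of_ode (r : \bar R) :
  (forall t : R, 0 < t -> (t%:E < r)%E -> exists f' g' : R,
    [/\ is_derive t 1 (fun t => A1 t * x t : R) f',
        is_derive t 1 (fun t => B1 t * y t : R) g',
        ode_p (A1 t) (B1 t) (A1 t * x t) (B1 t * y t) f' = 0
      & ode_m (A1 t) (B1 t) (A1 t * x t) (B1 t * y t) g' = 0]) ->
  instanton_reg T A1 B1 r (ansatz T A1 B1 x y).
Proof.
move=> ode z v Rz tv; case: (Rz) => t0 tr _ _.
have [f' [g' [df dg op om]]] := ode _ t0 tr.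
rewrite (curv_wedge_ansatz Rz tv df dg) sum3.
by rewrite curv_psi0 curv_psi1 curv_psi2 op om !oppr0 !mul0r !addr0 !scale0r !addr0.
Qed.

Definition dual_vec (b : nat) : E0 :=
  if b == 0%N then (1, 0, 0)
  else if (b <= 3)%N then (0, tnth T (inord b.-1), tnth T (inord b.-1))
  else (0, tnth T (inord (b - 4)), - tnth T (inord (b - 4))).

Lemma cov_dual (t : R) a b : (a < 7)%N -> (b < 7)%N ->
  cov T (t, q1 R, q1 R) a (dual_vec b) = (a == b)%:R.
Proof.
have [fT _ _] := hT; have u1 := qunit1 R.
have q0 : qmul (qconj (q1 R)) 0 = 0.
  by apply: qP => -[|[|[|[|//]]]] _; rewrite /qmul qc_mkq ?qcE //=; ring.
have D s s' i j : Defs.eta T s i (t, q1 R, q1 R) (fun=> (0, tnth T j,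
    if s' then tnth T j else - tnth T j)) = ((s == s') && (i == j))%:R.
  by have := eta_dual s s' i j t 0 fT u1 u1; rewrite !qmul1q.
have Dp s i j : Defs.eta T s i (t, q1 R, q1 R) (fun=> (0, tnth T j, tnth T j)) =
    ((s == true) && (i == j))%:R by exact: (D s true).
have Dm s i j : Defs.eta T s i (t, q1 R, q1 R) (fun=> (0, tnth T j, - tnth T j)) =
    ((s == false) && (i == j))%:R by exact: (D s false).
have D0 s i : Defs.eta T s i (t, q1 R, q1 R) (fun=> (1, 0, 0)) = 0.
  by rewrite /Defs.eta /= q0 linear0 addr0 subr0; case: s; rewrite mul0r.
have in3 m n : (m < 3)%N -> (n < 3)%N -> (inord m == inord n :> 'I_3) = (m == n).
  by move=> m3 n3; rewrite -val_eqE /= !inordK.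
by case: a => [|[|[|[|[|[|[|//]]]]]]] _; case: b => [|[|[|[|[|[|[|//]]]]]]] _;
  rewrite /cov /dual_vec /= ?D0 ?Dp ?Dm ?in3.
Qed.

Lemma dual_vec_tangent (r : \bar R) (t : R) b : 0 < t -> (t%:E < r)%E ->
  tangent (Reg r) (t, q1 R, q1 R) (dual_vec b).
Proof.
move=> t0 tr; have u1 := qunit1 R; have [_ iT _] := hT.
have c1 : qconj (q1 R) = q1 R.
  by apply: qP => -[|[|[|[|//]]]] _; rewrite /qconj /q1 !qc_mkq //= oppr0.
have iN w : qim w -> qim (- w) by rewrite /qim qcN => ->; rewrite oppr0.
have i0' : qim (0 : H) by rewrite /qim qc0.
apply: tangent_RegI => //=; rewrite c1 qmul1q /dual_vec;
  by case: (b == 0%N) => //=; case: (b <= 3)%N => //=; rewrite ?iT //; exact: iN.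
Qed.

Definition dual_vecs (s : seq nat) (i : 'I_6) : E0 := dual_vec (nth 0%N s i).

Lemma mono_dual_id (t : R) s : size s = 6%N -> uniq s -> all (ltn^~ 7%N) s ->
  mono (cov T (t, q1 R, q1 R)) s (dual_vecs s) = 1.
Proof.
move=> s6 us /allP ls; rewrite /mono -[RHS](@det1 R 6); congr (\det _).
apply/matrixP => i j; rewrite !mxE /dual_vecs.
by rewrite cov_dual ?nth_uniq ?s6 //; apply: ls; apply: mem_nth; rewrite s6.
Qed.

(** The row of the covector [a] vanishes on all the chosen vectors. *)
Lemma mono_dual0 (t : R) s s' a : size s = 6%N -> size s' = 6%N ->
  all (ltn^~ 7%N) s -> all (ltn^~ 7%N) s' -> a \in s' -> a \notin s ->
  mono (cov T (t, q1 R, q1 R)) s' (dual_vecs s) = 0.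
Proof.
move=> s6 s'6 /allP ls /allP ls' as' ans.
have i6 : (index a s' < 6)%N by rewrite -s'6 index_mem.
rewrite /mono (expand_det_row _ (Ordinal i6)) big1 // => j _.
rewrite mxE nth_index // /dual_vecs cov_dual //; last first.
- by apply: ls; apply: mem_nth; rewrite s6.
- exact: ls'.
case: eqP => [e|_]; last by rewrite mul0r.
by case/negP: ans; rewrite e mem_nth // s6.
Qed.

(** At [(t, 1, 1)] the six dual vectors left after omitting index 4, respectively index 1, isolate
    one coefficient of the first component, which is [ode_p], respectively [ode_m], up to sign. *)
Lemma ode_of_instanton (r : \bar R) (t : R) (f' g' : R) : 0 < t -> (t%:E < r)%E ->
  instanton_reg T A1 B1 r (ansatz T A1 B1 x y) ->
  is_derive t 1 (fun t => A1 t * x t : R) f' ->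
  is_derive t 1 (fun t => B1 t * y t : R) g' ->
  ode_p (A1 t) (B1 t) (A1 t * x t) (B1 t * y t) f' = 0 /\
  ode_m (A1 t) (B1 t) (A1 t * x t) (B1 t * y t) g' = 0.
Proof.
move=> t0 tr inst df dg; have u1 := qunit1 R.
have Rz : Reg r (t, q1 R, q1 R) by split.
have main s :
   - ode_p (A1 t) (B1 t) (A1 t * x t) (B1 t * y t) f' *
     mono (cov T (t, q1 R, q1 R)) [:: 0; 1; 2; 3; 5; 6]%N (dual_vecs s)
   + - ode_m (A1 t) (B1 t) (A1 t * x t) (B1 t * y t) g' *
     mono (cov T (t, q1 R, q1 R)) [:: 0; 2; 3; 4; 5; 6]%N (dual_vecs s) = 0.
  have tv i : tangent (Reg r) (t, q1 R, q1 R) (dual_vecs s i).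
    exact: dual_vec_tangent.
  have := inst _ _ Rz tv.
  rewrite (curv_wedge_ansatz Rz tv df dg) => /(congr1 (coord T ord0)).
  by rewrite (coord_sum hT) linear0 curv_psi0.
split; apply/eqP; rewrite -oppr_eq0; apply/eqP.
- rewrite -(main [:: 0; 1; 2; 3; 5; 6]%N) mono_dual_id //.
  by rewrite (@mono_dual0 _ _ _ 4%N) // mulr0 addr0 mulr1.
- rewrite -(main [:: 0; 2; 3; 4; 5; 6]%N) mono_dual_id //.
  by rewrite (@mono_dual0 _ _ _ 1%N) // mulr0 add0r mulr1.
Qed.

End InstantonODE.

(** * The extension over the singular orbit *)

Section Radial.
Variable R : realType.
Local Notation H := 'rV[R]_4.

(** Differentials are estimated in the sup norm, whereas radial functions depend on the Euclidean
    one; the factor is the square root of the dimension. *)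
Lemma qnorm_le (p : H) : qnorm p <= 2%:R * `|p|.
Proof.
have n0 : 0 <= 2%:R * `|p| by rewrite mulr_ge0.
rewrite -[leRHS]ger0_norm // -sqrtr_sqr /qnorm ler_sqrt ?sqr_ge0 //.
apply: (@le_trans _ _ (\sum_(i < 4) `|p| ^+ 2)); last first.
  by rewrite sumr_const card_ord exprMn -natrX -[leLHS]mulr_natl.
apply: ler_sum => i _; rewrite -real_normK ?num_real //.
rewrite lerXn2r ?nnegrE //.
rewrite [leRHS]/Num.Def.normr /= mx_normrE.
by apply: le_trans; last exact: (le_bigmax _ _ (ord0, i)).
Qed.

Lemma smooth_on_linear_comp (E W V : normedModType R) (O : set E) (L : W -> V)
    (f : E -> W) : open O -> linear L -> continuous L ->
  smooth_on O f -> smooth_on O (fun x => L (f x)).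
Proof.
move=> oO lL cL sf.
apply: (@smooth_on_class _ _ _ O (fun g => exists2 f : E -> W, smooth_on O f &
    forall x, O x -> L (f x) = g x)); last by exists f.
- move=> {sf}g {f}[f sf fg] x Ox; apply: (near_eq_differentiable (open_near_eq oO fg Ox)).
  apply: (@differentiable_comp _ _ _ _ f L); first exact: smooth_on_differentiable Ox.
  exact: differentiable_linear.
- move=> {sf}g v {f}[f sf fg]; exists ('D_v f); first exact: smooth_on_derive.
  move=> x Ox; rewrite -(near_eq_derive v (open_near_eq oO fg Ox)).
  have df := smooth_on_differentiable sf Ox.
  have dL : differentiable L (f x) by exact: differentiable_linear.
  have dLf : differentiable (L \o f) x by exact: differentiable_comp.
  rewrite [RHS](deriveE _ dLf) diff_comp //= deriveE //.
  by rewrite (@diff_lin _ _ _ (linear_of lL)).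
Qed.

Lemma linear_qc i : linear (fun x : H => qc x i : R^o).
Proof. by move=> c u v; rewrite qcD qcZ. Qed.

Section Quaternionic.
Variables (E : normedModType R) (O : set E).
Hypothesis oO : open O.
Implicit Types f g : E -> H.

Lemma smooth_on_qc f i : smooth_on O f -> smooth_on O (fun x => qc (f x) i : R).
Proof.
exact: (smooth_on_linear_comp oO (linear_qc i) (@qc_continuous R i)).
Qed.

Lemma smooth_on_quat f : (forall i, (i < 4)%N -> smooth_on O (fun x => qc (f x) i : R)) ->
  smooth_on O f.
Proof.
move=> sf; apply: smooth_on_row => // i.
by have := sf i (ltn_ord i); rewrite /qc inord_val.
Qed.

Lemma smooth_on_mkq (a b c d : E -> R) : smooth_on O a -> smooth_on O b ->
  smooth_on O c -> smooth_on O d -> smooth_on O (fun x => mkq (a x) (b x) (c x) (d x)).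
Proof.
by move=> sa sb sc sd; apply: smooth_on_quat => -[|[|[|[|//]]]] _;
  under eq_fun do rewrite qc_mkq //=.
Qed.

Lemma smooth_on_qmul f g : smooth_on O f -> smooth_on O g ->
  smooth_on O (fun x => qmul (f x) (g x)).
Proof.
move=> sf sg; have m i j := smooth_onM oO (smooth_on_qc i sf) (smooth_on_qc j sg).
by apply: smooth_on_mkq; repeat first
  [exact: m | apply: smooth_onB => // | apply: smooth_onD => //].
Qed.

Lemma smooth_on_qconj f : smooth_on O f -> smooth_on O (fun x => qconj (f x)).
Proof.
move=> sf; have m i := smooth_on_qc i sf.
by apply: smooth_on_mkq; repeat first [exact: m | apply: smooth_onN => //].
Qed.

Lemma smooth_on_scale (c : E -> R) f : smooth_on O c -> smooth_on O f ->
  smooth_on O (fun x => c x *: f x).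
Proof.
move=> sc sf; apply: smooth_on_quat => i _.
under eq_fun do rewrite qcZ.
by apply: smooth_onM => //; exact: smooth_on_qc.
Qed.

Lemma smooth_on_qsub f g : smooth_on O f -> smooth_on O g ->
  smooth_on O (fun x => f x - g x).
Proof.
move=> sf sg; apply: smooth_on_quat => i _.
under eq_fun do rewrite qcD qcN.
by apply: smooth_onB => //; exact: smooth_on_qc.
Qed.

End Quaternionic.

Definition qdot (p v : H) : R :=
  qc p 0 * qc v 0 + qc p 1 * qc v 1 + qc p 2 * qc v 2 + qc p 3 * qc v 3.

Lemma smooth_qdot v : smooth_on setT (fun p : H => qdot p v).
Proof.
have oT := @openT H; have sq i := smooth_on_qc oT i (@smooth_on_id _ H setT).
have m i : smooth_on setT (fun p : H => qc p i * qc v i).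
  by apply: smooth_onM => //; exact: smooth_on_cst.
by do 3! apply: smooth_onD => //.
Qed.

Lemma is_der_qnorm_sqr (p v : H) :
  is_derive p v (fun p : H => qnorm p ^+ 2 : R) (2%:R * qdot p v).
Proof.
have m i := is_der_expS 1 (is_der_qc i (is_derive_id p v)).
under eq_fun do rewrite qnorm_sqr.
apply: (is_derive_eq (is_der_add (is_der_add (is_der_add (m 0%N) (m 1%N)) (m 2%N)) (m 3%N))).
by rewrite /qdot; ring.
Qed.

Lemma differentiable_qnorm_sqr (p : H) : differentiable (fun p : H => qnorm p ^+ 2 : R) p.
Proof.
under eq_fun do rewrite qnorm_sqr.
have oT := @openT H; have sq i := smooth_on_qc oT i (@smooth_on_id _ H setT).
apply: (@smooth_on_differentiable _ _ _ setT) => //.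
by do 3! (apply: smooth_onD => //; last exact: smooth_onM); exact: smooth_onM.
Qed.

Lemma qnorm_continuous : continuous (@qnorm R).
Proof.
have -> : @qnorm R = (fun p => Num.sqrt (qnorm p ^+ 2)).
  by apply/funext => p; rewrite sqrtr_sqr ger0_norm // qnorm_ge0.
move=> p; apply: (@continuous_comp _ _ _ (fun p : H => qnorm p ^+ 2) Num.sqrt).
  by apply: differentiable_continuous; exact: differentiable_qnorm_sqr.
exact: sqrt_continuous.
Qed.

Lemma qnorm0 : qnorm (0 : H) = 0.
Proof.
apply/eqP; rewrite -sqrf_eq0 qnorm_sqr; apply/eqP.
by rewrite !qc0 expr0n /= !addr0.
Qed.

Lemma qnorm_gt0 (p : H) : p != 0 -> 0 < qnorm p.
Proof.
move=> p0; rewrite lt_neqAle qnorm_ge0 andbT eq_sym.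
by apply: contra_neq p0; exact: qnorm_eq0.
Qed.

(** Writing the derivative with [h'/t], extended over 0, gives one formula valid at the centre too.
    Off the centre it is the chain rule through [sqrt(|p|^2)]. *)
Lemma radial_derive (h : R -> R) (p v : H) : smooth_on setT h -> even_fun h ->
  differentiable (fun p : H => h (qnorm p)) p /\
  'D_v (fun p : H => h (qnorm p)) p = quot0 (derive1 h) (qnorm p) * qdot p v.
Proof.
move=> sh eh; have oh := derive1_odd sh eh; have h0 := odd_fun0 oh.
case: (eqVneq p 0) => [->|p0].
(* At the centre the differential is zero: evenness gives [h'(0) = 0], so [h(|q|) - h(0)] is
   [o(|q|)]. *)
- pose z (p : H) : R^o := 0.
  have lz : linear z by move=> c u w; rewrite scaler0 addr0.
  have dh : differentiable h 0 by exact: (smooth_on_differentiable sh).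
  have dh0 s : 'd h 0 s = 0.
    transitivity ('d h 0 (s *: (1 : R))); first by rewrite [_ *: _]mulr1.
    by rewrite linearZ /= -deriveE // -derive1E h0 scaler0.
  have D : is_diff (0 : H) (fun p : H => h (qnorm p) : R^o) z.
    apply: (@is_diff_littleo R _ _ _ (linear_of lz)); first exact: (@cst_continuous H R^o 0).
    move=> e e0; have e2 : 0 < e / 2%:R by rewrite divr_gt0.
    have := diff_littleo dh e2 => Hn.
    have cq : qnorm q @[q --> (0 : H)] --> (0 : R).
      by rewrite -[X in _ --> X]qnorm0; exact: qnorm_continuous.
    have Hn2 : \forall q \near (0 : H),
        `|h (qnorm q + 0) - h 0 - 'd h 0 (qnorm q)| <= e / 2%:R * `|qnorm q|.
      exact: (cq _ Hn).
    apply: filterS Hn2 => q /=.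
    rewrite !addr0 qnorm0 dh0 !subr0 => Hq; apply: le_trans Hq _.
    rewrite ger0_norm ?qnorm_ge0 //.
    apply: le_trans (ler_wpM2l (ltW e2) (qnorm_le q)) _.
    by rewrite mulrA divfK // pnatr_eq0.
  case: D => D1 D2; split=> //.
  by rewrite deriveE // D2 /z /qdot !qc0 !mul0r !addr0 mulr0.
- have n0 := qnorm_gt0 p0.
  have N0 : 0 < qnorm p ^+ 2 by rewrite exprn_gt0.
  have ds := is_derive1_sqrt N0.
  have sE : Num.sqrt (qnorm p ^+ 2) = qnorm p.
    by rewrite sqrtr_sqr ger0_norm // ltW.
  have E : (fun p : H => h (qnorm p)) = (fun p : H => (fun s => h (Num.sqrt s)) (qnorm p ^+ 2)).
    by apply/funext => q; rewrite sqrtr_sqr ger0_norm // qnorm_ge0.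
  have dhs : is_derive (qnorm p ^+ 2) 1 (fun s => h (Num.sqrt s)) _ :=
    is_derive_comp1 (smooth1_is_derive (Num.sqrt (qnorm p ^+ 2)) sh) ds.
  have dhs' : differentiable (fun s => h (Num.sqrt s)) (qnorm p ^+ 2).
    by apply/derivable1_diffP; case: dhs.
  have dN := differentiable_qnorm_sqr p.
  rewrite E; split.
    exact: (@differentiable_comp _ _ _ _ (fun p : H => qnorm p ^+ 2) (fun s => h (Num.sqrt s))).
  rewrite (@derive_comp1 R _ (fun s => h (Num.sqrt s)) (fun p : H => qnorm p ^+ 2)) //.
  case: dhs => _ ->; case: (is_der_qnorm_sqr p v) => _ ->.
  rewrite sE /quot0 gt_eqF //.
  have nn0 : qnorm p != 0 by rewrite gt_eqF.
  move: (derive1 h (qnorm p)) => d; move: (qdot p v) => q.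
  by field.
Qed.

(** Each derivative is a radial function of the same kind times a linear function, so radial
    functions generate an algebra stable under differentiation. *)
Lemma radial_smooth (h : R -> R) : smooth_on setT h -> even_fun h ->
  smooth_on setT (fun p : H => h (qnorm p)).
Proof.
move=> sh eh; have oT := @openT H.
pose B (b : H -> R) := exists h : R -> R,
  [/\ smooth_on setT h, even_fun h & b = (fun p : H => h (qnorm p))].
apply: (@smooth_alg_smooth R H setT B _ oT); last by apply: alg_gen; exists h.
move=> _ {h sh eh} [h [sh eh ->]]; split=> [p _|v].
  by case: (radial_derive p 0 sh eh).
have oh := derive1_odd sh eh.
apply: (@alg_ext _ _ _ _ (fun p => quot0 (derive1 h) (qnorm p) * qdot p v)).
  apply: alg_mul; last by apply: alg_smooth; exact: smooth_qdot.
  apply: alg_gen; exists (quot0 (derive1 h)); split => //.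
    by apply: smooth_quot0; [exact: smooth1_derive1|exact: odd_fun0].
  exact: quot0_even.
by move=> p _; case: (radial_derive p v sh eh).
Qed.

End Radial.

Ltac quaternion_coords := apply: qP => -[|[|[|[|//]]]] _;
  rewrite /qbracket /qmul /qconj ?qcE ?qc_mkq ?qcE //=.
Ltac qring := by quaternion_coords; ring.
Ltac qfield := by quaternion_coords; field.

(** * Adjoint action and imaginary part *)

Section QuaternionAlgebra.
Variable R : realType.
Local Notation H := 'rV[R]_4.
Implicit Types (a x y z w : 'rV[R]_4) (c : R).

Lemma qmulDl x y z : qmul (x + y) z = qmul x z + qmul y z. Proof. qring. Qed.
Lemma qmulDr x y z : qmul x (y + z) = qmul x y + qmul x z. Proof. qring. Qed.
Lemma qmulNl x y : qmul (- x) y = - qmul x y. Proof. qring. Qed.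
Lemma qmulNr x y : qmul x (- y) = - qmul x y. Proof. qring. Qed.
Lemma qmulZl c x y : qmul (c *: x) y = c *: qmul x y. Proof. qring. Qed.
Lemma qmulZr c x y : qmul x (c *: y) = c *: qmul x y. Proof. qring. Qed.
Lemma qmul0q x : qmul 0 x = 0. Proof. qring. Qed.
Lemma qmulq0 x : qmul x 0 = 0. Proof. qring. Qed.
Lemma qconjD x y : qconj (x + y) = qconj x + qconj y. Proof. qring. Qed.
Lemma qconjZ c x : qconj (c *: x) = c *: qconj x. Proof. qring. Qed.

Lemma qconj_im x : qim x -> qconj x = - x.
Proof.
move=> ix; apply: qP => -[|[|[|[|//]]]] _; rewrite qcN /qconj qc_mkq //=.
by rewrite ix oppr0.
Qed.

Lemma qnorm_unit a : qunit a -> qnorm a = 1. Proof. by []. Qed.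

Lemma qnormZ c x : qnorm (c *: x) = `|c| * qnorm x.
Proof.
have n0 y : 0 <= qnorm y := qnorm_ge0 y.
apply/eqP; rewrite -(@eqrXn2 _ 2) ?mulr_ge0 // exprMn real_normK ?num_real //.
by rewrite !qnorm_sqr !qcZ; apply/eqP; ring.
Qed.

Definition qAd a x := qmul (qmul a x) (qconj a).

Lemma qAdD a x y : qAd a (x + y) = qAd a x + qAd a y.
Proof. by rewrite /qAd qmulDr qmulDl. Qed.
Lemma qAdN a x : qAd a (- x) = - qAd a x.
Proof. by rewrite /qAd qmulNr qmulNl. Qed.
Lemma qAdZ a c x : qAd a (c *: x) = c *: qAd a x.
Proof. by rewrite /qAd qmulZr qmulZl. Qed.

Lemma qAd_mul a x y : qunit a -> qmul (qAd a x) (qAd a y) = qAd a (qmul x y).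
Proof.
move=> ua; rewrite /qAd -!qmulA; congr (qmul a (qmul x _)).
by rewrite qmulA qmulVq // qmul1q.
Qed.

Lemma qAd_bracket a x y : qunit a -> qbracket (qAd a x) (qAd a y) = qAd a (qbracket x y).
Proof. by move=> ua; rewrite /qbracket !qAd_mul // qAdD qAdN. Qed.

Lemma qAd_im a x : qim x -> qim (qAd a x).
Proof.
move=> ix; rewrite /qim; have -> : qc (qAd a x) 0 =
  (qc a 0 ^+ 2 + qc a 1 ^+ 2 + qc a 2 ^+ 2 + qc a 3 ^+ 2) * qc x 0.
  by rewrite /qAd /qmul /qconj !qc_mkq //=; ring.
by rewrite ix mulr0.
Qed.

Lemma qAdM a b x : qAd (qmul a b) x = qAd a (qAd b x).
Proof. by rewrite /qAd qconjM -!qmulA. Qed.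

Lemma qAd_conjK a x : qunit a -> qAd (qconj a) (qAd a x) = x.
Proof.
move=> ua; rewrite -qAdM qmulVq // /qAd qmul1q.
have -> : qconj (q1 R) = q1 R by rewrite /q1; qring.
by rewrite qmulq1.
Qed.

Definition qIm x : H := mkq 0 (qc x 1) (qc x 2) (qc x 3).

Lemma qImD x y : qIm (x + y) = qIm x + qIm y. Proof. by rewrite /qIm; qring. Qed.
Lemma qImN x : qIm (- x) = - qIm x. Proof. by rewrite /qIm; qring. Qed.
Lemma qImZ c x : qIm (c *: x) = c *: qIm x. Proof. by rewrite /qIm; qring. Qed.
Lemma qIm_im x : qim (qIm x). Proof. by rewrite /qim qc_mkq. Qed.
Lemma qImE x : qIm x = 2%:R^-1 *: (x - qconj x).
Proof.
apply: qP => -[|[|[|[|//]]]] _; rewrite /qIm /qconj ?qcE ?qc_mkq ?qcE //=; by field.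
Qed.
Lemma qIm_id x : qim x -> qIm x = x.
Proof.
by move=> ix; apply: qP => -[|[|[|[|//]]]] _; rewrite /qIm qc_mkq //= ix.
Qed.
Lemma qIm_q1 c : qIm (c *: q1 R) = 0. Proof. by rewrite /qIm /q1; qring. Qed.

Lemma qIm_Ad a x : qIm (qAd a x) = qAd a (qIm x).
Proof.
rewrite !qImE qAdZ qAdD qAdN; congr (_ *: (_ - _)).
by rewrite /qAd !qconjM qconjK qmulA.
Qed.

Lemma qim_conjM_im a x : qunit a -> qim (qmul (qconj a) x) -> qim (qmul x (qconj a)).
Proof.
move=> ua ix; have -> : qmul x (qconj a) = qAd a (qmul (qconj a) x).
  by rewrite /qAd qmulA qmulqV // qmul1q.
exact: qAd_im.
Qed.

End QuaternionAlgebra.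

(** * The extended connection form and its symmetries *)

Section Extension.
Variable R : realType.
Local Notation H := 'rV[R]_4.
Local Notation HHH := (H * H * H)%type.
Variables (f h : R -> R).
Hypothesis sf : smooth_on [set: R] f.
Hypothesis ef : even_fun f.
Hypothesis sh : smooth_on [set: R] h.
Hypothesis eh : even_fun h.

(* The connection form in the coordinates [((p, q), k)] of [Pid]: with
   [p = t a1], [q = a1 a2^-1], [k = a1 g] it is [g^-1 theta g + g^-1 dg] for
   [theta = f (a1^-1 da1 + a2^-1 da2) / 2] and [f = 1 - t^2 h]. *)
Definition Xi (x v : HHH) : H :=
  h (qnorm x.1.1) *: qIm (qmul v.1.1 (qconj x.1.1))
  + (f (qnorm x.1.1) / 2%:R) *: qmul v.1.2 (qconj x.1.2).

Definition Th : kform 1 HHH H := fun x v =>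
  qmul (qconj x.2) (v ord0).2 - qmul (qmul (qconj x.2) (Xi x (v ord0))) x.2.

Lemma Xi_linear x c u w : Xi x (c *: u + w) = c *: Xi x u + Xi x w.
Proof.
rewrite /Xi /= !qmulDl !qmulZl qImD qImZ !scalerDr !scalerA.
rewrite [c * h _]mulrC [c * (f _ / _)]mulrC; exact: addrACA.
Qed.

Lemma Th_linear x c u w : Th x (fun=> c *: u + w) = c *: Th x (fun=> u) + Th x (fun=> w).
Proof.
rewrite /Th Xi_linear /= qmulDr qmulZr (qmulDr (qconj x.2)) qmulDl.
rewrite qmulZr qmulZl scalerBr opprD; exact: addrACA.
Qed.

Let oT := @openT HHH.

Lemma linear_pp : linear (fun x : HHH => x.1.1). Proof. by []. Qed.
Lemma linear_qq : linear (fun x : HHH => x.1.2). Proof. by []. Qed.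
Lemma linear_kk : linear (fun x : HHH => x.2). Proof. by []. Qed.
Lemma continuous_pp : continuous (fun x : HHH => x.1.1).
Proof. by move=> x; apply: continuous_comp; exact: cvg_fst. Qed.
Lemma continuous_qq : continuous (fun x : HHH => x.1.2).
Proof. by move=> x; apply: continuous_comp; [exact: cvg_fst|exact: cvg_snd]. Qed.
Lemma continuous_kk : continuous (fun x : HHH => x.2).
Proof. by move=> x; exact: cvg_snd. Qed.

Lemma smooth_pp : smooth_on setT (fun x : HHH => x.1.1).
Proof. exact: (smooth_on_lin oT linear_pp continuous_pp). Qed.
Lemma smooth_qq : smooth_on setT (fun x : HHH => x.1.2).
Proof. exact: (smooth_on_lin oT linear_qq continuous_qq). Qed.
Lemma smooth_kk : smooth_on setT (fun x : HHH => x.2).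
Proof. exact: (smooth_on_lin oT linear_kk continuous_kk). Qed.

Lemma smooth_radial (g : R -> R) : smooth_on setT g -> even_fun g ->
  smooth_on setT (fun x : HHH => g (qnorm x.1.1)).
Proof.
move=> sg eg.
exact: (smooth_on_comp_lin oT linear_pp continuous_pp (radial_smooth sg eg)).
Qed.

Lemma smooth_Xi v : smooth_on setT (fun x => Xi x v).
Proof.
apply: smooth_onD => //.
- apply: (smooth_on_scale oT); first exact: smooth_radial.
  have m : smooth_on setT (fun x : HHH => qmul v.1.1 (qconj x.1.1)).
    apply: (smooth_on_qmul oT); first exact: smooth_on_cst.
    by apply: (smooth_on_qconj oT); exact: smooth_pp.
  by apply: (smooth_on_mkq oT); [exact: smooth_on_cst|exact: (smooth_on_qc oT)..].
- apply: (smooth_on_scale oT).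
    by apply: smooth_onM => //; [exact: smooth_radial|exact: smooth_on_cst].
  apply: (smooth_on_qmul oT); first exact: smooth_on_cst.
  by apply: (smooth_on_qconj oT); exact: smooth_qq.
Qed.

Lemma smooth_Th v : smooth_on setT (fun x => Th x v).
Proof.
have sk := smooth_on_qconj oT smooth_kk.
apply: (smooth_on_qsub oT).
  by apply: (smooth_on_qmul oT) => //; exact: smooth_on_cst.
apply: (smooth_on_qmul oT); last exact: smooth_kk.
by apply: (smooth_on_qmul oT) => //; exact: smooth_Xi.
Qed.

Lemma dfwith_ord1 (E : Type) (v : 'I_1 -> E) i u : dfwith v i u = fun=> u.
Proof. by apply/funext => j; rewrite (ord1 i) (ord1 j) dfwithin. Qed.

Lemma Th_form r : smooth_form (Pid r) Th.
Proof.
exists setT; split => // [x _|v]; last exact: smooth_Th.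
split; first by move=> v i s u w; rewrite !dfwith_ord1 Th_linear.
by move=> v i j; rewrite (ord1 i) (ord1 j) eqxx.
Qed.

Lemma Xi_im x v : qunit x.1.2 -> qim (qmul (qconj x.1.2) v.1.2) -> qim (Xi x v).
Proof.
move=> uq iq; rewrite /qim /Xi qcD !qcZ (qIm_im _) (qim_conjM_im uq iq).
by rewrite !mulr0 addr0.
Qed.

Lemma der_ract (g : H) (x v : HHH) : 'D_v (pid_ract g) x = (v.1, qmul v.2 g).
Proof.
have d := is_derive_id x v.
case: (is_der_pair (is_der_fst d) (is_der_qmul (is_der_snd d) (is_der_cst g x v))).
by move=> _; rewrite qmulq0 addr0.
Qed.

Lemma der_lact (b1 b2 : H) (x v : HHH) : 'D_v (pid_lact b1 b2) x = pid_lact b1 b2 v.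
Proof.
have d := is_derive_id x v.
have C b := is_der_cst (b : H) x v.
case: (is_der_pair (is_der_pair (is_der_qmul (C b1) (is_der_fst (is_der_fst d)))
    (is_der_qmul (is_der_qmul (C b1) (is_der_snd (is_der_fst d))) (C (qconj b2))))
  (is_der_qmul (C b1) (is_der_snd d))).
by move=> _; rewrite !qmulq0 !qmul0q !addr0 !add0r.
Qed.

Lemma qAd_conjE k (Z : H) : qAd (qconj k) Z = qmul (qmul (qconj k) Z) k.
Proof. by rewrite /qAd qconjK. Qed.

Lemma Th_connection r : connection r Th.
Proof.
split; first exact: Th_form.
- move=> x v Px /tangent_Pid_qim [iq ik]; case: Px => [[_ uq] uk].
  rewrite /qim /Th qcD qcN ik -qAd_conjE (qAd_im _ (Xi_im uq iq)).
  by rewrite subrr.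
- move=> x X [[_ uq] uk] iX; rewrite /Th /Xi /= !qmul0q.
  rewrite (qIm_id (qc0 R 0)) !scaler0 addr0 qmulq0 qmul0q subr0.
  by rewrite qmulA qmulVq // qmul1q.
- move=> g ug x v Px _; rewrite /pullback /Th !der_ract /=.
  rewrite qconjM qmulDr qmulDl qmulNr qmulNl -!qmulA; congr (_ - _).
Qed.

(** The third factor fixes the singular orbit pointwise, so on a bundle pulled back from there it
    can act trivially on the fibre coordinate. *)
Definition lift_act (c : H) (x : HHH) : HHH := ((qmul x.1.1 (qconj c), x.1.2), x.2).

Lemma qnorm_qmul (a b : H) : qnorm (qmul a b) = qnorm a * qnorm b.
Proof.
apply/eqP; rewrite -(@eqrXn2 _ 2) ?mulr_ge0 ?qnorm_ge0 // exprMn !qnorm_sqr.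
by rewrite /qmul !qc_mkq //=; apply/eqP; ring.
Qed.

Lemma qnorm_conj (a : H) : qnorm (qconj a) = qnorm a.
Proof.
apply/eqP; rewrite -(@eqrXn2 _ 2) ?qnorm_ge0 // !qnorm_sqr.
by rewrite /qconj !qc_mkq //=; apply/eqP; ring.
Qed.

Lemma der_lift (c : H) (x v : HHH) : 'D_v (lift_act c) x = lift_act c v.
Proof.
have d := is_derive_id x v.
case: (is_der_pair (is_der_pair (is_der_qmul (is_der_fst (is_der_fst d))
    (is_der_cst (qconj c) x v)) (is_der_snd (is_der_fst d))) (is_der_snd d)).
by move=> _; rewrite qmulq0 addr0.
Qed.

Lemma lift_act_lift3 r : lift3 r lift_act.
Proof.
have oT4 := @openT (H * HHH)%type.
have lf : linear (fun cx : H * HHH => cx.1) by [].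
have ls : linear (fun cx : H * HHH => cx.2) by [].
have cf : continuous (fun cx : H * HHH => cx.1) by move=> z; exact: cvg_fst.
have cs : continuous (fun cx : H * HHH => cx.2) by move=> z; exact: cvg_snd.
split.
- exists setT; split => //.
  apply: smooth_on_pair => //; last exact: (smooth_on_comp_lin oT4 ls cs smooth_kk).
  apply: smooth_on_pair => //; last exact: (smooth_on_comp_lin oT4 ls cs smooth_qq).
  apply: (smooth_on_qmul oT4); first exact: (smooth_on_comp_lin oT4 ls cs smooth_pp).
  by apply: (smooth_on_qconj oT4); exact: (smooth_on_lin oT4 lf cf).
- move=> c x uc [[rp uq] uk]; split=> //; split=> //; split=> //=.
  by rewrite qnorm_qmul qnorm_conj (qnorm_unit uc) mulr1.
- by [].
- split=> [[[p q] k] _|c c' x _ _ _]; rewrite /lift_act /=.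
    have -> : qconj (q1 R) = q1 R.
      by apply: qP => -[|[|[|[|//]]]] _; rewrite /qconj /q1 !qc_mkq //= oppr0.
    by rewrite qmulq1.
  by rewrite qconjM qmulA.
- by move=> c b1 b2 x _ _ _ _; rewrite /lift_act /pid_lact /= qmulA.
Qed.

(** Both [dp p^-] and [dq q^-] are conjugated by [b1], and [|p|] is unchanged. *)
Lemma Xi_lact b1 b2 x v : qunit b1 -> qunit b2 ->
  Xi (pid_lact b1 b2 x) (pid_lact b1 b2 v) = qAd b1 (Xi x v).
Proof.
move=> u1 u2; rewrite /Xi /= qnorm_qmul (qnorm_unit u1) mul1r qAdD !qAdZ -qIm_Ad.
congr (_ *: qIm _ + _ *: _); first by rewrite /qAd qconjM !qmulA.
rewrite /qAd !qconjM qconjK -!qmulA; congr (qmul b1 (qmul _ _)).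
by rewrite qmulA qmulVq // qmul1q.
Qed.

Lemma Xi_lift c x v : qunit c -> Xi (lift_act c x) (lift_act c v) = Xi x v.
Proof.
move=> uc; rewrite /Xi /= qnorm_qmul qnorm_conj (qnorm_unit uc) mulr1.
congr (_ *: qIm _ + _).
by rewrite qconjM qconjK -qmulA (qmulA (qconj c)) qmulVq // qmul1q.
Qed.

Lemma Th_invariant r : SU2_3_invariant r Th.
Proof.
exists lift_act; split; first exact: lift_act_lift3.
- move=> b1 b2 u1 u2 x v _ _; rewrite /pullback /Th !der_lact Xi_lact //=.
  rewrite /qAd qconjM -!qmulA.
  have e w : qmul (qconj b1) (qmul b1 w) = w by rewrite qmulA qmulVq // qmul1q.
  by rewrite !e.
- by move=> c uc x v _ _; rewrite /pullback /Th !der_lift Xi_lift.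
Qed.

End Extension.

(** * Curvature of the extended connection off the singular orbit *)

Section ExtensionCurvature.
Variable R : realType.
Local Notation H := 'rV[R]_4.
Local Notation E0 := (R * H * H)%type.
Local Notation HHH := (H * H * H)%type.
Variables (f h : R -> R).
Hypothesis sf : smooth_on [set: R] f.
Hypothesis ef : even_fun f.
Hypothesis sh : smooth_on [set: R] h.
Hypothesis eh : even_fun h.
Hypothesis fh : forall t, f t = 1 - t ^+ 2 * h t.

Local Notation XI := (Xi f h).
Local Notation TH := (Th f h).

(* The image in [M] of the tangent vector [(u, a1 X, a2 Y)] of [Reg] at
   [(t, a1, a2)]. *)
Definition frame (t : R) (a1 a2 : H) (u : R) (X Y : H) : H * H :=
  (u *: a1 + t *: qmul a1 X, qmul (qmul a1 (X - Y)) (qconj a2)).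

Section Frame.
Variables (t : R) (a1 a2 : H).
Hypothesis t0 : 0 < t.
Hypothesis u1 : qunit a1.
Hypothesis u2 : qunit a2.

Lemma frame_p u X Y : (frame t a1 a2 u X Y).1 = qmul a1 (u *: q1 R + t *: X).
Proof. by rewrite /frame /= qmulDr !qmulZr qmulq1. Qed.

Lemma frame_pp u X Y u' X' Y' : qim X' ->
  qmul (frame t a1 a2 u X Y).1 (qconj (frame t a1 a2 u' X' Y').1) =
  qAd a1 (qmul (u *: q1 R + t *: X) (u' *: q1 R - t *: X')).
Proof.
move=> iX'; rewrite !frame_p qconjM /qAd !qmulA; congr (qmul _ _).
rewrite -!qmulA; congr (qmul a1 (qmul _ _)).
rewrite qconjD !qconjZ (qconj_im iX') scalerN; congr (_ *: _ - _).
by apply: qP => -[|[|[|[|//]]]] _; rewrite /qconj /q1 !qc_mkq //= oppr0.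
Qed.

Lemma frame_qq u X Y u' X' Y' : qim X' -> qim Y' ->
  qmul (frame t a1 a2 u X Y).2 (qconj (frame t a1 a2 u' X' Y').2) =
  - qAd a1 (qmul (X - Y) (X' - Y')).
Proof.
move=> iX' iY'; have i : qim (X' - Y') by rewrite /qim qcD qcN iX' iY' subrr.
rewrite /frame /= !qconjM qconjK (qconj_im i) -!qmulA.
rewrite (qmulA (qconj a2) a2) qmulVq // qmul1q /qAd -!qmulA.
by rewrite -qmulNr -qmulNr -qmulNl.
Qed.

Lemma qnorm_frame : qnorm (t *: a1) = t.
Proof. by rewrite qnormZ (qnorm_unit u1) mulr1 gtr0_norm. Qed.

Lemma base_p : t *: a1 = (frame t a1 a2 t 0 0).1.
Proof. by rewrite frame_p scaler0 addr0 qmulZr qmulq1. Qed.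

(** The radial velocity is real and drops out under [qIm], leaving the factor [t^2] that turns the
    coefficient [h] into [1 - f]. *)
Lemma frame_p_base u X Y :
  qIm (qmul (frame t a1 a2 u X Y).1 (qconj (t *: a1))) = t ^+ 2 *: qAd a1 (qIm X).
Proof.
rewrite base_p frame_pp; last by rewrite /qim qc0.
rewrite qIm_Ad scaler0 subr0 qmulZr qmulq1 qImZ qImD qIm_q1 add0r qImZ scalerA.
by rewrite -expr2 qAdZ.
Qed.

Lemma frame_q_base u X Y :
  qmul (frame t a1 a2 u X Y).2 (qconj (qmul a1 (qconj a2))) = qAd a1 (X - Y).
Proof.
rewrite /frame /= qconjM qconjK -!qmulA (qmulA (qconj a2)) qmulVq // qmul1q.
by rewrite /qAd qmulA.
Qed.

(** This is [(1 - f) X + (f/2) (X - Y) = X - (f/2) (X + Y)], conjugated by [a1]. *)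
Lemma Xi_frame k dk u X Y : qim X ->
  XI (t *: a1, qmul a1 (qconj a2), k) (frame t a1 a2 u X Y, dk) =
  qAd a1 (X - (f t / 2%:R) *: (X + Y)).
Proof.
move=> iX; have := frame_p_base u X Y; have := frame_q_base u X Y.
move: (frame t a1 a2 u X Y) => F eq ep.
rewrite /Xi /= qnorm_frame ep eq (qIm_id iX) -!qAdZ -qAdD fh.
congr (qAd a1 _); rewrite !scalerA; move: (h t) => ht; qfield.
Qed.

Lemma Th_frame k dk u X Y : qim X -> TH (t *: a1, qmul a1 (qconj a2), k)
    (fun=> (frame t a1 a2 u X Y, dk)) =
  qmul (qconj k) dk - qAd (qconj k) (qAd a1 (X - (f t / 2%:R) *: (X + Y))).
Proof. by move=> iX; rewrite /Th Xi_frame //= qAd_conjE. Qed.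

Lemma der_reg_to_M (z w : E0) : 'D_w (@reg_to_M R) z =
  (w.1.1 *: z.1.2 + z.1.1 *: w.1.2, qmul w.1.2 (qconj z.2) + qmul z.1.2 (qconj w.2)).
Proof.
have d := is_derive_id z w.
case: (is_der_pair
  (@is_der_scale R _ (fun z : E0 => z.1.1) _ _ _ _ _ (is_der_fst (is_der_fst d))
    (is_der_snd (is_der_fst d)))
  (is_der_qmul (is_der_snd (is_der_fst d)) (is_der_qconj (is_der_snd d)))).
by [].
Qed.

Lemma der_reg_to_M_frame u X Y : qim Y ->
  'D_((u, qmul a1 X, qmul a2 Y) : E0) (@reg_to_M R) (t, a1, a2) = frame t a1 a2 u X Y.
Proof.
move=> iY; rewrite der_reg_to_M /frame /=; congr (_, _).
by rewrite qconjM (qconj_im iY) qmulNl qmulNr (qmulDr a1) (qmulNr a1) qmulDl qmulNl qmulA.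
Qed.

End Frame.

Lemma der_pid_sec (z w : E0) : 'D_w (@pid_sec R) z = ('D_w (@reg_to_M R) z, w.1.2).
Proof.
have d := is_derive_id z w.
have dM : is_derive z w (@reg_to_M R) ('D_w (@reg_to_M R) z).
  have := is_der_pair
    (@is_der_scale R _ (fun z : E0 => z.1.1) _ _ _ _ _ (is_der_fst (is_der_fst d))
      (is_der_snd (is_der_fst d)))
    (is_der_qmul (is_der_snd (is_der_fst d)) (is_der_qconj (is_der_snd d))).
  by case=> dr _; apply: DeriveDef.
case: (is_der_pair dM (is_der_qmul (is_der_snd (is_der_fst d)) (is_der_cst (q1 R) z w))).
by move=> _; rewrite qmulq0 addr0 qmulq1.
Qed.

Lemma conjMK (a w : H) : qunit a -> w = qmul a (qmul (qconj a) w).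
Proof. by move=> ua; rewrite qmulA qmulqV // qmul1q. Qed.

Lemma tangent_Reg_frame r (z w : E0) : Reg r z -> tangent (Reg r) z w ->
  exists X Y, [/\ qim X, qim Y & w = (w.1.1, qmul z.1.2 X, qmul z.2 Y)].
Proof.
move=> [t0 tr u1 u2] /tangent_Reg_qim [iX iY].
exists (qmul (qconj z.1.2) w.1.2), (qmul (qconj z.2) w.2); split => //.
by rewrite -!conjMK //; case: w {iX iY} => [[? ?] ?].
Qed.

(** Along the section [k = a1] and [dk = a1 X], so [k^-1 dk = X] cancels the first term of
    [Xi_frame] and leaves [(f/2) (X + Y)]. *)
Lemma pid_sec_Th r (th : kform 1 E0 H) :
  (forall (t u : R) a1 a2 X Y, 0 < t -> qunit a1 -> qunit a2 -> qim X -> qim Y ->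
    th (t, a1, a2) (fun=> (u, qmul a1 X, qmul a2 Y)) = (f t / 2%:R) *: (X + Y)) ->
  form_eq (Reg r) (pullback (@pid_sec R) TH) th.
Proof.
move=> hth z v Rz tv; rewrite /pullback.
have [X [Y [iX iY e]]] := tangent_Reg_frame Rz (tv ord0).
case: Rz => t0 _ u1 u2.
have ve : v = fun=> v ord0 by apply/funext => i; rewrite (ord1 i).
rewrite ve; move: (v ord0) e => w ->; move: w.1.1 => {v w tv ve} u.
case: z t0 u1 u2 => [[t a1] a2] /= t0 u1 u2.
rewrite hth // /pid_sec /reg_to_M /pid_fiber /= qmulq1.
have -> : (fun _ : 'I_1 => 'D_((u, qmul a1 X, qmul a2 Y) : E0) (@pid_sec R) (t, a1, a2)) =
    fun=> (frame t a1 a2 u X Y, qmul a1 X).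
  by apply/funext => i; rewrite der_pid_sec der_reg_to_M_frame.
rewrite Th_frame // qmulA qmulVq // qmul1q qAd_conjK //.
by rewrite opprB addrC subrK.
Qed.

Lemma is_der_Xi (x v w : HHH) : is_derive x v (fun z => XI z w)
  ((quot0 (derive1 h) (qnorm x.1.1) * qdot x.1.1 v.1.1) *: qIm (qmul w.1.1 (qconj x.1.1))
   + h (qnorm x.1.1) *: qIm (qmul w.1.1 (qconj v.1.1))
   + ((quot0 (derive1 f) (qnorm x.1.1) * qdot x.1.1 v.1.1 / 2%:R)
        *: qmul w.1.2 (qconj x.1.2)
      + (f (qnorm x.1.1) / 2%:R) *: qmul w.1.2 (qconj v.1.2))).
Proof.
have d := is_derive_id x v.
have rad (g : R -> R) : smooth_on setT g -> even_fun g -> is_derive x v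
    (fun z : HHH => g (qnorm z.1.1) : R) (quot0 (derive1 g) (qnorm x.1.1) * qdot x.1.1 v.1.1).
  move=> sg eg; have [D E] := radial_derive x.1.1 v.1.1 sg eg.
  have dg : differentiable (fun z : HHH => g (qnorm z.1.1)) x.
    by have := smooth_on_differentiable (smooth_radial sg eg) (I : setT x).
  apply: DeriveDef; first exact: diff_derivable.
  rewrite -E deriveE //.
  have dp : differentiable (fun z : HHH => z.1.1) x.
    exact: (differentiable_linear x (@linear_pp R) (@continuous_pp R)).
  rewrite (@diff_comp _ _ _ _ (fun z : HHH => z.1.1) (fun p : H => g (qnorm p))) //=.
  rewrite (@diff_lin _ _ _ (linear_of (@linear_pp R))) //=; last exact: (@continuous_pp R).
  by rewrite deriveE.
have lI (c : R) (u u' : H) : qIm (c *: (u - u')) = c *: (qIm u - qIm u').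
  by rewrite qImZ qImD qImN.
have cI : continuous (@qIm R).
  have lq : linear (@qIm R) by move=> c u u'; rewrite qImD qImZ.
  exact: (@linear_quat_continuous R _ (@linear_of R _ _ _ lq)).
have di := is_der_linear lI cI (is_der_qmul (is_der_cst w.1.1 x v)
  (is_der_qconj (is_der_fst (is_der_fst d)))).
have dq := is_der_qmul (is_der_cst w.1.2 x v) (is_der_qconj (is_der_snd (is_der_fst d))).
have rf2 := is_der_mul (rad f sf ef) (is_der_cst (2%:R^-1 : R^o) x v).
apply: (is_derive_eq (is_der_add (is_der_scale (rad h sh eh) di) (is_der_scale rf2 dq))).
by rewrite !qmul0q !add0r mulr0 addr0.
Qed.

(** [Th] is the gauge transform by [k] of the form [- Xi], so its curvature is the conjugate of [-
    (d Xi - [Xi, Xi])]. *)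
Lemma Th_curvature (x : HHH) (v : 'I_2 -> HHH) : qunit x.2 ->
  (forall i, qim (qmul (qconj x.2) (v i).2)) ->
  let v0 := v ord0 in let v1 := v (lift ord0 ord0) in
  curvature TH x v = - qAd (qconj x.2)
    ('D_v0 (fun z => XI z v1) x - 'D_v1 (fun z => XI z v0) x
     - qbracket (XI x v0) (XI x v1)).
Proof.
move=> uk ik v0 v1.
have D (u w : HHH) : 'D_u (fun z => TH z (fun=> w)) x =
    qmul (qconj u.2) w.2 - (qmul (qmul (qconj u.2) (XI x w)
      + qmul (qconj x.2) ('D_u (fun z => XI z w) x)) x.2
      + qmul (qmul (qconj x.2) (XI x w)) u.2).
  have d := is_derive_id x u.
  have dX : is_derive x u (fun z => XI z w) ('D_u (fun z => XI z w) x).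
    by case: (is_der_Xi x u w) => dr _; apply: DeriveDef.
  case: (is_der_sub (is_der_qmul (is_der_qconj (is_der_snd d)) (is_der_cst w.2 x u))
    (is_der_qmul (is_der_qmul (is_der_qconj (is_der_snd d)) dX) (is_der_snd d))).
  by move=> _; rewrite qmulq0 addr0.
rewrite curvatureE !D /Th -/v0 -/v1.
have uk' := qunitV uk.
have K (w : HHH) : qim (qmul (qconj x.2) w.2) -> exists kk : H, w.2 = qmul x.2 kk /\ qim kk.
  by move=> iw; exists (qmul (qconj x.2) w.2); split => //; exact: conjMK.
have [k0 [e0 i0]] := K v0 (ik _); have [k1 [e1 i1]] := K v1 (ik _).
rewrite !qAdD !qAdN -qAd_bracket // !qAd_conjE.
rewrite e0 e1 !qconjM (qconj_im i0) (qconj_im i1).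
move: (XI x v0) (XI x v1) ('D_v0 _ x) ('D_v1 _ x) => X0 X1 D0 D1.
have C w : qmul (qconj x.2) (qmul x.2 w) = w by rewrite qmulA qmulVq // qmul1q.
have E (a b c d : H) : qmul (qmul (qmul a b) c) d = qmul a (qmul (qmul b c) d).
  by rewrite !qmulA.
rewrite !qmulNl -!qmulA !C.
rewrite !(qmulDl, qmulNl, qmulDr, qmulNr) -!qmulA.
have P w w' : qmul (qconj x.2) (qmul w (qmul x.2 w')) =
    qmul (qmul (qconj x.2) (qmul w x.2)) w' by rewrite !qmulA.
rewrite !P.
move: (qmul (qconj x.2) (qmul X0 x.2)) (qmul (qconj x.2) (qmul X1 x.2))
  (qmul (qconj x.2) (qmul D0 x.2)) (qmul (qconj x.2) (qmul D1 x.2)) => Y0 Y1 Z0 Z1.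
rewrite /qbracket !(qmulDl, qmulDr, qmulNl, qmulNr).
by apply: qP => i _; rewrite !qcE; ring.
Qed.

Lemma derive1_fh t : derive1 f t = - (2%:R * t * h t + t ^+ 2 * derive1 h t).
Proof.
have -> : f = (fun t => 1 - t ^+ 2 * h t) by apply/funext.
rewrite derive1E.
case: (is_der_sub (is_der_cst (1 : R^o) t 1) (is_der_mul
  (is_der_expS 1 (is_derive_id t 1)) (smooth1_is_derive t sh))) => _ ->.
by rewrite expr1 mulr1 sub0r.
Qed.

(** The curvature of [f (a1^-1 da1 + a2^-1 da2) / 2] on the vectors [(u_i, a1 X_i, a2 Y_i)]; the
    middle term is the Maurer-Cartan contribution. *)
Definition theta_curv (t u0 u1 : R) (X0 X1 Y0 Y1 : H) : H :=
  (derive1 f t / 2%:R) *: (u0 *: (X1 + Y1) - u1 *: (X0 + Y0))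
  - (f t / 2%:R) *: (qbracket X0 X1 + qbracket Y0 Y1)
  + (f t ^+ 2 / 4%:R) *: qbracket (X0 + Y0) (X1 + Y1).

Lemma qdotE (p v : H) : qdot p v = qc (qmul v (qconj p)) 0.
Proof. by rewrite /qdot /qmul /qconj !qc_mkq //=; ring. Qed.

Lemma qc_qAd (a w : H) : qunit a -> qc (qAd a w) 0 = qc w 0.
Proof.
move=> /qunit_sum ua; rewrite -[RHS]mul1r -ua.
by rewrite /qAd /qmul /qconj !qc_mkq //=; ring.
Qed.

Lemma der_Xi_frame (t : R) (a1 a2 k dk dk' : H) (u u' : R) (X X' Y Y' : H) :
  0 < t -> qunit a1 -> qunit a2 -> qim X -> qim X' -> qim Y -> qim Y' ->
  'D_(frame t a1 a2 u X Y, dk) (fun z => XI z (frame t a1 a2 u' X' Y', dk'))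
     (t *: a1, qmul a1 (qconj a2), k) =
  qAd a1 ((derive1 h t * u * t ^+ 2) *: X' +
    h t *: qIm (qmul (u' *: q1 R + t *: X') (u *: q1 R - t *: X)) +
    (derive1 f t * u / 2%:R) *: (X' - Y') -
    (f t / 2%:R) *: qmul (X' - Y') (X - Y)).
Proof.
move=> t0 u1 u2 iX iX' iY iY'.
have tn0 : t != 0 by rewrite gt_eqF.
have qd : qdot (t *: a1) (frame t a1 a2 u X Y).1 = t * u.
  rewrite qdotE (base_p t a1 a2) frame_pp; last by rewrite /qim qc0.
  rewrite qc_qAd // scaler0 subr0 qmulZr qmulq1 !qcE iX /q1 qc_mkq //=; ring.
(* The factor [t] in [<p, dp> = t u] undoes the division by [t] in the radial derivative. *)
have qh (g : R -> R) : quot0 (derive1 g) t * (t * u) = derive1 g t * u.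
  by rewrite /quot0 (negbTE tn0); field.
have ep := frame_p_base t a1 a2 u' X' Y'.
have eq := frame_q_base t a1 u2 u' X' Y'.
have epp := frame_pp t a1 a2 u' X' Y' u Y iX.
have eqq := frame_qq t a1 u2 u' X' Y' u iX iY.
move: (frame t a1 a2 u X Y) (frame t a1 a2 u' X' Y') qd ep eq epp eqq => F F' qd ep eq epp eqq.
case: (is_der_Xi (t *: a1, qmul a1 (qconj a2), k) (F, dk) (F', dk')) => _ ->.
rewrite /= (qnorm_frame t0 u1) qd !qh ep eq epp eqq (qIm_id iX') qIm_Ad scalerN scalerA.
by rewrite !qAdD !qAdN !qAdZ addrA qAdD qAdN.
Qed.

(** With [theta_curvature] this plays the role of naturality of the curvature, at every point of the
    fibre and not only on the section. It is a direct computation from [f = 1 - t^2 h] and the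
    resulting formula for [f']. *)
Lemma Th_curvature_frame (t : R) (a1 a2 k : H) (u0 u1 : R) (X0 X1 Y0 Y1 : H)
    (v : 'I_2 -> HHH) :
  0 < t -> qunit a1 -> qunit a2 -> qunit k -> qim X0 -> qim X1 -> qim Y0 -> qim Y1 ->
  (forall i, qim (qmul (qconj k) (v i).2)) ->
  (v ord0).1 = frame t a1 a2 u0 X0 Y0 ->
  (v (lift ord0 ord0)).1 = frame t a1 a2 u1 X1 Y1 ->
  curvature TH (t *: a1, qmul a1 (qconj a2), k) v =
  qAd (qconj k) (qAd a1 (theta_curv t u0 u1 X0 X1 Y0 Y1)).
Proof.
move=> t0 ua1 ua2 uk iX0 iX1 iY0 iY1 ik e0 e1.
rewrite Th_curvature //=.
have -> : v ord0 = (frame t a1 a2 u0 X0 Y0, (v ord0).2) by rewrite -e0; case: (v ord0).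
have -> : v (lift ord0 ord0) = (frame t a1 a2 u1 X1 Y1, (v (lift ord0 ord0)).2).
  by rewrite -e1; case: (v _).
rewrite !der_Xi_frame // !Xi_frame // qAd_bracket // -!qAdN -!qAdD -qAdN.
congr (qAd _ (qAd _ _)); rewrite /theta_curv derive1_fh fh.
move: (h t) (derive1 h t) => ht ht'.
have q1E : qmul (u1 *: q1 R + t *: X1) (u0 *: q1 R - t *: X0) =
   (u1 * u0) *: q1 R + (u0 * t) *: X1 - (u1 * t) *: X0 - (t * t) *: qmul X1 X0.
  rewrite !(qmulDl, qmulDr, qmulNl, qmulNr, qmulZl, qmulZr) !qmulq1 !qmul1q.
  by apply: qP => i _; rewrite !qcE; ring.
have q1E' : qmul (u0 *: q1 R + t *: X0) (u1 *: q1 R - t *: X1) =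
   (u0 * u1) *: q1 R + (u1 * t) *: X0 - (u0 * t) *: X1 - (t * t) *: qmul X0 X1.
  rewrite !(qmulDl, qmulDr, qmulNl, qmulNr, qmulZl, qmulZr) !qmulq1 !qmul1q.
  by apply: qP => i _; rewrite !qcE; ring.
rewrite q1E q1E' !qImD !qImN !qImZ (qIm_id iX0) (qIm_id iX1).
have -> : qIm (q1 R) = 0 by rewrite /qIm /q1; qring.
(* The real parts of [X0 X1] and [X1 X0] agree, so they cancel after antisymmetrisation; the
   products can then be treated as independent atoms. *)
have b (Z : H) : qIm Z = Z - qc Z 0 *: q1 R.
  by apply: qP => -[|[|[|[|//]]]] _; rewrite /qIm /q1 ?qcE !qc_mkq //=; ring.
have cc : qc (qmul X0 X1) 0 = qc (qmul X1 X0) 0.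
  by rewrite /qmul !qc_mkq //=; ring.
rewrite !b cc /qbracket !(qmulDl, qmulDr, qmulNl, qmulNr, qmulZl, qmulZr).
move: (qc (qmul X1 X0) 0) (q1 R) => c e.
move: (qmul X0 X0) (qmul X0 X1) (qmul X0 Y0) (qmul X0 Y1) (qmul X1 X0) (qmul X1 X1)
  (qmul X1 Y0) (qmul X1 Y1) (qmul Y0 X0) (qmul Y0 X1) (qmul Y0 Y0) (qmul Y0 Y1)
  (qmul Y1 X0) (qmul Y1 X1) (qmul Y1 Y0) (qmul Y1 Y1).
by move=> ? ? ? ? ? ? ? ? ? ? ? ? ? ? ? ?; apply: qP => i _; rewrite !qcE; field.
Qed.

End ExtensionCurvature.

(** * The instanton equation on the bundle off the singular orbit *)

Section InstantonExtension.
Variables (R : realType) (T : 3.-tuple 'rV[R]_4).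
Hypothesis hT : standard_basis T.
Local Notation H := 'rV[R]_4.
Local Notation E0 := (R * H * H)%type.
Local Notation HHH := (H * H * H)%type.
Variables (f h : R -> R).
Hypothesis sf : smooth_on [set: R] f.
Hypothesis ef : even_fun f.
Hypothesis sh : smooth_on [set: R] h.
Hypothesis eh : even_fun h.
Hypothesis fh : forall t, f t = 1 - t ^+ 2 * h t.
Local Notation TH := (Th f h).
Variables (A1 B1 x : R -> R).
Hypothesis xE : forall t, 0 < t -> A1 t * x t = f t.
Local Notation th := (ansatz T A1 B1 x (fun=> 0)).

Lemma theta_curvature r (z : E0) (w : 'I_2 -> E0) : Reg r z ->
  (forall i, tangent (Reg r) z (w i)) ->
  let w0 := w ord0 in let w1 := w (lift ord0 ord0) in
  curvature th z w = theta_curv f z.1.1 w0.1.1 w1.1.1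
    (qmul (qconj z.1.2) w0.1.2) (qmul (qconj z.1.2) w1.1.2)
    (qmul (qconj z.2) w0.2) (qmul (qconj z.2) w1.2).
Proof.
move=> Rz tw w0 w1; have [t0 _ u1 u2] := Rz.
have df : is_derive z.1.1 1 (fun t => A1 t * x t : R) (derive1 f z.1.1).
  apply: (@near_eq_is_derive R R^o R^o f).
    by apply: near_eq_pos => // s s0; rewrite xE.
  exact: smooth1_is_derive.
have dg : is_derive z.1.1 1 (fun t => B1 t * 0 : R) 0.
  by under eq_fun do rewrite mulr0; exact: is_derive_cst.
rewrite (ansatz_curvature hT Rz tw df dg) xE // mulr0.
have [iX0 iY0] := tangent_Reg_qim (tw ord0).
have [iX1 iY1] := tangent_Reg_qim (tw (lift ord0 ord0)).
rewrite -/w0 in iX0 iY0; rewrite -/w1 in iX1 iY1.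
set Z := theta_curv _ _ _ _ _ _ _ _.
have iZ : qim Z.
  have iD (a b : H) : qim a -> qim b -> qim (a + b) by rewrite /qim qcD => -> ->; rewrite addr0.
  have iN (a : H) : qim a -> qim (- a) by rewrite /qim qcN => ->; rewrite oppr0.
  have iC c (a : H) : qim a -> qim (c *: a) by rewrite /qim qcZ => ->; rewrite mulr0.
  have iB (a b : H) : qim (qbracket a b) by exact: qbracket_im.
  exact: (iD _ _ (iD _ _ (iC _ _ (iD _ _ (iC _ _ (iD _ _ iX1 iY1))
    (iN _ (iC _ _ (iD _ _ iX0 iY0))))) (iN _ (iC _ _ (iD _ _ (iB _ _) (iB _ _)))))
    (iC _ _ (iB _ _))).
rewrite -[RHS](coordK hT iZ); apply: eq_bigr => k _; congr (_ *: _).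
have cD a b : coord T k (a + b) = coord T k a + coord T k b :> R by rewrite linearD.
have cN a : coord T k (- a) = - coord T k a :> R by rewrite linearN.
have cZ c a : coord T k (c *: a) = c * coord T k a :> R by rewrite linearZ.
have jD a b i : coord T i (a + b) = coord T i a + coord T i b :> R by rewrite linearD.
rewrite /Z /theta_curv {Z iZ}.
set X0 := qmul (qconj z.1.2) w0.1.2 in iX0 *; set X1 := qmul (qconj z.1.2) w1.1.2 in iX1 *.
set Y0 := qmul (qconj z.2) w0.2 in iY0 *; set Y1 := qmul (qconj z.2) w1.2 in iY1 *.
have iXY0 : qim (X0 + Y0) by rewrite /qim qcD iX0 iY0 addr0.
have iXY1 : qim (X1 + Y1) by rewrite /qim qcD iX1 iY1 addr0.
have := coord_qbracket hT k iX0 iX1; have := coord_qbracket hT k iY0 iY1.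
have := coord_qbracket hT k iXY0 iXY1.
move: (qbracket X0 X1) (qbracket Y0 Y1) (qbracket (X0 + Y0) (X1 + Y1)) => b1 b2 b3 h3 h2 h1.
rewrite !(cD, cN, cZ) h1 h2 h3 !jD.
rewrite /curv_ev !ev_cons ev_nil !mono2 !cov_ip !cov_im.
rewrite (_ : cov T z 0 (w ord0) = w0.1.1) // (_ : cov T z 0 (w (lift ord0 ord0)) = w1.1.1) //=.
rewrite /Defs.eta -/w0 -/w1 -/X0 -/X1 -/Y0 -/Y1.
move: (coord T k X0) (coord T k X1) (coord T k Y0) (coord T k Y1) => c1 c2 c3 c4.
move: (coord T (ordS k) X0) (coord T (ordS k) X1) (coord T (ordS k) Y0)
  (coord T (ordS k) Y1) => d1 d2 d3 d4.
move: (coord T (ordS (ordS k)) X0) (coord T (ordS (ordS k)) X1)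
  (coord T (ordS (ordS k)) Y0) (coord T (ordS (ordS k)) Y1) => e1 e2 e3 e4.
move: (f z.1.1) (derive1 f z.1.1) w0.1.1 w1.1.1 => F F' a b.
by field.
Qed.

Lemma qAd_sum (I : Type) (s : seq I) (F : I -> H) a :
  qAd a (\sum_(i <- s) F i) = \sum_(i <- s) qAd a (F i).
Proof.
elim/big_ind2: _ => [|u u' v v' <- <-|//]; last by rewrite qAdD.
by rewrite /qAd qmulq0 qmul0q.
Qed.

(** [wedge] evaluates its factors only on subfamilies of the six vectors, selected by [s]; agreement
    of the factors on these is enough, and conjugation by [a] passes through the linear
    combinations. *)
Lemma curv_wedge_transport (E E' : normedModType R) (th1 : kform 1 E H)
    (th2 : kform 1 E' H) (b : kform 4 E R) (b' : kform 4 E' R) (y : E) (z : E')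
    (v : 'I_6 -> E) (w : 'I_6 -> E') (a : H) :
  (forall s : 'I_2 -> 'I_6, curvature th1 y (fun i => v (s i)) =
     qAd a (curvature th2 z (fun i => w (s i)))) ->
  (forall s : 'I_4 -> 'I_6, b y (fun i => v (s i)) = b' z (fun i => w (s i))) ->
  curv_wedge th1 b y v = qAd a (curv_wedge th2 b' z w).
Proof.
move=> hc hb; rewrite /curv_wedge /wedge qAdZ qAd_sum; congr (_ *: _).
by apply: eq_bigr => s _; rewrite hc hb !qAdZ.
Qed.

Lemma der_pid_proj (y v : HHH) : 'D_v (@pid_proj R) y = v.1.
Proof. by case: (is_der_fst (is_derive_id y v)). Qed.

Lemma qmul_conjK (a b d : H) : qunit a -> qunit b ->
  qmul (qmul a (qmul (qmul (qconj a) d) b)) (qconj b) = d.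
Proof.
by move=> ua ub; rewrite !qmulA qmulqV // qmul1q -qmulA qmulqV // qmulq1.
Qed.

(* Off the singular orbit every point of [Pid] and every tangent vector there are
   images of frame data on [Reg], up to the right action. *)
Lemma frame_exists r (y : HHH) : Pid r y -> y.1.1 != 0 ->
  let t := qnorm y.1.1 in
  exists a1 a2, [/\ Reg r (t, a1, a2), y.1 = (t *: a1, qmul a1 (qconj a2)) &
  forall v : HHH, qim (qmul (qconj y.1.2) v.1.2) -> exists u X Y,
    [/\ qim X, qim Y & v.1 = frame t a1 a2 u X Y]].
Proof.
case: y => [[p q] k] [[/= pr uq] uk] p0; set t := qnorm p.
have t0 : 0 < t by exact: qnorm_gt0.
have tn0 : t != 0 by rewrite gt_eqF.
(* These invert [(p, q) = (t a1, a1 a2^-1)] with [t = |p|]. *)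
pose a1 := t^-1 *: p; pose a2 := qmul (qconj q) a1.
have u1 : qunit a1.
  by rewrite /qunit qnormZ ger0_norm ?invr_ge0 ?ltW // mulVf.
have u2 : qunit a2 by apply: qunitM => //; exact: qunitV.
have pE : p = t *: a1 by rewrite scalerA divff // scale1r.
have qE : q = qmul a1 (qconj a2).
  by rewrite /a2 qconjM qconjK qmulA qmulqV // qmul1q.
exists a1, a2; split; first by split.
  by rewrite -qE -pE.
move=> v /= iq.
(* The equation [v.1 = frame] is solved componentwise: [a1^-1 dp = u + t X] gives [u] and [X] as
   real and imaginary parts, and [a1^-1 dq a2 = X - Y] gives [Y]. *)
pose Z := qmul (qconj a1) v.1.1.
pose X := t^-1 *: qIm Z.
pose Y := X - qmul (qmul (qconj a1) v.1.2) a2.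
have iX : qim X by rewrite /qim qcZ qIm_im mulr0.
have iY : qim Y.
  have i' : qim (qmul (qmul (qconj a1) v.1.2) a2).
    have -> : qmul (qmul (qconj a1) v.1.2) a2 = qAd (qconj a1) (qmul v.1.2 (qconj q)).
      by rewrite qAd_conjE /a2 !qmulA.
    exact: qAd_im (qim_conjM_im uq iq).
  by rewrite /Y /qim qcD qcN iX i' subrr.
exists (qc Z 0), X, Y; split=> //; rewrite /frame.
have -> : X - Y = qmul (qmul (qconj a1) v.1.2) a2 by rewrite /Y opprB addrC subrK.
have -> : qmul (qmul a1 (qmul (qmul (qconj a1) v.1.2) a2)) (qconj a2) = v.1.2.
  exact: qmul_conjK.
have -> : qc Z 0 *: a1 + t *: qmul a1 X = v.1.1.
  rewrite /X qmulZr scalerA divff // scale1r.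
  have -> : v.1.1 = qmul a1 Z by exact: conjMK.
  rewrite -{1}[a1]qmulq1 -qmulZr -qmulDr; congr (qmul a1 _).
  by apply: qP => -[|[|[|[|//]]]] _; rewrite /qIm /q1 !qcE !qc_mkq //=; ring.
by case: v.1.
Qed.

(** Tangency enters only through conditions on the [q] and [k] components, which are independent of
    [p]; the statement can thus be applied to fixed vectors along a curve that tends to the singular
    orbit. *)
Lemma instanton_Pid_regular r (Psi : kform 4 (H * H)%type R) (y : HHH) (v : 'I_6 -> HHH) :
  instanton_reg T A1 B1 r th -> psi_ext T A1 B1 r Psi ->
  Pid r y -> y.1.1 != 0 -> (forall i, qim (qmul (qconj y.1.2) (v i).1.2)) ->
  (forall i, qim (qmul (qconj y.2) (v i).2)) ->
  curv_wedge TH (pullback (@pid_proj R) Psi) y v = 0.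
Proof.
move=> inst [_ hPsi] Py p0 iv ik.
have [a1 [a2 [Rz yE fr]]] := frame_exists Py p0.
set t := qnorm y.1.1 in Rz yE fr; have [t0 tr u1 u2] := Rz; rewrite /= in t0 tr u1 u2.
have /choice [uXY HuXY] : forall i, exists p : R * H * H, [/\ qim p.1.2, qim p.2
    & (v i).1 = frame t a1 a2 p.1.1 p.1.2 p.2].
  by move=> i; have [u [X [Y ?]]] := fr _ (iv i); exists (u, X, Y).
pose w i : E0 := ((uXY i).1.1, qmul a1 (uXY i).1.2, qmul a2 (uXY i).2).
have C a (b : H) : qunit a -> qmul (qconj a) (qmul a b) = b.
  by move=> ua; rewrite qmulA qmulVq // qmul1q.
have tw i : tangent (Reg r) (t, a1, a2) (w i).
  by have [iX iY _] := HuXY i; apply: tangent_RegI => //=; rewrite C.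
have -> : 0 = qAd (qmul (qconj y.2) a1) (curv_wedge th (psi T A1 B1) (t, a1, a2) w).
  by rewrite inst // /qAd qmulq0 qmul0q.
have uk : qunit y.2 by case: Py.
have yE' : y = (t *: a1, qmul a1 (qconj a2), y.2) by rewrite -yE; case: (y).
apply: curv_wedge_transport => s.
- rewrite {1}yE' (@Th_curvature_frame R f h sf ef sh eh fh t a1 a2 y.2
    (uXY (s ord0)).1.1 (uXY (s (lift ord0 ord0))).1.1 (uXY (s ord0)).1.2
    (uXY (s (lift ord0 ord0))).1.2 (uXY (s ord0)).2 (uXY (s (lift ord0 ord0))).2) //;
    try by case: (HuXY (s ord0)).
  + rewrite (theta_curvature Rz) //= !C // qAdM; congr (qAd _ (qAd _ _)).
  + by case: (HuXY (s (lift ord0 ord0))).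
  + by case: (HuXY (s (lift ord0 ord0))).
  + by case: (HuXY (s (lift ord0 ord0))).
- have <- := hPsi _ _ Rz (fun i => tw (s i)); rewrite /pullback.
  have -> : (fun i => 'D_(v (s i)) (@pid_proj R) y) =
      (fun i => 'D_(w (s i)) (@reg_to_M R) (t, a1, a2)).
    apply/funext => i; rewrite der_pid_proj; have [iX iY ->] := HuXY (s i).
    by rewrite -(der_reg_to_M_frame t a1 a2 _ _ iY).
  by have -> : pid_proj y = reg_to_M (t, a1, a2) by exact: yE.
Qed.

End InstantonExtension.

(** * Passage to the singular orbit *)

Section InstantonPid.
Variables (R : realType) (T : 3.-tuple 'rV[R]_4).
Hypothesis hT : standard_basis T.
Local Notation H := 'rV[R]_4.
Local Notation HHH := (H * H * H)%type.
Variables (f h : R -> R).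
Hypothesis sf : smooth_on [set: R] f.
Hypothesis ef : even_fun f.
Hypothesis sh : smooth_on [set: R] h.
Hypothesis eh : even_fun h.
Hypothesis fh : forall t, f t = 1 - t ^+ 2 * h t.
Local Notation TH := (Th f h).
Variables (A1 B1 x : R -> R).
Hypothesis xE : forall t, 0 < t -> A1 t * x t = f t.
Local Notation th := (ansatz T A1 B1 x (fun=> 0)).

Lemma smooth_curvature_Th (v : 'I_2 -> HHH) : smooth_on setT (fun z => curvature TH z v).
Proof.
have oT := @openT HHH; have sT w := smooth_Th sf ef sh eh w.
under eq_fun do rewrite curvatureE.
apply: (smooth_onD oT).
  by apply: (smooth_on_qsub oT); apply: smooth_on_derive; exact: sT.
apply: (smooth_on_qsub oT); apply: (smooth_on_qmul oT); exact: sT.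
Qed.

Lemma smooth_curv_wedge_Th (O : set (H * H)) (Psi : kform 4 (H * H)%type R) (v : 'I_6 -> HHH) :
  open O -> (forall u, smooth_on O (fun z => Psi z u)) ->
  smooth_on ((@pid_proj R) @^-1` O)
    (fun z => curv_wedge TH (pullback (@pid_proj R) Psi) z v).
Proof.
move=> oO sP.
have lp : linear (@pid_proj R) by [].
have cp : continuous (@pid_proj R) by move=> z; exact: cvg_fst.
have oO' : open ((@pid_proj R) @^-1` O) by apply: open_comp => // z _; exact: cp.
rewrite /curv_wedge /wedge.
apply: (smooth_on_scale oO'); first exact: smooth_on_cst.
apply: (smooth_on_sum _ oO') => s.
apply: (smooth_on_scale oO'); first exact: smooth_on_cst.
apply: (smooth_on_scale oO').
  rewrite /pullback.
  have -> : (fun z : HHH => Psi (pid_proj z) (fun i => 'D_(v (s (rshift 2 i))) (@pid_proj R) z)) =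
      (fun z => Psi (pid_proj z) (fun i => (v (s (rshift 2 i))).1)).
    by apply/funext => z; congr (Psi _ _); apply/funext => i; rewrite der_pid_proj.
  exact: (smooth_on_comp_lin_sub oO' lp cp (fun _ => id) (sP _)).
exact: smooth_on_sub (smooth_curvature_Th _).
Qed.

Lemma continuous_curve_eq0 (V W : normedModType R) (G : V -> W) (c : R -> V) :
  {for c 0, continuous G} -> {for (0 : R), continuous c} ->
  (\forall s \near (0 : R)^'+, G (c s) = 0) -> G (c 0) = 0.
Proof.
move=> cG cc E.
have cGc : {for (0 : R), continuous (fun s => G (c s))} by exact: continuous_comp.
have H1 : G (c s) @[s --> (0 : R)^'+] --> G (c 0) by exact: cvg_at_right_filter.
have H2 : G (c s) @[s --> (0 : R)^'+] --> (0 : W).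
  have E' : \forall s \near (0 : R)^'+, (fun=> 0 : W) s = G (c s).
    by apply: filterS E => s.
  by apply: (cvg_trans (near_eq_cvg E')); exact: cvg_cst.
exact: cvg_unique H1 H2.
Qed.

Lemma instanton_Pid_Th r : instanton_reg T A1 B1 r th -> instanton_Pid T A1 B1 r TH.
Proof.
move=> inst Psi hPsi y v Py tv.
have iv i := (tangent_Pid_qim (tv i)).1; have ik i := (tangent_Pid_qim (tv i)).2.
case: (eqVneq y.1.1 0) => [p0|p0]; last first.
  by apply: (instanton_Pid_regular hT sf ef sh eh fh xE inst hPsi Py p0).
case: (hPsi) => [[U [oO MO _ sP]] _].
have cp : continuous (@pid_proj R) by move=> z; exact: cvg_fst.
have oO' : open ((@pid_proj R) @^-1` U) by apply: open_comp => // z _; exact: cp.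
have Oy : U (pid_proj y) by apply: MO; case: Py.
case: y Py p0 iv ik tv Oy => [[p q] k] [[/= pr uq] uk] p0 iv ik tv Oy.
rewrite /= in p0; subst p; rewrite qnorm0 in pr.
(* Only [p] moves along [c], so [iv] and [ik] hold at each of its points, and the points with small
   [s > 0] lie off the singular orbit. *)
pose c (s : R) : HHH := (s *: q1 R, q, k).
have c0 : c 0 = (0, q, k) by rewrite /c scale0r.
rewrite -c0; apply: (@continuous_curve_eq0 HHH H
  (fun z => curv_wedge TH (pullback (@pid_proj R) Psi) z v) c).
- rewrite c0; apply: differentiable_continuous.
  exact: (@smooth_on_differentiable R HHH H _ _ (0, q, k) (smooth_curv_wedge_Th v oO sP) Oy).
- apply: differentiable_continuous; apply/derivable1_diffP.
  by case: (is_der_pair (is_der_pair (is_der_scale (is_derive_id (0 : R) 1)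
    (is_der_cst (q1 R) (0 : R) 1)) (is_der_cst q (0 : R) 1)) (is_der_cst k (0 : R) 1)).
have n2 : \forall s \near (0 : R)^'+, (s%:E < r)%E.
  by rewrite near_withinE; apply: filterS (near_lt_ereal pr) => s hs _; exact: hs.
near=> s.
have s0 : 0 < s by near: s; exact: nbhs_right_gt.
have sr : (s%:E < r)%E by near: s.
have nq : qnorm (s *: q1 R) = s.
  by rewrite qnormZ (qnorm_unit (qunit1 R)) mulr1 gtr0_norm.
have Pc : Pid r (c s) by split=> //; split=> //=; rewrite nq.
have cn0 : (c s).1.1 != 0.
  by apply/eqP => /= e; move: s0; rewrite -nq e qnorm0 ltxx.
exact: (instanton_Pid_regular hT sf ef sh eh fh xE inst hPsi Pc cn0 iv ik).
Unshelve. all: by end_near. Qed.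

End InstantonPid.

(** * The explicit solution is an instanton on the whole bundle *)

Section Existence.
Variables (R : realType) (T : 3.-tuple 'rV[R]_4).
Hypothesis hT : standard_basis T.
Variables (A1 B1 : R -> R) (b0 : R).
Hypothesis hG : G2_data A1 B1 b0.

Definition theta_x (t : R) : R := expR (oint (Ffun A1 B1) 2%:R^-1 t)
  / oint (fun s => expR (oint (Ffun A1 B1) 2%:R^-1 s)) 0 t.

Lemma theta0_ansatz : theta0 T A1 B1 = ansatz T A1 B1 theta_x (fun=> 0).
Proof.
apply/funext => z; apply/funext => v.
by rewrite /theta0 /ansatz mulr0 scale0r addr0 /theta_x mulrA.
Qed.

Lemma G2_pos t : 0 < t -> 0 < A1 t /\ 0 < B1 t.
Proof.
move=> t0; have [[_ A0 _ _] [_ B0 _ _]] := hG.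
by split; [exact: A0|apply: B0; exact: ltW].
Qed.

Lemma theta_inv_instanton r : inv_instanton_Pid T A1 B1 r (theta0 T A1 B1).
Proof.
have [f [h [[sf ef sh eh fh] [fE df]]]] := profile hG.
have xE t : 0 < t -> A1 t * theta_x t = f t by move=> t0; rewrite -fE // mulrA.
have inst : instanton_reg T A1 B1 r (ansatz T A1 B1 theta_x (fun=> 0)).
  apply: (instanton_of_ode hT) => t t0 _.
  exists ((f t - f t ^+ 2) / A1 t - A1 t * f t / B1 t ^+ 2), 0; split.
  - apply: (@near_eq_is_derive R R^o R^o f _ t 1); last exact: df.
    by apply: near_eq_pos => // s s0; rewrite xE.
  - by under eq_fun do rewrite mulr0; exact: is_derive_cst.
  - have [A0 B0] := G2_pos t0; rewrite /ode_p mulr0 xE //.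
    have An0 : A1 t != 0 by rewrite gt_eqF.
    have Bn0 : B1 t != 0 by rewrite gt_eqF.
    by field; rewrite An0 Bn0.
  - by rewrite /ode_m !mulr0 subrr !mulr0 !mul0r subrr mulr0.
rewrite theta0_ansatz; split => //; exists (Th f h); split.
- exact: Th_connection.
- apply: pid_sec_Th => // t u a1 a2 X Y t0 u1 u2 iX iY.
  have iXY : qim (X + Y) by rewrite /qim qcD iX iY addr0.
  rewrite ansatzE /= -(coordK hT iXY) scaler_sumr; apply: eq_bigr => i _.
  rewrite /Defs.eta /= !qmulA !qmulVq // !qmul1q xE // mulr0 mul0r addr0.
  by rewrite scalerA; congr (_ *: _); rewrite linearD /= mulrA mulrAC.
- exact: Th_invariant.
- exact: (instanton_Pid_Th hT sf ef sh eh fh xE inst).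
Qed.

End Existence.

(** * Uniqueness *)

Section Uniqueness.
Variable R : realType.

(* Gronwall: [u ^ 2 e^(-2 C t)] is nonincreasing when [k <= C]. *)
Lemma linear_ode_zero (u k K : R -> R) (r : \bar R) :
  (forall t : R, 0 < t -> (t%:E < r)%E -> is_derive t 1 u (k t * u t)) ->
  (forall t : R, 0 < t -> (t%:E < r)%E -> k t <= K t) ->
  (forall t : R, 0 <= t -> (t%:E < r)%E -> {for t, continuous K}) ->
  u t @[t --> (0 : R)^'+] --> (0 : R) ->
  forall t : R, 0 < t -> (t%:E < r)%E -> u t = 0.
Proof.
move=> du kK cK u0 s s0 sr.
have ltr (t : R) : t <= s -> (t%:E < r)%E.
  by move=> ts; apply: le_lt_trans sr; rewrite lee_fin.
(* The majorant [K] is continuous up to 0, which gives a uniform upper bound even where [k] tends to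
   minus infinity. *)
have [c _ HC] : exists2 c, c \in `[0, s]%R & forall t, t \in `[0, s]%R -> K t <= K c.
  apply: EVT_max; first exact: ltW.
  apply: continuous_in_subspaceT => t /set_mem; rewrite /= in_itv /= => /andP[t0 ts].
  by apply: cK => //; exact: ltr.
set C := K c in HC.
pose v (t : R) : R := u t * u t * expR (- 2%:R * C * t).
have dv (t : R) : 0 < t -> t <= s -> is_derive t 1 v
    (2%:R * (k t - C) * u t ^+ 2 * expR (- 2%:R * C * t)).
  move=> t0 ts.
  have dl : is_derive t 1 (fun t : R => - 2%:R * C * t) (- 2%:R * C).
    by apply: (is_derive_eq (is_der_mulc (- 2%:R * C) (is_derive_id t 1))); rewrite mulr1.
  apply: (is_derive_eq (is_der_mul (is_der_mul (du t t0 (ltr _ ts)) (du t t0 (ltr _ ts)))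
    (is_derive_comp1 (is_derive_expR _) dl))).
  by move: (expR _) (u t) (k t) => e w kk; ring.
have mono t : 0 < t -> t < s -> v s <= v t.
  move=> t0 ts.
  have [||c' + e] := @MVT R v (fun t => 2%:R * (k t - C) * u t ^+ 2 * expR (- 2%:R * C * t)) t s ts.
  - move=> y; rewrite in_itv /= => /andP[ty ys].
    by apply: dv; [exact: lt_trans ty|exact: ltW].
  - apply: continuous_in_subspaceT => y /set_mem; rewrite /= in_itv /= => /andP[ty ys].
    apply: differentiable_continuous; apply/derivable1_diffP.
    by case: (dv y (lt_le_trans t0 ty) ys).
  rewrite in_itv /= => /andP[tc cs].
  rewrite -subr_le0 e; apply: mulr_le0_ge0; last by rewrite subr_ge0 ltW.
  apply: mulr_le0_ge0; last exact: expR_ge0.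
  apply: mulr_le0_ge0; last exact: sqr_ge0.
  apply: mulr_ge0_le0 => //; rewrite subr_le0.
  have c0 : 0 < c' by exact: lt_trans tc.
  apply: (le_trans (kK _ c0 (ltr _ (ltW cs)))).
  by apply: HC; rewrite in_itv /= !ltW.
have v0 : v t @[t --> (0 : R)^'+] --> (0 : R).
  rewrite [X in _ --> X](_ : _ = 0 * 0 * expR (- 2%:R * C * 0)); last by rewrite !mul0r.
  apply: cvgM; first exact: cvgM.
  apply: cvg_at_right_filter.
  apply: (@continuous_comp _ _ _ (fun t : R => - 2%:R * C * t) expR).
    by apply: cvgM; [exact: cvg_cst|exact: cvg_id].
  exact: continuous_expR.
have vs : v s <= 0.
  apply: (cvgr_to_ge v0); near=> t; apply: mono; near: t.
    exact: nbhs_right_gt.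
  exact: nbhs_right_lt.
move: vs; rewrite /v pmulr_lle0 ?expR_gt0 // => us.
by apply/eqP; rewrite -sqrf_eq0 eq_le sqr_ge0 andbT expr2.
Unshelve. all: by end_near. Qed.

End Uniqueness.

(** * Members of the family with parameter zero *)

Section Family.
Variables (R : realType) (T : 3.-tuple 'rV[R]_4).
Hypothesis hT : standard_basis T.
Local Notation H := 'rV[R]_4.
Local Notation E0 := (R * H * H)%type.
Local Notation HHH := (H * H * H)%type.
Variables (A1 B1 : R -> R) (b0 : R).
Hypothesis hG : G2_data A1 B1 b0.

Definition base_pt (t : R) : HHH := (t *: q1 R, q1 R, q1 R).

Lemma base_pt_Pid (r : \bar R) t : 0 <= t -> (t%:E < r)%E -> Pid r (base_pt t).
Proof.
move=> t0 tr; have u1 := qunit1 R; split=> //; split=> //=.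
by rewrite qnormZ (qnorm_unit u1) mulr1 ger0_norm.
Qed.

Lemma differentiable_base_pt t : differentiable base_pt t.
Proof.
apply/derivable1_diffP.
by case: (is_der_pair (is_der_pair (is_der_scale (is_derive_id t 1)
    (is_der_cst (q1 R) t 1)) (is_der_cst (q1 R) t 1)) (is_der_cst (q1 R) t 1)).
Qed.

(* Evaluated at [base_pt t], an invariant connection form whose restriction is
   the ansatz gives its two coefficients as [1 + t mu] and [1 + t mu + 2 nu]
   with [mu] and [nu] differentiable up to [t = 0]. *)
Lemma ansatz_coefficients (r : \bar R) (Th : kform 1 HHH H) (x y : R -> R) :
  connection r Th ->
  form_eq (Reg r) (pullback (@pid_sec R) Th) (ansatz T A1 B1 x y) ->
  exists mu nu : R -> R,
  [/\ forall t, 0 <= t -> (t%:E < r)%E -> derivable mu t 1,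
      forall t, 0 <= t -> (t%:E < r)%E -> derivable nu t 1,
      forall t, 0 < t -> (t%:E < r)%E -> A1 t * x t = 1 + t * mu t
    & forall t, 0 < t -> (t%:E < r)%E -> B1 t * y t = 1 + t * mu t + 2%:R * nu t].
Proof.
move=> [[U [oU PU mU sU]] _ fund _] pull.
have [fT iT _] := hT; pose X := tnth T ord0; have iX : qim X by exact: iT.
have u1 := qunit1 R.
have c1 : qconj (q1 R) = q1 R.
  by apply: qP => -[|[|[|[|//]]]] _; rewrite /qconj /q1 !qc_mkq //= oppr0.
have lin p c (u w : HHH) : U p -> Th p (fun=> c *: u + w) = c *: Th p (fun=> u) + Th p (fun=> w).
  move=> /mU [ml _]; have := ml (fun=> 0) ord0 c u w; by rewrite !dfwith_ord1.
(* At [a1 = a2 = 1] the section maps [(0, X, X)] to [t vp + vk] and [(0, X, -X)] to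
   [t vp + 2 vq + vk]. The vector [vk] is vertical, where the connection form takes the value [X];
   this is the origin of the 1 in both coefficients. *)
pose vp : HHH := (X, 0, 0); pose vq : HHH := (0, X, 0); pose vk : HHH := (0, 0, X).
pose ev v (t : R) : R := coord T ord0 (Th (base_pt t) (fun=> v)).
have dev v t : 0 <= t -> (t%:E < r)%E -> derivable (ev v) t 1.
  move=> t0 tr; apply/derivable1_diffP.
  have UP : U (base_pt t) by apply: PU; exact: base_pt_Pid.
  have dT : differentiable (fun p => Th p (fun=> v)) (base_pt t).
    exact: (smooth_on_differentiable (sU _) UP).
  have dTp : differentiable (fun s => Th (base_pt s) (fun=> v)) t.
    by apply: (@differentiable_comp _ _ _ _ base_pt (fun p => Th p (fun=> v))) => //;
      exact: differentiable_base_pt.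
  have lc : linear (fun Z : H => coord T ord0 Z : R^o) by move=> c u w; rewrite linearP.
  have cc : continuous (fun Z : H => coord T ord0 Z : R^o).
    exact: (@linear_quat_continuous R R^o (linear_of lc)).
  apply: (@differentiable_comp _ _ _ _ (fun s => Th (base_pt s) (fun=> v))
    (fun Z : H => coord T ord0 Z : R^o)) => //.
  exact: differentiable_linear.
have fk t : 0 < t -> (t%:E < r)%E -> Th (base_pt t) (fun=> vk) = X.
  move=> t0 tr; rewrite -[RHS](fund (base_pt t) X) //; last exact: base_pt_Pid (ltW t0) tr.
  by rewrite /pid_fund /= qmul1q.
have pv t (s : bool) : 0 < t -> (t%:E < r)%E ->
    Th (base_pt t) (fun=> ((t *: X, X - (if s then X else - X), X) : HHH)) =
    ansatz T A1 B1 x y (t, q1 R, q1 R) (fun=> (0, X, if s then X else - X)).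
  move=> t0 tr; set Y := if s then X else - X.
  have iY : qim Y by rewrite /Y; case: (s) => //; rewrite /qim qcN iX oppr0.
  have tw : tangent (Reg r) (t, q1 R, q1 R) ((0, X, Y) : E0).
    by apply: tangent_RegI => //=; rewrite c1 qmul1q.
  rewrite -(pull (t, q1 R, q1 R) (fun=> (0, X, Y))) // /pullback.
  have -> : pid_sec (t, q1 R, q1 R) = base_pt t.
    by rewrite /pid_sec /reg_to_M /pid_fiber /= c1 !qmul1q.
  congr (Th _ _); apply/funext => i.
  rewrite der_pid_sec der_reg_to_M /= c1 scale0r add0r qmulq1 qmul1q.
  by rewrite (qconj_im iY).
have ans t (s : bool) : coord T ord0
    (ansatz T A1 B1 x y (t, q1 R, q1 R) (fun=> (0, X, if s then X else - X))) =
    if s then A1 t * x t else B1 t * y t.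
  rewrite ansatzE (coord_sum hT) /=.
  have D s' := eta_dual s' s ord0 ord0 t 0 fT u1 u1.
  rewrite !qmul1q in D; rewrite !D andbT.
  by case: s {D} => /=; rewrite ?andbT ?mulr1 ?mulr0 ?addr0 ?add0r.
have cD a b : coord T ord0 (a + b) = coord T ord0 a + coord T ord0 b :> R by rewrite linearD.
have cZ c a : coord T ord0 (c *: a) = c * coord T ord0 a :> R by rewrite linearZ.
have cX : coord T ord0 X = 1 :> R by rewrite (coord_tnth hT) eqxx.
exists (ev vp), (ev vq); split; [exact: dev|exact: dev|move=> t t0 tr..].
- have UP : U (base_pt t) by apply: PU; exact: base_pt_Pid (ltW t0) tr.
  have := ans t true; rewrite /= => <-; have := pv t true t0 tr; rewrite /= => <-.
  have -> : ((t *: X, X - X, X) : HHH) = t *: vp + vk.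
    transitivity ((t *: X + 0, t *: (0 : H) + 0, t *: (0 : H) + X) : HHH); last by [].
    by rewrite !scaler0 !addr0 add0r subrr.
  by rewrite lin // fk // cD cZ cX addrC.
- have UP : U (base_pt t) by apply: PU; exact: base_pt_Pid (ltW t0) tr.
  have := ans t false; rewrite /= => <-; have := pv t false t0 tr; rewrite /= => <-.
  have -> : ((t *: X, X - - X, X) : HHH) = t *: vp + (2%:R *: vq + vk).
    transitivity ((t *: X + (2%:R *: (0 : H) + 0), t *: (0 : H) + (2%:R *: X + 0),
      t *: (0 : H) + (2%:R *: (0 : H) + X)) : HHH); last by [].
    by rewrite !scaler0 !addr0 !add0r opprK scaler_nat mulr2n.
  by rewrite !lin // fk // !cD !cZ cX /ev; ring.
Qed.

Lemma continuous_of_derivable (g : R -> R) t : derivable g t 1 -> {for t, continuous g}.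
Proof. by move=> /derivable1_diffP; exact: differentiable_continuous. Qed.

Lemma family_unique (r : \bar R) (x y : R -> R) : (0 < r)%E ->
  Pid_family T A1 B1 r 0 x y ->
  form_eq (Reg r) (ansatz T A1 B1 x y) (theta0 T A1 B1).
Proof.
move=> r0 [[inst [Th [conn pull _ _]]] ylim].
have [mu [nu [dmu dnu FE GE]]] := ansatz_coefficients conn pull.
have [aa [sa ea a0 apos AE]] := G2_data_A hG.
have [B [sB eB Bpos BE]] := G2_data_B hG.
have [f [h [[sf ef sh eh fh] [fE df]]]] := profile hG.
have nearR (P Q : R -> R) t : (forall s, 0 < s -> (s%:E < r)%E -> P s = Q s) ->
    0 < t -> (t%:E < r)%E -> \forall s \near t, P s = Q s.
  move=> PQ t0 tr; apply: filterS2 (near_gt t0) (near_lt_ereal tr) => s; exact: PQ.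
have nearR0 (P Q : R -> R) : (forall s, 0 < s -> (s%:E < r)%E -> P s = Q s) ->
    \forall s \near (0 : R)^'+, P s = Q s.
  move=> PQ; rewrite near_withinE; apply: filterS (near_lt_ereal r0) => s sr s0.
  exact: PQ.
have dF t : 0 < t -> (t%:E < r)%E -> exists F' : R, is_derive t 1 (fun t => A1 t * x t : R) F'.
  move=> t0 tr.
  have d := is_der_add (is_der_cst (1 : R^o) t 1)
    (is_der_mul (is_derive_id t 1) (DeriveDef (dmu t (ltW t0) tr) erefl)).
  exists (0 + (1 * mu t + t * 'D_1 mu t)).
  by apply: (near_eq_is_derive _ d); apply: nearR => // s s0 sr; rewrite FE.
have dG t : 0 < t -> (t%:E < r)%E -> exists G' : R, is_derive t 1 (fun t => B1 t * y t : R) G'.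
  move=> t0 tr.
  have d := is_der_add (is_der_add (is_der_cst (1 : R^o) t 1)
    (is_der_mul (is_derive_id t 1) (DeriveDef (dmu t (ltW t0) tr) erefl)))
    (is_der_mulc 2%:R (DeriveDef (dnu t (ltW t0) tr) erefl)).
  eexists; apply: (near_eq_is_derive _ d).
  by apply: nearR => // s s0 sr; rewrite GE.
have an0 t : aa t != 0 by rewrite gt_eqF.
have Bn0 t : B t != 0 by rewrite gt_eqF.
have ca : continuous aa := smooth1_continuous sa.
have cB : continuous B := smooth1_continuous sB.
have G0 t : 0 < t -> (t%:E < r)%E -> B1 t * y t = 0.
  (* With [A1 x = 1 + t mu] and [A1 = t a], the coefficient [2 (f - 1) / A1] becomes [2 mu / a],
     continuous up to 0. *)
  move: t; pose k t := 2%:R * mu t / aa t.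
  apply: (@linear_ode_zero R (fun t => B1 t * y t) k k r).
  - move=> t t0 tr; have [F' dF'] := dF t t0 tr; have [G' dG'] := dG t t0 tr.
    have [_] := ode_of_instanton hT t0 tr inst dF' dG'.
    rewrite /ode_m FE // AE ?BE ?ltW // => /eqP.
    rewrite mulf_eq0 pnatr_eq0 /= subr_eq0 => /eqP e.
    suff -> : k t * (B t * y t) = G' by move: dG'.
    have tn0 : t != 0 by rewrite gt_eqF.
    have nz : (t * aa t) ^+ 2 * B t ^+ 2 != 0 by rewrite mulf_neq0 // expf_neq0 // mulf_neq0.
    apply: (mulfI nz); rewrite e /k; move: (B t * y t) (an0 t) (Bn0 t) => g an Bn.
    by field.
  - by [].
  - move=> t t0 tr; apply: cvgM; last by apply: cvgV => //; exact: ca.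
    by apply: cvgM; [exact: cvg_cst|exact: continuous_of_derivable (dmu _ t0 tr)].
  - rewrite [X in _ --> X](_ : _ = B 0 * 0); last by rewrite mulr0.
    apply: cvgM => //.
    have cB0 : B s @[s --> (0 : R)^'+] --> B 0 by apply: cvg_at_right_filter; exact: cB.
    apply: cvg_trans cB0; apply: near_eq_cvg; apply: nearR0 => s s0 _.
    by rewrite BE // ltW.
have F0 t : 0 < t -> (t%:E < r)%E -> A1 t * x t = f t.
  move=> t0 tr; apply/eqP; rewrite -subr_eq0; apply/eqP; move: t t0 tr.
  (* The difference of two solutions of the equation for [f] has this coefficient. Both solutions
     tend to 1, so it behaves like [- 1 / A1] near 0; [K] is obtained by dropping exactly this
     negative singular term. *)
  pose k t := (1 - A1 t * x t - f t) / A1 t - A1 t / B1 t ^+ 2.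
  pose K t := (- mu t + t * h t) / aa t - t * aa t / B t ^+ 2.
  apply: (@linear_ode_zero R (fun t => A1 t * x t - f t) k K r).
  - move=> t t0 tr; have [F' dF'] := dF t t0 tr; have [G' dG'] := dG t t0 tr.
    have [e _] := ode_of_instanton hT t0 tr inst dF' dG'.
    have dFf := is_der_sub dF' (df t t0).
    apply: (is_derive_eq dFf).
    move: e; rewrite /ode_p G0 // /k !FE // => /eqP; rewrite mulf_eq0 pnatr_eq0 /= => /eqP e.
    have [A0 B0] := G2_pos hG t0.
    have An0 : A1 t != 0 by rewrite gt_eqF.
    have B1n0 : B1 t != 0 by rewrite gt_eqF.
    move: e An0 B1n0; move: (1 + t * mu t) (A1 t) (B1 t) (f t) => F A b ft e An0 B1n0.
    have nz : A ^+ 2 * b ^+ 2 != 0 by rewrite mulf_neq0 // expf_neq0.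
    apply: (mulfI nz).
    have -> : A ^+ 2 * b ^+ 2 * (F' - ((ft - ft ^+ 2) / A - A * ft / b ^+ 2)) =
      (A ^+ 2 * b ^+ 2 * F' + (F ^+ 2 - F) * b ^+ 2 * A - (0 ^+ 2 - F) * A ^+ 3)
      - ((F ^+ 2 - F) * b ^+ 2 * A + F * A ^+ 3) - A * b ^+ 2 * (ft - ft ^+ 2) + A ^+ 3 * ft.
      by rewrite expr0n /=; field; rewrite An0 B1n0.
    by rewrite e; field; rewrite An0 B1n0.
  - move=> t t0 tr; rewrite -subr_ge0 /k /K FE // fh.
    rewrite AE ?ltW // BE ?ltW //; have tn0 : t != 0 by rewrite gt_eqF.
    have -> : (- mu t + t * h t) / aa t - t * aa t / B t ^+ 2 -
      ((1 - (1 + t * mu t) - (1 - t ^+ 2 * h t)) / (t * aa t) - t * aa t / B t ^+ 2) =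
      (t * aa t)^-1.
      by have := an0 t; have := Bn0 t => Bn an; field; rewrite tn0 an Bn.
    by rewrite invr_gt0 mulr_gt0.
  - move=> t t0 tr; have cmu := continuous_of_derivable (dmu _ t0 tr).
    apply: cvgB.
      apply: cvgM; last by apply: cvgV => //; exact: ca.
      apply: cvgD; first exact: cvgN.
      by apply: cvgM; [exact: cvg_id|exact: (smooth1_continuous sh)].
    apply: cvgM; first by apply: cvgM; [exact: cvg_id|exact: ca].
    apply: cvgV; first by rewrite expf_neq0.
    by apply: cvgM; exact: cB.
  (* Smooth extension over the singular orbit forces the limit 1 of [A1 x], which is also the value
     [f 0]. *)
  - rewrite [X in _ --> X](_ : _ = (1 + 0 * mu 0) - f 0); last first.
      by rewrite fh expr0n !mul0r addr0 subr0 subrr.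
    have cF0 : 1 + s * mu s - f s @[s --> (0 : R)^'+] --> 1 + 0 * mu 0 - f 0.
      apply: cvg_at_right_filter; apply: cvgB; last exact: (smooth1_continuous sf).
      apply: cvgD; first exact: cvg_cst.
      by apply: cvgM; [exact: cvg_id|exact: continuous_of_derivable (dmu _ (lexx 0) r0)].
    apply: cvg_trans cF0; apply: near_eq_cvg; apply: nearR0 => s s0 sr.
    by rewrite FE.
move=> z v Rz tv; have [t0 tr _ _] := Rz.
rewrite theta0_ansatz !ansatzE; apply: eq_bigr => i _.
by rewrite F0 // G0 // mulr0 /theta_x mulrA fE.
Qed.

End Family.

Theorem theorem4p8 (R : realType) (T : 3.-tuple 'rV[R]_4) (A1 B1 : R -> R)
    (b0 : R) (hT : standard_basis T) (hG : G2_data A1 B1 b0) :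
  inv_instanton_Pid T A1 B1 +oo%E (theta0 T A1 B1)
  /\ exists x y : R -> R,
       form_eq (Reg +oo%E) (theta0 T A1 B1) (ansatz T A1 B1 x y)
       /\ forall r : \bar R, (0 < r)%E ->
            Pid_family T A1 B1 r 0 x y
            /\ forall x' y' : R -> R, Pid_family T A1 B1 r 0 x' y' ->
                 form_eq (Reg r) (ansatz T A1 B1 x' y') (theta0 T A1 B1).
Proof.
split; first exact: (theta_inv_instanton hT hG).
exists (theta_x A1 B1), (fun=> 0); split; first by rewrite theta0_ansatz.
move=> r r0; split; last by move=> x' y' hxy; apply: (family_unique hT hG r0 hxy).
split; last exact: cvg_cst.
by rewrite -theta0_ansatz; exact: (theta_inv_instanton hT hG).
Qed.
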